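(* Let $\mathbf A$ be a complex Fréchet algebra. Using two independent parameters $\lambda$ and $\kappa$, define the bilinear map $\star:\mathcal D_{\mathbf A}(M)\times\mathcal D_{\mathbf A}(M)\to C^\infty(M,\mathbf A\otimes\mathcal A)$ by $$(f_1\star f_2)(z)=\kappa\int dz_1\,dz_2\ f_1(z_1)f_2(z_2)\,e^{2ia_0(\omega_0(x_2-x,w_1)+\omega_0(x-x_1,w_2)+\omega_0(x_1-x_2,w))}\,e^{2ia_0\lambda(\omega_1(\xi,\xi_1)+\omega_1(\xi_1,\xi_2)+\omega_1(\xi_2,\xi))},$$ for $f_1,f_2\in\mathcal D_{\mathbf A}(M)$ and $z=(x,\xi,w)\in M$, $z_i=(x_i,\xi_i,w_i)$. This map can be extended: - to Schwartz functions, $\star:\mathcal S_{\mathbf A}(M)\times\mathcal S_{\mathbf A}(M)\to\mathcal S_{\mathbf A}(M)$; - to the symbol calculus, $\star:\mathcal B^\mu_{\mathbf A}(M)\times\mathcal B^{\mu'}_{\mathbf A}(M)\to\mathcal B^{\tilde\mu\tilde\mu'}_{\mathbf A}(M)$, by using the oscillating integral, for weights $\mu$ and $\mu'$ bounded by a polynomial, with associated weights $\tilde\mu$ and $\tilde\mu'$; - as $\star:\mathcal B^\mu_{\mathbf A}(M)\times\mathcal S_{\mathbf A}(M)\to\mathcal S_{\mathbf A}(M)$ and $\star:\mathcal S_{\mathbf A}(M)\times\mathcal B^\mu_{\mathbf A}(M)\to\mathcal S_{\mathbf A}(M)$. Moreover, in each case the extended bilinear map is continuous for the topologies involved.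
   Context: Coordinates. $m$ is even, $n\ge0$, $a_0\in\mathbb R\setminus\{0\}$. $\mathcal A$ is a fixed real supercommutative superalgebra whose quotient by its nilpotents is $\mathbb R$ (e.g. $\bigwedge V$, $V$ an infinite-dimensional real vector space). $M\simeq\mathbb R^{m|n}=\mathcal A_0^m\times\mathcal A_1^n$ has coordinates $z=(x,\xi,w)$, with $x,w$ even with $m/2$ components each and $\xi=(\xi^1,\dots,\xi^n)$ odd. Its body is $\mathbb BM=\mathbb R^{m/2}\times\mathbb R^{m/2}\ni y=(x,w)$. Set $\omega_0(x,w)=x\cdot w$ and $\omega_1(\xi,\xi')=2\sum_i\xi^i\xi'^i$. An element of $C^\infty(M,\mathbf A\otimes\mathcal A)$ is a superfunction $f=\sum_If_I(x,w)\xi^I$ ($I\subset\{1,\dots,n\}$, $\xi^I$ ordered product) with $f_I\in C^\infty(\mathbb BM,\mathbf A)$ (extended to nilpotent arguments by Taylor expansion). Exponentials of odd bilinear expressions are finite power series. Berezin integration: $\int d\xi\,\xi^{\{1,\dots,n\}}c=c$ for $c$ independent of $\xi$ (possibly involving other odd variables), lower powers of $\xi$ integrate to $0$; $\int dz_1dz_2$ is the iterated integral $\int dz_1(\int dz_2\cdots)$ of Berezin integration combined with Lebesgue integration over $\mathbb BM$. Spaces. $(\mathbf A,|\cdot|_j)$ is a Fréchet algebra with continuous product. $\mathcal D_{\mathbf A}(M)$: components smooth with compact support. For $\mu\in C^\infty(\mathbb BM,\mathbb R^*_+)$, $\mathcal B^\mu_{\mathbf A}(M)$ is the Fréchet space of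 smooth $f$ with all $|f|^{(\mu)}_{j,\beta}=\sup_y\frac1{\mu(y)}\sum_I|D^\beta f_I(y)|_j$ finite. $\mu$ is a weight if $|D^\beta\mu|\le C_\beta\mu$ for all $\beta$. For a weight $\mu$ bounded by a polynomial, $\tilde\mu>\mu$ denotes an associated weight, also bounded by a polynomial, with $\mu(y+y_0)\le\tilde\mu(y)\tilde\mu(y_0)$ for all $y,y_0\in\mathbb BM$. $\mathcal S_{\mathbf A}(M)$ is the Fréchet space of smooth $f$ with all $\sup_y|\nu(y)|\sum_I|D^\beta f_I(y)|_j$ finite ($\nu$ polynomial). Oscillating integral. The extension of an integral against the quadratic phase, from compactly supported smooth functions to symbol spaces $\mathcal B^\mu$ with $\mu$ a weight bounded by a polynomial, which is continuous for the topology of $\mathcal B^{\mu'}$ for polynomially bounded weights $\mu'>\mu$ with $\mu/\mu'\to0$ at infinity. It is applied after the change of variables giving $(f_1\star f_2)(z)=\kappa\int dz_1dz_2\,f_1(z_1+z)f_2(z_2+z)e^{2ia_0(\omega_0(x_2,w_1)-\omega_0(x_1,w_2)+\lambda\omega_1(\xi_1,\xi_2))}$. *)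

(* Defs.v *)
From HB Require Import structures.
From mathcomp Require Import all_boot all_order all_algebra.
From mathcomp Require Import complex.
From mathcomp Require mpoly.
From mathcomp Require Import all_classical all_reals all_analysis.

Set Implicit Arguments.
Unset Strict Implicit.
Unset Printing Implicit Defensive.

Import Order.TTheory GRing.Theory Num.Theory.
Import numFieldNormedType.Exports.

Local Open Scope classical_set_scope.
Local Open Scope ring_scope.
Local Open Scope complex_scope.

HB.mixin Record isFrechet (R : realType) A of Tvs R[i] A := {
  semi : nat -> A -> R ;
  semiD : forall j x y, semi j (x + y) <= semi j x + semi j y ;
  semiZ : forall j c x, (semi j (c *: x))%:C = `|c| * (semi j x)%:C ;
  semi_separating : forall x, (forall j, semi j x = 0) -> x = 0 ;
  nbhs_semi : forall (x : A) (U : set A), nbhs x U <->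
    exists N e, 0 < e /\
      forall y, (forall j, (j <= N)%N -> semi j (y - x) < e) -> U y ;
  semi_complete : forall u : nat -> A,
    (forall j e, 0 < e -> exists N, forall p q,
       (N <= p)%N -> (N <= q)%N -> semi j (u p - u q) < e) ->
    exists l : A, u @ \oo --> l
}.

#[short(type="frechetType")]
HB.structure Definition Frechet (R : realType) :=
  {A of Tvs R[i] A & isFrechet R A}.

(* No unit is required: GRing.Algebra would impose one. *)
HB.mixin Record Frechet_isAlgebra (R : realType) A of Frechet R A := {
  fmul : A -> A -> A ;
  fmulA : associative fmul ;
  fmul_linearr : forall x, linear (fmul x) ;
  fmul_linearl : forall y, linear (fmul^~ y) ;
  fmul_continuous : continuous (fun xy : A * A => fmul xy.1 xy.2)
}.

#[short(type="frechetAlgType")]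
HB.structure Definition FrechetAlg (R : realType) :=
  {A of Frechet R A & Frechet_isAlgebra R A}.

Section FrechetTheory.
Context {R : realType} {A : frechetType R}.
Implicit Types x y : A.

Lemma semi0 j : semi j (0 : A) = 0.
Proof.
have := semiZ j 0 (0 : A); rewrite scale0r normr0 mul0r.
by move/(congr1 (@complex.Re R)).
Qed.

Lemma semiN j x : semi j (- x) = semi j x.
Proof.
have := semiZ j (- 1) x; rewrite scaleN1r normrN normr1 mul1r.
by move/(congr1 (@complex.Re R)).
Qed.

Lemma semi_ge0 j x : 0 <= semi j x.
Proof.
have := semiD j x (- x); rewrite subrr semi0 semiN -mulr2n.
by rewrite pmulrn_lge0.
Qed.

Lemma semi_normc j (c : R[i]) x : semi j (c *: x) = complex.Re `|c| * semi j x.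
Proof.
have := semiZ j c x; move/(congr1 (@complex.Re R)) => /= ->.
by rewrite mulr0 subr0.
Qed.

Lemma normc_ge0 (c : R[i]) : 0 <= complex.Re `|c|.
Proof. by have := normr_ge0 c; rewrite lecE => /andP[]. Qed.

Lemma frechet_hausdorff : hausdorff_space A.
Proof.
move=> x y xy; apply/eqP; rewrite -subr_eq0; apply/eqP.
apply: semi_separating => j; apply/eqP; rewrite eq_le semi_ge0 andbT.
apply/ler_addgt0Pl => e e0; rewrite addr0.
have e2 : 0 < e / 2 by rewrite divr_gt0.
have ball (z : A) : nbhs z [set w | semi j (w - z) < e / 2].
  by apply/nbhs_semi; exists j, (e / 2); split=> // w /(_ j (leqnn j)).
have [z [/= zx zy]] := xy _ _ (ball x) (ball y).
have -> : x - y = (z - y) - (z - x) by rewrite opprB [RHS]addrC addrA subrK.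
by rewrite (le_trans (semiD _ _ _))// semiN (splitr e) lerD// ltW.
Qed.

End FrechetTheory.

(* D^beta, for one differentiation operator per coordinate. *)
Definition iter_deriv d (W : Type) (der : 'I_d -> W -> W)
    (beta : 'I_d -> nat) (f : W) : W :=
  foldr (fun i => iter (beta i) (der i)) f (enum 'I_d).

Section RealCalculus.
Context {R : realType} {d : nat}.
Implicit Type mu : 'rV[R]_d -> R.

Definition rpartial (i : 'I_d) mu : 'rV[R]_d -> R :=
  'D_(delta_mx 0 i) mu.

Definition rsmooth mu := forall s : seq 'I_d,
  let g := foldr rpartial mu s in
  continuous g /\ forall i y, derivable g y (delta_mx 0 i).

Definition polyfun (P : mpoly.mpoly d R) (y : 'rV[R]_d) : R :=
  mpoly.meval (fun i => y 0 i) P.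

Definition weight (mu : 'rV[R]_d -> {posnum R}) :=
  let m := fun y => (mu y)%:num in
  rsmooth m /\ forall beta, exists C, forall y,
    `|iter_deriv rpartial beta m y| <= C * m y.

Definition poly_bounded (mu : 'rV[R]_d -> {posnum R}) :=
  exists P, forall y, (mu y)%:num <= polyfun P y.

Definition associated_weight (mu mut : 'rV[R]_d -> {posnum R}) :=
  [/\ weight mut, poly_bounded mut, forall y, (mu y)%:num < (mut y)%:num &
    forall y y0, (mu (y + y0))%:num <= (mut y)%:num * (mut y0)%:num].

Definition vanishes_at_infinity (g : 'rV[R]_d -> R) := forall e, 0 < e ->
  exists r, forall y, r <= `|y| -> `|g y| < e.

End RealCalculus.

Section VectorCalculus.
Context {R : realType} {A : frechetType R} {d : nat}.
Implicit Type f : 'rV[R]_d -> A.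

Definition partial_cvg (i : 'I_d) f y (l : A) :=
  (h^-1)%:C *: (f (y + h *: delta_mx 0 i) - f y) @[h --> (0 : R)^'] --> l.

(* The default value 0 is used where the derivative does not exist. *)
Definition partial (i : 'I_d) f : 'rV[R]_d -> A :=
  fun y => xget 0 (partial_cvg i f y).

Definition smooth f := forall s : seq 'I_d,
  let g := foldr partial f s in
  continuous g /\ forall i y, exists l, partial_cvg i g y l.

Definition compactly_supported f := compact (closure [set y | f y != 0]).

Lemma partialE i f y l : partial_cvg i f y l -> partial i f y = l.
Proof.
move=> fl; apply: xget_unique => // l' fl'.
exact: (cvg_unique frechet_hausdorff fl' fl).
Qed.

Lemma cvg_linear (U : Type) (F : set_system U) {FF : Filter F}
    (g h : U -> A) (c : R[i]) (a b : A) :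
  g u @[u --> F] --> a -> h u @[u --> F] --> b ->
  c *: g u + h u @[u --> F] --> c *: a + b.
Proof.
move=> ga hb.
apply: (@continuous2_cvg _ _ _ _ _ _ _ _ (fun x y : A => x + y)) => //.
  exact: (@add_continuous A (_, _)).
apply: (@continuous2_cvg _ R[i]^o _ _ _ _ (fun=> c) _
    (fun (k : R[i]^o) (x : A) => k *: x)) => //.
  exact: (@scale_continuous R[i] A (_, _)).
exact: cvg_cst.
Qed.

Lemma partial_cvg_linear i f g c y l l' : partial_cvg i f y l ->
  partial_cvg i g y l' -> partial_cvg i (c *: f + g) y (c *: l + l').
Proof.
move=> fl gl; rewrite /partial_cvg.
have -> : (fun h : R => (h^-1)%:C *:
      ((c *: f + g) (y + h *: delta_mx 0 i) - (c *: f + g) y)) =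
    (fun h => c *: ((h^-1)%:C *: (f (y + h *: delta_mx 0 i) - f y)) +
      (h^-1)%:C *: (g (y + h *: delta_mx 0 i) - g y)).
  apply/funext => h; rewrite !fctE /= scalerA [c * _]mulrC -scalerA -scalerDr.
  by congr (_ *: _); rewrite scalerBr opprD addrACA.
exact: cvg_linear.
Qed.

Lemma partial_linear i f g c : (forall y, exists l, partial_cvg i f y l) ->
  (forall y, exists l, partial_cvg i g y l) ->
  partial i (c *: f + g) = c *: partial i f + partial i g.
Proof.
move=> df dg; apply/funext => y; have [l fl] := df y; have [l' gl] := dg y.
rewrite !fctE (partialE fl) (partialE gl).
exact/partialE/partial_cvg_linear.
Qed.

Lemma foldr_partial_linear f g c s : smooth f -> smooth g ->
  foldr partial (c *: f + g) s = c *: foldr partial f s + foldr partial g s.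
Proof.
move=> sf sg; elim: s => //= i s ->; rewrite partial_linear// => y.
- by have [_] := sf s; exact.
- by have [_] := sg s; exact.
Qed.

Lemma partial_cvg0 i y : partial_cvg i (fun=> 0) y 0.
Proof.
rewrite /partial_cvg subrr.
under eq_fun do rewrite scaler0.
exact: cvg_cst.
Qed.

Lemma foldr_partial0 s : foldr partial (fun=> 0) s = fun=> 0.
Proof.
elim: s => //= i s ->; apply/funext => y.
exact/partialE/partial_cvg0.
Qed.

Lemma smooth0 : smooth (fun=> 0).
Proof.
move=> s /=; rewrite foldr_partial0.
split=> [|i y]; first exact: cst_continuous.
by exists 0; exact: partial_cvg0.
Qed.

Lemma smooth_linear c f g : smooth f -> smooth g -> smooth (c *: f + g).
Proof.
move=> sf sg s /=; rewrite foldr_partial_linear//.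
have [cf df] := sf s; have [cg dg] := sg s; split=> [y|i y].
  exact: cvg_linear (cf y) (cg y).
have [l fl] := df i y; have [l' gl] := dg i y.
by exists (c *: l + l'); exact: partial_cvg_linear.
Qed.

Lemma iter_deriv_partialE beta :
  exists s, forall g, iter_deriv partial beta g = foldr partial g s :> (_ -> A).
Proof.
rewrite /iter_deriv; elim: (enum 'I_d) => [|i e [s es]]; first by exists [::].
exists (nseq (beta i) i ++ s) => g /=; rewrite es foldr_cat.
by elim: (beta i) => //= n ->.
Qed.

End VectorCalculus.

(* f I y is the coefficient f_I(y) of xi^I.  The real supercommutative algebra
   in which the coordinates take their values does not occur: a superfunction
   on R^{d|n} amounts to the family of its coefficients, and only these enter
   the seminorms, the Berezin integral and the product. *)
Definition superfun (R : realType) (A : frechetType R) (d n : nat) : Type :=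
  {set 'I_n} -> 'rV[R]_d -> A.

HB.instance Definition _ (R : realType) (A : frechetType R) (d n : nat) :=
  GRing.Lmodule.copy (superfun A d n) ({set 'I_n} -> 'rV[R]_d -> A).

Section Spaces.
Context {R : realType} {A : frechetType R} {d n : nat}.
Implicit Types (f : superfun A d n) (g : 'rV[R]_d -> R) (beta : 'I_d -> nat).

Definition coef_norm j beta f y : R :=
  \sum_I semi j (iter_deriv partial beta (f I) y).

Definition sup_norm g j beta f : \bar R :=
  ereal_sup [set (g y * coef_norm j beta f y)%:E | y in [set: 'rV[R]_d]].

Definition supersmooth f := forall I, smooth (f I).

Definition test_fun f := forall I, smooth (f I) /\ compactly_supported (f I).

Definition symbol_norm (mu : 'rV[R]_d -> {posnum R})
    (jb : nat * ('I_d -> nat)) f := sup_norm (fun y => (mu y)%:num^-1) jb.1 jb.2 f.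

Definition schwartz_norm (njb : mpoly.mpoly d R * nat * ('I_d -> nat)) f :=
  sup_norm (fun y => `|polyfun njb.1.1 y|) njb.1.2 njb.2 f.

Definition symbol_set mu : set (superfun A d n) :=
  [set f | supersmooth f /\ forall jb, (symbol_norm mu jb f < +oo)%E].

Definition schwartz_set : set (superfun A d n) :=
  [set f | supersmooth f /\ forall njb, (schwartz_norm njb f < +oo)%E].

Lemma supersmooth_linear c f1 f2 :
  supersmooth f1 -> supersmooth f2 -> supersmooth (c *: f1 + f2).
Proof. by move=> s1 s2 I; exact: smooth_linear. Qed.

Lemma coef_norm_linear j beta c f1 f2 y :
  supersmooth f1 -> supersmooth f2 ->
  coef_norm j beta (c *: f1 + f2) y <=
    complex.Re `|c| * coef_norm j beta f1 y + coef_norm j beta f2 y.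
Proof.
move=> s1 s2; rewrite /coef_norm mulr_sumr -big_split /=; apply: ler_sum => I _.
have [s es] := iter_deriv_partialE (A := A) beta.
rewrite !es (foldr_partial_linear _ _ (s1 I) (s2 I)) -semi_normc.
exact: semiD.
Qed.

Lemma coef_norm0 j beta y : coef_norm j beta 0 y = 0.
Proof.
rewrite /coef_norm big1// => I _.
have [s ->] := iter_deriv_partialE (A := A) beta.
by rewrite foldr_partial0 semi0.
Qed.

Lemma sup_norm_linear_fin g j beta c f1 f2 : (forall y, 0 <= g y) ->
  supersmooth f1 -> supersmooth f2 -> (sup_norm g j beta f1 < +oo)%E ->
  (sup_norm g j beta f2 < +oo)%E -> (sup_norm g j beta (c *: f1 + f2)%R < +oo)%E.
Proof.
move=> g0 s1 s2 fin1 fin2.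
have bound f : (sup_norm g j beta f < +oo)%E ->
    exists C, forall y, g y * coef_norm j beta f y <= C.
  move=> fin; exists (fine (sup_norm g j beta f)) => y.
  have yf : ((g y * coef_norm j beta f y)%:E <= sup_norm g j beta f)%E.
    by apply: ereal_sup_ubound; exists y.
  rewrite -lee_fin fineK// fin_numElt fin andbT.
  by rewrite (lt_le_trans _ yf)// ltNyr.
have [C1 b1] := bound _ fin1; have [C2 b2] := bound _ fin2.
apply: (@le_lt_trans _ _ (complex.Re `|c| * C1 + C2)%:E); last exact: ltry.
apply: ge_ereal_sup => _ [y _ <-]; rewrite lee_fin.
rewrite (le_trans (ler_wpM2l (g0 y) (coef_norm_linear j beta c y s1 s2)))//.
by rewrite mulrDr mulrCA lerD// ler_wpM2l// normc_ge0.
Qed.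

Lemma sup_norm0_fin g j beta : (sup_norm g j beta 0%R < +oo)%E.
Proof.
apply: (@le_lt_trans _ _ 0%E); last exact: ltry.
by apply: ge_ereal_sup => _ [y _ <-]; rewrite coef_norm0 mulr0.
Qed.

Lemma supersmooth0 : supersmooth (0 : superfun A d n).
Proof. by move=> I; exact: smooth0. Qed.

Lemma symbol_submod mu : submod_closed (mem (symbol_set mu)).
Proof.
split=> [|c f1 f2]; rewrite !inE.
  by split=> [|jb]; [exact: supersmooth0|exact: sup_norm0_fin].
move=> [s1 fin1] [s2 fin2]; split=> [|jb]; first exact: supersmooth_linear.
by apply: sup_norm_linear_fin (fin1 _) (fin2 _).
Qed.

Lemma schwartz_submod : submod_closed (mem schwartz_set).
Proof.
split=> [|c f1 f2]; rewrite !inE.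
  by split=> [|jb]; [exact: supersmooth0|exact: sup_norm0_fin].
move=> [s1 fin1] [s2 fin2]; split=> [|jb]; first exact: supersmooth_linear.
by apply: sup_norm_linear_fin (fin1 _) (fin2 _).
Qed.

End Spaces.

(* A subbase of the topology defined by the family of seminorms p. *)
Definition seminorm_balls (R : realType) (E : zmodType) (J : Type)
    (p : J -> E -> \bar R) : set (set E) :=
  [set U | exists j (x : E) (e : R),
    0 < e /\ U = [set y | (p j (y - x)%R < e%:E)%E]].

Section SpaceTypes.
Context {R : realType} (A : frechetType R) {d : nat} (n : nat).

(* The set B^mu with the topology of the seminorms of B^mu'. *)
Definition symbols_for (mu' mu : 'rV[R]_d -> {posnum R}) : Type :=
  {f : superfun A d n | f \in symbol_set mu}.

Definition schwartz : Type := {f : superfun A d n | f \in schwartz_set}.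

Section Symbols.
Variables mu' mu : 'rV[R]_d -> {posnum R}.
HB.instance Definition _ := SubType.on (symbols_for mu' mu).
HB.instance Definition _ := [Choice of symbols_for mu' mu by <:].
HB.instance Definition _ := GRing.SubChoice_isSubLmodule.Build R[i]
  (superfun A d n) (fun f => f \in symbol_set mu) (symbols_for mu' mu)
  (symbol_submod mu).
HB.instance Definition _ := isSubBaseTopological.Build (symbols_for mu' mu)
  (seminorm_balls (fun jb (f : symbols_for mu' mu) =>
     symbol_norm mu' jb (val f))) id.
End Symbols.

HB.instance Definition _ := SubType.on schwartz.
HB.instance Definition _ := [Choice of schwartz by <:].
HB.instance Definition _ := GRing.SubChoice_isSubLmodule.Build R[i]
  (superfun A d n) (fun f => f \in schwartz_set) schwartz schwartz_submod.
HB.instance Definition _ := isSubBaseTopological.Build schwartz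
  (seminorm_balls (fun njb (f : schwartz) => schwartz_norm njb (val f))) id.

End SpaceTypes.

Notation symbols A n mu := (symbols_for A n mu mu).

Record measured_space (R : realType) := MeasuredSpace {
  ms_display : measure_display ;
  ms_carrier : measurableType ms_display ;
  ms_measure : {measure set ms_carrier -> \bar R}
}.

(* The product of d copies of the line with Lebesgue measure. *)
Fixpoint lebesgue_space (R : realType) (d : nat) : measured_space R :=
  if d is d'.+1 then
    @MeasuredSpace R _ _ (ms_measure (lebesgue_space R d') \x lebesgue_measure)%E
  else @MeasuredSpace R _ unit (@dirac _ unit tt R).

(* The coordinates of t are reversed; the product measure is symmetric. *)
Fixpoint row_of (R : realType) (d : nat) :
    ms_carrier (lebesgue_space R d) -> 'rV[R]_d :=
  if d is d'.+1 then
    fun t => row_mx (t.2 : R)%:M (row_of t.1) : 'rV_(1 + d')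
  else fun=> 0.

Section Bochner.
Context {R : realType} {A : frechetType R}.
Context {disp : measure_display} {T : measurableType disp}.
Variable m : {measure set T -> \bar R}.
Implicit Types (s : seq (set T * A)) (f : T -> A).

Definition simple s :=
  forall p, p \in s -> measurable p.1 /\ (m p.1 < +oo)%E.

Definition simple_eval s : T -> A :=
  fun x => \sum_(p <- s) (\1_(p.1) x)%:C *: p.2.

Definition simple_integral s : A :=
  \sum_(p <- s) (fine (m p.1))%:C *: p.2.

Definition bochner_integral f (v : A) := exists s : nat -> seq (set T * A),
  [/\ forall k, simple (s k),
      forall j k,
        measurable_fun setT (fun x => semi j (f x - simple_eval (s k) x)),
      forall j, (\int[m]_x (semi j (f x - simple_eval (s k) x)%R)%:E)%E
        @[k --> \oo] --> 0%E &
      simple_integral (s k) @[k --> \oo] --> v].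

End Bochner.

(* The default value 0 is used for functions that are not integrable. *)
Definition integral (R : realType) (A : frechetType R) (d : nat)
    (f : 'rV[R]_d -> A) : A :=
  xget 0 (bochner_integral (ms_measure (lebesgue_space R d)) (f \o @row_of R d)).

(* a K is the coefficient of the product of the generators th_i, i in K, taken
   in increasing order. *)
Definition grassmann (N : nat) (V : Type) : Type := {set 'I_N} -> V.

(* th^I th^J = (-1)^(inversions I J) th^(I u J) for disjoint I and J. *)
Definition inversions (N : nat) (I J : {set 'I_N}) : nat :=
  #|[pred p : 'I_N * 'I_N | [&& p.1 \in I, p.2 \in J & (p.2 < p.1)%N]]|.

Section Grassmann.
Context {N : nat}.

Definition gmul (U V : Type) (Z : zmodType) (op : U -> V -> Z)
    (a : grassmann N U) (b : grassmann N V) : grassmann N Z :=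
  fun K => \sum_(I : {set 'I_N} | I \subset K)
    op (a I) (b (K :\: I)%SET) *~ (-1) ^+ inversions I (K :\: I)%SET.

Definition gone (C : nzRingType) : grassmann N C := fun K => (K == finset.set0)%:R.

Definition gvar (C : nzRingType) (i : 'I_N) : grassmann N C :=
  fun K => (K == [set i]%SET)%:R.

Definition gexp (C : fieldType) (a : grassmann N C) : grassmann N C :=
  fun K => \sum_(k < N.+1) (k`!%:R)^-1 * iter k (gmul *%R a) (gone C) K.

(* Substitution of th for xi in \sum_I c_I xi^I. *)
Definition gsubst (C : nzRingType) (V : lmodType C) (n : nat)
    (c : {set 'I_n} -> V) (th : 'I_n -> grassmann N C) : grassmann N V :=
  fun K => \sum_(I : {set 'I_n})
    (\big[gmul *%R/gone C]_(i <- enum I) th i) K *: c I.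

(* Integration over the variables in S: the coefficient of th^S, once th^S is
   moved to the left. *)
Definition berezin (V : zmodType) (S : {set 'I_N}) (a : grassmann N V) :
    grassmann N V :=
  fun K => if [disjoint K & S] then a (S :|: K)%SET *~ (-1) ^+ inversions S K else 0.

End Grassmann.

Definition expi (R : realType) (t : R) : R[i] := cos t +i* sin t.

Definition omega0 (R : realType) (k : nat) (x w : 'rV[R]_k) : R :=
  \sum_i x 0 i * w 0 i.

Definition omega1 (C : nzRingType) (N n : nat)
    (a b : 'I_n -> grassmann N C) : grassmann N C :=
  fun K => 2 * \sum_i gmul *%R (a i) (b i) K.

(* The 3 n odd variables are xi, xi_1, xi_2, in this order. *)
Definition odd_index0 n (i : 'I_n) : 'I_(n + (n + n)) := lshift (n + n) i.
Definition odd_index1 n (i : 'I_n) : 'I_(n + (n + n)) := rshift n (lshift n i).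
Definition odd_index2 n (i : 'I_n) : 'I_(n + (n + n)) := rshift n (rshift n i).

Section StarProduct.
Context {R : realType} {A : frechetAlgType R} {k n : nat}.
Variables (a0 : R) (lambda kappa : R[i]).

Local Notation N := (n + (n + n))%N.
Local Notation G := (grassmann N).
(* A point of the body is y = (x, w) = row_mx x w. *)
Local Notation body := 'rV[R]_(k + k).
Local Notation xi0 := (fun i : 'I_n => gvar R[i] (odd_index0 i)).
Local Notation xi1 := (fun i : 'I_n => gvar R[i] (odd_index1 i)).
Local Notation xi2 := (fun i : 'I_n => gvar R[i] (odd_index2 i)).
Local Notation odd1 := [set odd_index1 i | i : 'I_n]%SET.
Local Notation odd2 := [set odd_index2 i | i : 'I_n]%SET.

Definition superintegral (S : {set 'I_N}) (F : body -> G A) : G A :=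
  berezin S (fun J => integral (fun y => F y J)).

Definition odd_product (c1 c2 : {set 'I_n} -> A)
    (th1 th2 : 'I_n -> G R[i]) (phase : G R[i]) : G A :=
  gmul (fun (a : A) (c : R[i]) => c *: a)
    (gmul fmul (gsubst c1 th1) (gsubst c2 th2))
    (gexp (fun K => (0 +i* (2 * a0)) * lambda * phase K)).

Definition star_integrand (f1 f2 : superfun A (k + k) n) (y y1 y2 : body) :
    G A :=
  let: (x, w) := (lsubmx y, rsubmx y) in
  let: (x1, w1) := (lsubmx y1, rsubmx y1) in
  let: (x2, w2) := (lsubmx y2, rsubmx y2) in
  fun J =>
    expi (2 * a0 * (omega0 (x2 - x) w1 + omega0 (x - x1) w2
                    + omega0 (x1 - x2) w)) *:
    odd_product (f1^~ y1) (f2^~ y2) xi1 xi2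
      (fun K => omega1 xi0 xi1 K + omega1 xi1 xi2 K + omega1 xi2 xi0 K) J.

Definition star (f1 f2 : superfun A (k + k) n) : superfun A (k + k) n :=
  fun K y => kappa *:
    superintegral odd1 (fun y1 => superintegral odd2 (fun y2 =>
      star_integrand f1 f2 y y1 y2)) [set odd_index0 i | i in K]%SET.

(* e^{2 i a0 (omega0 (x2, w1) - omega0 (x1, w2))} at Y = (y1, y2) *)
Definition quadratic_phase (Y : 'rV[R]_((k + k) + (k + k))) : R[i] :=
  let: (x1, w1) := (lsubmx (lsubmx Y), rsubmx (lsubmx Y)) in
  let: (x2, w2) := (lsubmx (rsubmx Y), rsubmx (rsubmx Y)) in
  expi (2 * a0 * (omega0 x2 w1 - omega0 x1 w2)).

(* A-valued functions on the body of M x M are superfunctions without odd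
   variables; set0 indexes their only coefficient. *)
Definition is_oscillating_integral
    (mu : 'rV[R]_((k + k) + (k + k)) -> {posnum R})
    (L : {linear symbols A 0 mu -> A}) :=
  (forall F : symbols A 0 mu, test_fun (val F) ->
    L F = integral (fun y1 : body => integral (fun y2 : body =>
      quadratic_phase (row_mx y1 y2) *:
        val F finset.set0 (row_mx y1 y2)))) /\
  forall mu', weight mu' -> poly_bounded mu' ->
    (forall Y, (mu Y)%:num < (mu' Y)%:num) ->
    vanishes_at_infinity (fun Y => (mu Y)%:num / (mu' Y)%:num) ->
    continuous (L : symbols_for A 0 mu' mu -> A).

(* The part of f1(z1 + z) f2(z2 + z) e^{2 i a0 lambda omega1(xi1, xi2)}
   multiplied by th^J. *)
Definition shifted_integrand (f1 f2 : superfun A (k + k) n) (y : body)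
    (J : {set 'I_N}) : superfun A ((k + k) + (k + k)) 0 :=
  fun _ Y =>
    odd_product (f1^~ (lsubmx Y + y)) (f2^~ (rsubmx Y + y))
      (fun i K => xi1 i K + xi0 i K) (fun i K => xi2 i K + xi0 i K)
      (omega1 xi1 xi2) J.

(* h = f1 * f2 in the sense of oscillating integrals. *)
Definition oscillating_star (f1 f2 h : superfun A (k + k) n) :=
  exists (mu : 'rV[R]_((k + k) + (k + k)) -> {posnum R})
         (L : {linear symbols A 0 mu -> A})
         (F : body -> {set 'I_N} -> symbols A 0 mu),
    [/\ weight mu, poly_bounded mu, is_oscillating_integral L,
        forall y J, val (F y J) = shifted_integrand f1 f2 y J &
        forall K y, h K y = kappa *:
          berezin odd1 (berezin odd2 (fun J => L (F y J)))
            [set odd_index0 i | i in K]%SET].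

End StarProduct.

(* Main.v *)
Require Import Defs.
From HB Require Import structures.
From mathcomp Require Import all_boot all_order all_algebra.
From mathcomp Require Import complex ring lra.
From mathcomp Require mpoly finmap.
From mathcomp Require Import all_classical all_reals all_analysis.
From mathcomp Require Import measurable_realfun.
Set Implicit Arguments.
Unset Strict Implicit.
Unset Printing Implicit Defensive.
Import Order.TTheory GRing.Theory Num.Theory.
Import numFieldNormedType.Exports.
Import (canonicals, coercions) mpoly finmap.
Local Open Scope classical_set_scope.
Local Open Scope ring_scope.
Local Open Scope complex_scope.

(* The phase E of the integral satisfies d_i E = i c_i y_(sigma i) E, where sigma
   exchanges conjugate coordinates, so E = (E + d_i E) / (1 + i c_i y_(sigma i)) and
   an integration by parts replaces F by (F - d_i F) / (1 + i c_i y_(sigma i)).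
   Each sweep over all coordinates gains a factor rho^-1, rho y = prod_i (1 + |y_i|),
   which defines the oscillating integral L on all functions of polynomial growth
   and bounds it by finitely many derivatives.  The Berezin integral is invariant
   under the translation of the odd variables, as the Lebesgue integral is under
   that of the even ones; hence the star product is a finite linear combination of
   the functions y |-> L (f1 (. + y) f2 (. + y)).  Their derivatives obey Leibniz'
   rule, so the growth of f1 and f2 under translations controls all the seminorms
   of the product, and a bilinear map bounded on seminorms is continuous. *)

(** The phase contains no squares: each coordinate multiplies only its conjugate. Hence the factor
    [1 / (1 + i c_i y_(sigma i))] is constant in the direction [i] of its own integration by parts,
    and its derivatives in later steps are polynomials in the factor itself, so they lose no decay.

    The value of [integral] is a default unless simple functions approximate the integrand in every
    seminorm, so that not even additivity is free. All integrals are therefore taken of continuous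
    functions with decay [rho ^- 2], which step functions on grids approximate in all seminorms at
    once; in exchange, the powers of [rho] lost by differentiating the phase have to be counted.

    Smoothness, in turn, only speaks of limits along the coordinate axes. A mean value inequality
    for each seminorm replaces Taylor's formula, and a function given by an integral is shown to be
    smooth by placing it in a class stable under differentiation.

    A single functional on functions of polynomial growth serves all the spaces: the four products
    are restrictions of one formula, and their continuity is four times an instance of
    [star_extension]. *)

(** * A decision procedure for abelian groups *)

Inductive zmod_term :=
  | ZAtom of nat | ZZero | ZAdd of zmod_term & zmod_term | ZOpp of zmod_term.

Fixpoint zmod_eval (V : zmodType) (env : seq V) t : V :=
  match t with
  | ZAtom i => env`_i
  | ZZero => 0
  | ZAdd t1 t2 => zmod_eval env t1 + zmod_eval env t2
  | ZOpp t1 => - zmod_eval env t1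
  end.

Fixpoint zmod_coef t (i : nat) : int :=
  match t with
  | ZAtom k => (i == k)%:R
  | ZZero => 0
  | ZAdd t1 t2 => zmod_coef t1 i + zmod_coef t2 i
  | ZOpp t1 => - zmod_coef t1 i
  end.

Fixpoint zmod_bound t : nat :=
  match t with
  | ZAtom k => k.+1
  | ZZero => 0%N
  | ZAdd t1 t2 => maxn (zmod_bound t1) (zmod_bound t2)
  | ZOpp t1 => zmod_bound t1
  end.

Lemma zmod_evalE (V : zmodType) (env : seq V) t n : (zmod_bound t <= n)%N ->
  zmod_eval env t = \sum_(i < n) env`_i *~ zmod_coef t i.
Proof.
elim: t => [k|t|t1 IH1 t2 IH2|t IH] /=.
- move=> kn; rewrite (bigD1 (Ordinal kn))//= eqxx mulr1z big1 ?addr0// => i.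
  by rewrite -val_eqE /= => /negPf ->; rewrite mulr0z.
- by rewrite big1// => i _; rewrite mulr0z.
- rewrite geq_max => /andP[/IH1 -> /IH2 ->]; rewrite -big_split /=.
  by apply: eq_bigr => i _; rewrite mulrzDr.
- by move/IH ->; rewrite -sumrN; apply: eq_bigr => i _; rewrite mulrNz.
Qed.

(** Reflection: the hypothesis compares integer coefficients atom by atom, a closed computation that
    reduces to [true], so that the tactic [zmod] below proves it by [isT]. *)
Lemma zmod_eval_eq (V : zmodType) (env : seq V) t1 t2 :
  all (fun i => zmod_coef t1 i == zmod_coef t2 i)
    (iota 0 (maxn (zmod_bound t1) (zmod_bound t2))) ->
  zmod_eval env t1 = zmod_eval env t2.
Proof.
move=> /allP H; rewrite (zmod_evalE env (leq_maxl _ (zmod_bound t2))).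
rewrite (zmod_evalE env (leq_maxr (zmod_bound t1) _)).
by apply: eq_bigr => i _; rewrite (eqP (H i _))// mem_iota /=.
Qed.

(* Atoms are compared up to conversion, as the same element may be displayed
   through different paths of the algebraic hierarchy. *)
Ltac zmod_index x l :=
  lazymatch l with
  | ?z :: ?l' =>
      match constr:(Set) with
      | _ => let _ := match constr:(Set) with _ => unify x z end in constr:(0%N)
      | _ => let k := zmod_index x l' in constr:(k.+1)
      end
  end.
Ltac zmod_insert x l :=
  match constr:(Set) with
  | _ => let _ := zmod_index x l in l
  | _ => constr:(x :: l)
  end.
Ltac zmod_atoms t l :=
  lazymatch t with
  | (?a + ?b)%R => let l1 := zmod_atoms b l in zmod_atoms a l1
  | (- ?a)%R => zmod_atoms a l
  | (0)%R => l
  | _ => zmod_insert t l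
  end.
Ltac zmod_quote t l :=
  lazymatch t with
  | (?a + ?b)%R =>
      let a' := zmod_quote a l in let b' := zmod_quote b l in constr:(ZAdd a' b')
  | (- ?a)%R => let a' := zmod_quote a l in constr:(ZOpp a')
  | (0)%R => constr:(ZZero)
  | _ => let k := zmod_index t l in constr:(ZAtom k)
  end.
(* Decides equalities that hold in every abelian group. *)
Ltac zmod :=
  lazymatch goal with
  | |- @eq ?V ?a ?b =>
      let l0 := zmod_atoms b (@nil V) in
      let l := zmod_atoms a l0 in
      let ta := zmod_quote a l in let tb := zmod_quote b l in
      exact: (@zmod_eval_eq _ l ta tb isT)
  end.

(** * Seminorms and partial derivatives *)

Section ComplexModulus.
Context {R : realType}.
Implicit Types (c : R[i]) (r : R).

Definition cmod c : R := complex.Re `|c|.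

Lemma cmodE c : (cmod c)%:C = `|c|.
Proof. by rewrite /cmod; case: c => a b; rewrite normc_def. Qed.

Lemma cmod_ge0 c : 0 <= cmod c. Proof. exact: normc_ge0. Qed.

Lemma cmodM c1 c2 : cmod (c1 * c2) = cmod c1 * cmod c2.
Proof. by apply: (@complexI R); rewrite rmorphM/= !cmodE normrM. Qed.

Lemma cmodD c1 c2 : cmod (c1 + c2) <= cmod c1 + cmod c2.
Proof. by rewrite -lecR rmorphD/= !cmodE ler_normD. Qed.

Lemma cmodN c : cmod (- c) = cmod c.
Proof. by rewrite /cmod normrN. Qed.

Lemma cmod_real r : cmod r%:C = `|r|.
Proof. by rewrite /cmod normc_def /= expr0n /= addr0 sqrtr_sqr. Qed.

Lemma cmod0 : cmod 0 = 0. Proof. by rewrite /cmod normr0. Qed.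
Lemma cmod1 : cmod 1 = 1. Proof. by rewrite /cmod normr1. Qed.

Lemma cmodV c : cmod c^-1 = (cmod c)^-1.
Proof. by apply: (@complexI R); rewrite fmorphV/= !cmodE normfV. Qed.

Lemma cmod_sqr c : cmod c ^+ 2 = complex.Re c ^+ 2 + complex.Im c ^+ 2.
Proof.
case: c => a b; rewrite /cmod normc_def /= sqr_sqrtr//.
by rewrite addr_ge0// sqr_ge0.
Qed.

End ComplexModulus.

Section Seminorms.
Context {R : realType} {A : frechetType R}.
Implicit Types x y : A.

Lemma semiZc j (c : R[i]) x : semi j (c *: x) = cmod c * semi j x.
Proof. exact: semi_normc. Qed.

Lemma semiZr j (r : R) x : semi j (r%:C *: x) = `|r| * semi j x.
Proof. by rewrite semiZc cmod_real. Qed.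

Lemma scale_realBl (s t : R) x : (s - t)%:C *: x = s%:C *: x - t%:C *: x.
Proof. by rewrite rmorphB/= scalerBl. Qed.

Lemma scale_realDl (s t : R) x : (s + t)%:C *: x = s%:C *: x + t%:C *: x.
Proof. by rewrite rmorphD/= scalerDl. Qed.

Lemma semiB j x y : semi j (x - y) <= semi j x + semi j y.
Proof. by rewrite (le_trans (semiD _ _ _))// semiN. Qed.

Lemma semi_distrC j x y : semi j (x - y) = semi j (y - x).
Proof. by rewrite -semiN opprB. Qed.

Lemma semi_dist_le j x y z : semi j (x - z) <= semi j (x - y) + semi j (y - z).
Proof. by have := semiD j (x - y) (y - z); rewrite addrA subrK. Qed.

Lemma cvg_semiP (T : Type) (F : set_system T) {FF : Filter F} (f : T -> A) l :
  f u @[u --> F] --> l <->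
  forall j e, 0 < e -> \forall u \near F, semi j (f u - l) < e.
Proof.
split=> [fl j e e0|fl].
  have : nbhs l [set w | semi j (w - l) < e].
    by apply/nbhs_semi; exists j, e; split=> // w /(_ j (leqnn j)).
  exact: fl.
move=> U /= /nbhs_semi[N [e [e0 eU]]].
have : \forall u \near F, forall j, (j <= N)%N -> semi j (f u - l) < e.
  elim: N {eU} => [|N IH].
    by apply: filterS (fl 0%N e e0) => u fu j; rewrite leqn0 => /eqP ->.
  apply: filterS2 (fl N.+1 e e0) IH => u fu Hu j.
  by rewrite leq_eqVlt => /orP[/eqP ->//|]; rewrite ltnS; exact: Hu.
by apply: filterS => u Hu; exact: eU.
Qed.

Lemma semi_eq0 x : (forall j e, 0 < e -> semi j x <= e) -> x = 0.
Proof.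
move=> xe; apply: semi_separating => j; apply/eqP.
rewrite eq_le semi_ge0 andbT; apply/ler_addgt0Pl => e e0.
by rewrite addr0; exact: xe.
Qed.

End Seminorms.

(** * Mean value inequality in one seminorm *)

Section MeanValue.
Context {R : realType} {A : frechetType R}.

(** Differentiability at [t] as seen by the single seminorm [j]. A Fréchet space has no norm, and
    the mean value inequality is proved for one seminorm at a time. *)
Definition expands_at j (phi : R -> A) (l : A) (t : R) :=
  forall e, 0 < e -> exists2 del, 0 < del & forall s, `|s - t| < del ->
    semi j (phi s - phi t - (s - t)%:C *: l) <= e * `|s - t|.

Lemma expands_at_dist j (phi : R -> A) l t M e :
  expands_at j phi l t -> semi j l <= M -> 0 < e ->
  exists2 del, 0 < del & forall s, `|s - t| < del ->
    semi j (phi s - phi t) <= (M + e) * `|s - t|.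
Proof.
move=> H lM e0; have [del d0 Hd] := H e e0; exists del => // s /Hd st.
rewrite -[phi s - phi t](subrK ((s - t)%:C *: l)) (le_trans (semiD _ _ _))//.
rewrite semiZr mulrDl addrC lerD// mulrC ler_wpM2r//.
Qed.

(** Continuous induction on [[a, b]]: the supremum [c] of the points up to which the bound with
    slope [M + e] holds is [b], because the slack [e] absorbs the remainder of the expansion at [c]
    on both sides. *)
Lemma mean_value_ineq j (phi phi' : R -> A) a b M : a <= b ->
  (forall t, a <= t <= b -> expands_at j phi (phi' t) t) ->
  (forall t, a <= t <= b -> semi j (phi' t) <= M) ->
  semi j (phi b - phi a) <= M * (b - a).
Proof.
move=> ab dphi bphi.
apply/ler_addgt0Pr => e' e'0.
pose e := e' / (b - a + 1).
have ba1 : 0 < b - a + 1 by rewrite ltr_wpDl// subr_ge0.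
have e0 : 0 < e by rewrite divr_gt0.
suff : semi j (phi b - phi a) <= (M + e) * (b - a).
  move=> /le_trans; apply; rewrite mulrDl lerD2l /e -mulrA ler_piMr//; first exact: ltW.
  by rewrite mulrC ler_pdivrMr// mul1r lerDl.
pose P t := semi j (phi t - phi a) <= (M + e) * (t - a).
pose S := [set t | a <= t <= b /\ forall s, a <= s <= t -> P s].
have Pa : P a by rewrite /P !subrr semi0 mulr0.
have Sa : S a.
  split; first by rewrite lexx.
  by move=> s; rewrite -eq_le => /eqP <-.
have ubS : ubound S b by move=> t [/andP[]].
have supS : has_sup S by split; [exists a|exists b].
set c := sup S.
have ac : a <= c by exact: ub_le_sup supS.2 _ Sa.
have cb : c <= b by apply: ge_sup => //; exists a.
have cab : a <= c <= b by rewrite ac cb.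
have [del d0 Hd] := expands_at_dist (dphi c cab) (bphi c cab) e0.
have Pltc s : a <= s -> s < c -> P s.
  move=> as_ sc; have [t [tab tS] st] := sup_gt (ex_intro _ a Sa) sc.
  by apply: tS; rewrite as_ ltW.
have step s t : P s -> s <= t -> semi j (phi t - phi s) <= (M + e) * (t - s) -> P t.
  move=> Ps st H; rewrite /P (le_trans (semi_dist_le _ _ (phi s) _))//.
  by rewrite (le_trans (lerD H Ps))// -mulrDr addrA subrK.
have Pc : P c.
  have [->//|nac] := eqVneq c a.
  have lac : a < c by rewrite lt_neqAle eq_sym nac.
  pose s := Num.max a (c - del / 2).
  have sc : s < c by rewrite gt_max lac gtrBl divr_gt0.
  have as_ : a <= s by rewrite le_max lexx.
  apply: (step s); [exact: Pltc|exact: ltW|].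
  rewrite semi_distrC; have := Hd s; rewrite distrC gtr0_norm ?subr_gt0//; apply.
  have : c - del / 2 <= s by rewrite le_max lexx orbT.
  by move: d0; lra.
have Sc : S c.
  split=> // s /andP[as_]; rewrite le_eqVlt => /orP[/eqP ->//|]; exact: Pltc.
have [<-//|ncb] := eqVneq c b.
have lcb : c < b by rewrite lt_neqAle ncb.
pose t := Num.min b (c + del / 2).
have ct : c < t by rewrite lt_min lcb ltrDl divr_gt0.
suff : S t by move=> /(ub_le_sup supS.2); rewrite leNgt ct.
split; first by rewrite (le_trans ac (ltW ct)) ge_min lexx.
move=> s /andP[as_ st]; have [sc|cs] := ltP s c; first exact: Pltc.
apply: (step c) => //; have := Hd s; rewrite ger0_norm ?subr_ge0//; apply.
have : t <= c + del / 2 by rewrite ge_min lexx orbT.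
by move: d0 st; lra.
Qed.

End MeanValue.

Section Partial.
Context {R : realType} {A : frechetType R} {d : nat}.
Implicit Types (f g : 'rV[R]_d -> A) (y h : 'rV[R]_d).
Local Notation e_ i := (delta_mx 0 i : 'rV[R]_d).

Lemma partial_cvgP i f y l : partial_cvg i f y l <->
  forall j e, 0 < e -> exists2 del, 0 < del & forall h : R, `|h| < del ->
    semi j (f (y + h *: e_ i) - f y - h%:C *: l) <= e * `|h|.
Proof.
split=> [/cvg_semiP fl j e e0|fl].
  have := fl j e e0; rewrite near_withinE => /nbhs_ballP[del d0 Hd].
  exists del => // h hd; have [->|h0] := eqVneq h 0.
    by rewrite scale0r addr0 subrr scale0r subr0 semi0 normr0 mulr0.
  have := Hd h; rewrite /ball/= sub0r normrN => /(_ hd h0) /ltW H.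
  rewrite (_ : _ - _ = h%:C *: ((h^-1)%:C *: (f (y + h *: e_ i) - f y) - l)).
    by rewrite semiZr mulrC ler_wpM2r.
  by rewrite [RHS]scalerBr scalerA -rmorphM/= divff// scale1r.
apply/cvg_semiP => j e e0; have e20 : 0 < e / 2 by rewrite divr_gt0.
have [del d0 Hd] := fl j _ e20.
rewrite near_withinE; apply/nbhs_ballP; exists del => // h.
rewrite /ball/= sub0r normrN => /Hd H h0.
rewrite (_ : _ - _ = (h^-1)%:C *: (f (y + h *: e_ i) - f y - h%:C *: l)).
  rewrite semiZr normfV ltr_pdivrMl ?normr_gt0// (le_lt_trans H)//.
  by rewrite mulrC ltr_pM2l ?normr_gt0// ltr_pdivrMr// ltr_pMr// ltr1n.
by rewrite [RHS]scalerBr scalerA -rmorphM/= mulVf// scale1r.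
Qed.

Lemma partial_expands i f y l t j : partial_cvg i f (y + t *: e_ i) l ->
  expands_at j (fun s => f (y + s *: e_ i)) l t.
Proof.
move=> /partial_cvgP H e e0; have [del d0 Hd] := H j e e0.
exists del => // s /Hd; rewrite -(addrA y) -scalerDl.
by rewrite [t + _]addrC subrK.
Qed.

(** The mean value inequality for [f - t l] along a line. With [l = 0] it is a Lipschitz bound; with
    [l] the derivative at [y] it is Taylor's formula, [M] bounding the oscillation of the
    derivative. *)
Lemma partial_mean_value j i f (g : 'rV[R]_d -> A) y (h : R) l M :
  (forall t, `|t| <= `|h| -> partial_cvg i f (y + t *: e_ i) (g (y + t *: e_ i))) ->
  (forall t, `|t| <= `|h| -> semi j (g (y + t *: e_ i) - l) <= M) ->
  semi j (f (y + h *: e_ i) - f y - h%:C *: l) <= M * `|h|.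
Proof.
move=> df bg.
pose phi t := f (y + t *: e_ i) - t%:C *: l.
have dphi t : `|t| <= `|h| -> expands_at j phi (g (y + t *: e_ i) - l) t.
  move=> th e e0; have [del d0 Hd] := partial_expands j (df t th) e0.
  exists del => // s /Hd; rewrite /phi.
  rewrite scalerBr !scale_realBl.
  set u := (X in semi _ X <= _ -> _); set v := (X in _ -> semi _ X <= _).
  by rewrite (_ : u = v)//; rewrite /u /v; zmod.
have phi0 : phi 0 = f y by rewrite /phi scale0r addr0 scale0r subr0.
have -> : f (y + h *: e_ i) - f y - h%:C *: l = phi h - phi 0.
  by rewrite phi0 /phi; zmod.
have [h0|h0] := leP 0 h.
  have th t : 0 <= t <= h -> `|t| <= `|h| by move=> /andP[t0 ?]; rewrite !ger0_norm.
  rewrite (ger0_norm h0) -{2}(subr0 h).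
  by apply: (mean_value_ineq h0 (phi' := fun t => g (y + t *: e_ i) - l)) => t /th;
    [exact: dphi|exact: bg].
have th t : h <= t <= 0 -> `|t| <= `|h|.
  by move=> /andP[ht t0]; rewrite !ler0_norm ?lerN2// ltW.
rewrite semi_distrC (ltr0_norm h0) -(sub0r h).
by apply: (mean_value_ineq (ltW h0) (phi' := fun t => g (y + t *: e_ i) - l)) => t /th;
  [exact: dphi|exact: bg].
Qed.

Lemma continuous_semiP f y : {for y, continuous f} <->
  forall j e, 0 < e -> exists2 del, 0 < del & forall h : 'rV[R]_d, `|h| < del ->
    semi j (f (y + h) - f y) < e.
Proof.
have FF : Filter (nbhs y) by exact: nbhs_filter.
split=> [/(cvg_semiP (FF := FF)) H j e e0|H].
  have /nbhs_ballP[del d0 Hd] := H j e e0.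
  exists del => // h hd; apply: Hd.
  by rewrite -ball_normE /= opprD addrA subrr sub0r normrN.
apply/(cvg_semiP (FF := FF)) => j e e0; have [del d0 Hd] := H j e e0.
apply/nbhs_ballP; exists del => // z.
by rewrite -ball_normE /= distrC => /Hd; rewrite [y + _]addrC subrK.
Qed.

Lemma rV_coord_le (h : 'rV[R]_d) i : `|h 0 i| <= `|h|.
Proof.
rewrite [leRHS]/Num.norm/= mx_normrE.
exact: (le_bigmax _ (fun k : 'I_1 * 'I_d => `|h k.1 k.2|) (0, i)).
Qed.

(** The path from [y] to [y + h] changes one coordinate at a time: [p m] has moved the first [m] of
    them. It stays in the box [|z_k - y_k| <= |h_k|], where the derivatives are bounded. *)
Lemma semi_lipschitz j f (g : 'I_d -> 'rV[R]_d -> A) (B : R) y h :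
  (forall i z, partial_cvg i f z (g i z)) ->
  (forall i (z : 'rV[R]_d), (forall k, `|z 0 k - y 0 k| <= `|h 0 k|) -> semi j (g i z) <= B) ->
  semi j (f (y + h) - f y) <= B * \sum_i `|h 0 i|.
Proof.
move=> df bg.
pose p m := y + \row_k (if (k < m)%N then h 0 k else 0).
have H m : (m <= d)%N -> semi j (f (p m) - f y) <= B * \sum_(i < d | (i < m)%N) `|h 0 i|.
  elim: m => [|m IH] md.
    have -> : p 0%N = y.
      by apply/rowP => k; rewrite !mxE ltn0 addr0.
    by rewrite subrr semi0 big1 ?mulr0// => i; rewrite ltn0.
  have pS : p m.+1 = p m + h 0 (Ordinal md) *: e_ (Ordinal md).
    apply/rowP => k; rewrite !mxE eqxx andTb -val_eqE /= ltnS leq_eqVlt -addrA; congr (_ + _).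
    have [e|ne] := eqVneq (k : nat) m => /=.
      rewrite e ltnn add0r mulr1; congr (h 0 _); exact: val_inj.
    by rewrite mulr0 addr0.
  rewrite (le_trans (semi_dist_le _ _ (f (p m)) _))//.
  rewrite (bigD1 (Ordinal md))/= ?ltnSn// mulrDr lerD//.
    rewrite pS; set i := Ordinal md.
    have := @partial_mean_value j i f (g i) (p m) (h 0 i) 0 B.
    rewrite scaler0 subr0; apply; first by move=> t _; exact: df.
    move=> t th; rewrite subr0; apply: bg => k.
    rewrite !mxE eqxx andTb -val_eqE /=; have [km|ne] := eqVneq (k : nat) m.
      have -> : k = i by exact: val_inj.
      by rewrite /= ltnn addr0 mulr1 [y 0 i + _]addrC addrK.
    rewrite mulr0 addr0 [y 0 k + _]addrC addrK; case: ifP => // _.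
    by rewrite normr0.
  rewrite (le_trans (IH (ltnW md)))//.
  rewrite le_eqVlt; apply/orP; left; apply/eqP; congr (_ * _).
  by apply: eq_bigl => k; rewrite -val_eqE /= ltnS [LHS]ltn_neqAle andbC.
have := H d (leqnn d).
have -> : p d = y + h by apply/rowP => k; rewrite !mxE ltn_ord.
by move=> /le_trans; apply; rewrite (eq_bigl xpredT)// => k; rewrite ltn_ord.
Qed.

End Partial.

Section Smooth.
Context {R : realType} {A : frechetType R} {d : nat}.
Implicit Types (f g : 'rV[R]_d -> A) (y h : 'rV[R]_d).
Local Notation e_ i := (delta_mx 0 i : 'rV[R]_d).

Definition translate h f : 'rV[R]_d -> A := fun y => f (y + h).

Lemma smooth_partial_cvg f s i y : smooth f ->
  partial_cvg i (foldr partial f s) y (foldr partial f (i :: s) y).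
Proof. by move=> /(_ s)[_ /(_ i y)] H; exact: xgetPex. Qed.

Lemma smooth_partial_cvg0 f i y : smooth f -> partial_cvg i f y (partial i f y).
Proof. by move=> sf; exact: (@smooth_partial_cvg f [::]). Qed.

Lemma smooth_foldr f s : smooth f -> smooth (foldr partial f s).
Proof. by move=> sf t; rewrite -foldr_cat; exact: sf. Qed.

Lemma smooth_partial f i : smooth f -> smooth (partial i f).
Proof. exact: (@smooth_foldr f [:: i]). Qed.

Lemma smooth_continuous f : smooth f -> continuous f.
Proof. by move=> /(_ [::])[]. Qed.

Lemma partial_cvg_translate f i y h l :
  partial_cvg i f (y + h) l -> partial_cvg i (translate h f) y l.
Proof.
by rewrite /partial_cvg /translate; under eq_fun do rewrite addrAC.
Qed.

(** Coinduction principle: [smooth] quantifies over all words of derivatives, so a class of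
    continuous functions that is stable under differentiation contains only smooth ones. The second
    conclusion keeps the class available for bounding the derivatives. *)
Lemma smooth_coind (P : ('rV[R]_d -> A) -> Prop) :
  (forall f, P f -> continuous f) ->
  (forall f i, P f -> exists2 g, P g & forall y, partial_cvg i f y (g y)) ->
  forall f, P f -> smooth f /\ forall s, P (foldr partial f s).
Proof.
move=> cP dP f Pf; have HP s : P (foldr partial f s).
  elim: s => //= i s /dP -/(_ i)[g Pg Hg].
  by rewrite (_ : partial i _ = g)//; apply/funext => y; exact: partialE.
split=> // s; split=> [|i y]; first exact/cP/HP.
by have [g _ Hg] := dP _ i (HP s); exists (g y); exact: Hg.
Qed.

Lemma smooth_translate f h : smooth f -> smooth (translate h f).
Proof.
move=> sf; apply: (@smooth_coind (fun g => exists2 f, smooth f & g = translate h f) _ _ _ _).1.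
- move=> _ [g sg ->] y; apply/continuous_semiP => j e e0.
  have /continuous_semiP/(_ j e e0)[del d0 Hd] : {for y + h, continuous g} by
    exact: smooth_continuous.
  by exists del => // z /Hd; rewrite /translate addrAC.
- move=> _ i [g sg ->]; exists (translate h (partial i g)).
    by exists (partial i g) => //; exact: smooth_partial.
  by move=> y; apply: partial_cvg_translate; exact: smooth_partial_cvg0.
- by exists f.
Qed.

Lemma foldr_partial_translate f h s : smooth f ->
  foldr partial (translate h f) s = translate h (foldr partial f s).
Proof.
move=> sf; elim: s => //= i s ->; apply/funext => y; apply: partialE.
exact/partial_cvg_translate/smooth_partial_cvg.
Qed.

Lemma partial_translate f h i : smooth f ->
  partial i (translate h f) = translate h (partial i f).
Proof. exact: (@foldr_partial_translate f h [:: i]). Qed.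

Lemma mixed_difference j f i k y t e : smooth f -> 0 < t ->
  (forall a b, `|a| <= t -> `|b| <= t -> semi j (foldr partial f [:: k; i]
     (y + a *: e_ i + b *: e_ k) - partial k (partial i f) y) <= e) ->
  semi j (f (y + t *: e_ i + t *: e_ k) - f (y + t *: e_ i) -
     (f (y + t *: e_ k) - f y) - t%:C *: (t%:C *: partial k (partial i f) y))
  <= e * t * t.
Proof.
move=> sf t0 H; set c := partial k (partial i f) y.
have := @partial_mean_value _ _ _ j i (-1 *: f + translate (t *: e_ k) f)
  (-1 *: partial i f + translate (t *: e_ k) (partial i f)) y t (t%:C *: c) (e * t).
rewrite (gtr0_norm t0) !fctE /translate !scaleN1r.
set u := (X in (_ -> _ -> semi _ X <= _) -> _) => M.
rewrite (_ : _ - _ = u); last by rewrite /u; zmod.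
apply: M => s st.
  apply: partial_cvg_linear; first exact: smooth_partial_cvg0.
  exact/partial_cvg_translate/smooth_partial_cvg0.
rewrite scaleN1r; set z := y + s *: e_ i.
have := @partial_mean_value _ _ _ j k (partial i f) (partial k (partial i f)) z t c e.
rewrite (gtr0_norm t0) => N.
rewrite (_ : _ - _ = partial i f (z + t *: e_ k) - partial i f z - t%:C *: c); last by zmod.
apply: N => a at_.
  exact: (@smooth_partial_cvg f [:: i]).
exact: H.
Qed.

(** Schwarz's theorem. The second difference is symmetric in [i] and [k], and divided by [t ^+ 2] it
    is close to both mixed derivatives at [y], by their continuity. *)
Lemma partial_comm f i k : smooth f -> partial i (partial k f) = partial k (partial i f).
Proof.
move=> sf; apply/funext => y; apply/eqP; rewrite -subr_eq0; apply/eqP.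
apply: semi_eq0 => j e e0; have e20 : 0 < e / 2 by rewrite divr_gt0.
have cont a b : exists2 del, 0 < del & forall s t, `|s| <= del -> `|t| <= del ->
    semi j (foldr partial f [:: b; a] (y + s *: e_ a + t *: e_ b)
      - partial b (partial a f) y) <= e / 2.
  have /continuous_semiP/(_ j _ e20)[del d0 Hd] : {for y, continuous (foldr partial f [:: b; a])} by
    exact: (sf [:: b; a]).1.
  exists (del / 4) => [|s t sd td]; first by rewrite divr_gt0.
  rewrite -addrA; apply/ltW/Hd/(le_lt_trans (ler_normD _ _)).
  have E m (v : R) : `|v| <= del / 4 -> `|v *: e_ m| <= del / 4.
    move=> vd; rewrite [leLHS]/Num.norm/= mx_normrE; apply/bigmax_leP => /=.
    split=> [|[a' b'] _]; first by rewrite divr_ge0// ltW.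
    rewrite !mxE; case: (_ && _); rewrite ?mulr1 ?mulr0 ?normr0// divr_ge0// ltW//.
  by have := lerD (E a s sd) (E b t td); move: d0; lra.
have [d1 d10 H1] := cont k i; have [d2 d20 H2] := cont i k.
pose t := Num.min d1 d2; have t0 : 0 < t by rewrite lt_min d10.
have td1 : t <= d1 by rewrite ge_min lexx.
have td2 : t <= d2 by rewrite ge_min lexx orbT.
have M1 := mixed_difference sf t0 (fun a b at_ bt => H1 a b (le_trans at_ td1) (le_trans bt td1)).
have M2 := mixed_difference sf t0 (fun a b at_ bt => H2 a b (le_trans at_ td2) (le_trans bt td2)).
rewrite [y + t *: e_ k + _]addrAC in M1.
set c1 := partial i _ y in M1 *; set c2 := partial k _ y in M2 *.
have : semi j (t%:C *: (t%:C *: (c1 - c2))) <= e * t * t.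
  move: M1 M2; set a := f (_ + _ + _); set b := f (_ + _); set c := f (_ + _); set z := f y.
  clearbody a b c z c1 c2; move=> M1 M2.
  rewrite 2!scalerBr (_ : _ - _ = (a - c - (b - z) - t%:C *: (t%:C *: c2)) -
    (a - b - (c - z) - t%:C *: (t%:C *: c1))); last by zmod.
  rewrite (le_trans (semiB _ _ _))//; have := lerD M2 M1.
  by move=> /le_trans; apply; rewrite [in leRHS](splitr e) !mulrDl.
rewrite !semiZr gtr0_norm// => H; rewrite -(ler_pM2l t0) -(ler_pM2l t0).
by rewrite (le_trans H)// [leRHS](_ : _ = e * t * t)//; ring.
Qed.

Lemma foldr_partial_perm f s t : smooth f -> perm_eq s t ->
  foldr partial f s = foldr partial f t.
Proof.
move=> sf /permP st.
have rem_ i (u : seq 'I_d) : i \in u -> foldr partial f u = foldr partial f (i :: rem i u).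
  elim: u => //= k u IH; rewrite inE; have [->//|ik /=] := eqVneq i k.
  by move=> /IH ->; rewrite /= -partial_comm//; exact: smooth_foldr.
elim: s t st => [|i s IH] t st.
  by case: t st => // k t /(_ (pred1 k)); rewrite /= eqxx.
have it : i \in t by rewrite -has_pred1 has_count -st /= eqxx.
rewrite (rem_ _ _ it) /= (IH (rem i t))//.
move=> a; have := st a; rewrite (permP (perm_to_rem it)) /=.
by move/addnI.
Qed.

Lemma iter_derivE (beta : 'I_d -> nat) f : iter_deriv partial beta f =
  foldr partial f (flatten [seq nseq (beta i) i | i <- enum 'I_d]).
Proof.
rewrite /iter_deriv; elim: (enum 'I_d) => //= i e ->; rewrite foldr_cat.
by elim: (beta i) => //= n ->.
Qed.

(** Passage from words of derivatives, natural for [smooth], to the multi-indices of the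
    seminorms. *)
Lemma foldr_partial_iter f s : smooth f ->
  foldr partial f s = iter_deriv partial (fun i => count_mem i s) f.
Proof.
move=> sf; rewrite iter_derivE; apply: foldr_partial_perm => //.
apply/allP => i _ /=; apply/eqP; rewrite count_flatten -map_comp sumnE big_map.
rewrite big_enum /= (bigD1 i)//= big1 => [|k ki]; rewrite ?count_nseq /= ?eqxx ?mul1n ?addn0//.
by rewrite (negPf ki).
Qed.

End Smooth.

(** * Symbol classes *)

Section Growth.
Context {R : realType} {d : nat}.
Implicit Types (y h : 'rV[R]_d) (u v : 'rV[R]_d -> R).

(** A product over the coordinates rather than a power of a norm: one integration by parts gains
    exactly one factor, [rho] splits over blocks of coordinates, and the exponent 2 makes its
    inverse integrable in every dimension. *)
Definition rho y : R := \prod_i (1 + `|y 0 i|).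

Lemma one_add_norm_ge1 (t : R) : 1 <= 1 + `|t|. Proof. by rewrite lerDl. Qed.

Lemma one_add_mul (a b : R) : 0 <= a -> 0 <= b ->
  1 + (a + b) <= (1 + a) * (1 + b).
Proof. by move=> a0 b0; have := mulr_ge0 a0 b0; lra. Qed.

Lemma rho_ge1 y : 1 <= rho y.
Proof.
rewrite /rho; apply: (big_ind (fun x : R => 1 <= x)) => // [a b a1 b1|i _].
  by rewrite -[1]mulr1 ler_pM.
exact: one_add_norm_ge1.
Qed.

Lemma rho_gt0 y : 0 < rho y. Proof. exact: lt_le_trans ltr01 (rho_ge1 y). Qed.

Lemma rho_le y h : (forall i, `|y 0 i| <= `|h 0 i|) -> rho y <= rho h.
Proof. by move=> yh; apply: ler_prod => i _; rewrite addr_ge0//= lerD2l yh. Qed.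

Lemma rhoN y : rho (- y) = rho y.
Proof. by apply: eq_bigr => i _; rewrite mxE normrN. Qed.

Lemma rhoD y h : rho (y + h) <= rho y * rho h.
Proof.
rewrite /rho -big_split; apply: ler_prod => i _; rewrite addr_ge0//= mxE.
rewrite (@le_trans _ _ (1 + (`|y 0 i| + `|h 0 i|)))//.
  by rewrite lerD2l ler_normD.
exact: one_add_mul.
Qed.

Lemma coord_le_rho y i : 1 + `|y 0 i| <= rho y.
Proof.
rewrite /rho (bigD1 i)//= ler_peMr ?addr_ge0//.
apply: (big_ind (fun x : R => 1 <= x)) => // [a b a1 b1|k _].
  by rewrite -[1]mulr1 ler_pM.
exact: one_add_norm_ge1.
Qed.

(** Weights that are moderate with respect to a power of [rho]. As [rho] is even, inverses are
    moderate too ([moderateV]), so growth and decay are treated alike. *)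
Definition moderate u := (forall y, 0 < u y) /\
  exists m, forall y h, u (y + h) <= u y * rho h ^+ m.

Lemma moderate_rho : moderate rho.
Proof.
by split=> [y|]; [exact: rho_gt0|exists 1%N => y h; rewrite expr1 rhoD].
Qed.

Lemma moderate1 : moderate (fun=> 1).
Proof. by split=> // ; exists 0%N => y h; rewrite mulr1. Qed.

Lemma moderateM u v : moderate u -> moderate v -> moderate (fun y => u y * v y).
Proof.
move=> [u0 [m um]] [v0 [n vn]]; split=> [y|]; first exact: mulr_gt0.
exists (m + n)%N => y h; rewrite exprD mulrACA ler_pM//; exact: ltW.
Qed.

Lemma moderateV u : moderate u -> moderate (fun y => (u y)^-1).
Proof.
move=> [u0 [m um]]; split=> [y|]; first by rewrite invr_gt0.
exists m => y h; rewrite ler_pdivlMl// ler_pdivrMr//.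
by have := um (y + h) (- h); rewrite addrK rhoN mulrC.
Qed.

Lemma moderateX u n : moderate u -> moderate (fun y => u y ^+ n).
Proof.
move=> mu; elim: n => [|n IH]; first exact: moderate1.
rewrite (_ : (fun y => _) = fun y => u y * u y ^+ n); first exact: moderateM.
by apply/funext => y; rewrite exprS.
Qed.

Lemma moderate_coord i : moderate (fun y => 1 + `|y 0 i|).
Proof.
split=> [y|]; first by rewrite ltr_pwDl.
exists 1%N => y h; rewrite expr1 mxE.
apply: le_trans (_ : (1 + `|y 0 i|) * (1 + `|h 0 i|) <= _).
  rewrite (@le_trans _ _ (1 + (`|y 0 i| + `|h 0 i|)))//.
    by rewrite lerD2l ler_normD.
  exact: one_add_mul.
by rewrite ler_wpM2l ?addr_ge0// coord_le_rho.
Qed.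

End Growth.

Lemma rho_row_mx (R : realType) d1 d2 (a : 'rV[R]_d1) (b : 'rV[R]_d2) :
  rho (row_mx a b) = rho a * rho b.
Proof.
rewrite /rho big_split_ord /=; congr (_ * _); apply: eq_bigr => i _.
  by rewrite row_mxEl.
by rewrite row_mxEr.
Qed.

Section Symbols.
Context {R : realType} {A : frechetType R} {d : nat}.
Implicit Types (f g : 'rV[R]_d -> A) (y h : 'rV[R]_d) (u v : 'rV[R]_d -> R).
Local Notation e_ i := (delta_mx 0 i : 'rV[R]_d).

Definition dominated u f := forall j, exists C, forall y, semi j (f y) <= C * u y.

Lemma dominatedP u f : (forall y, 0 <= u y) -> dominated u f ->
  forall j, exists2 C, 0 <= C & forall y, semi j (f y) <= C * u y.
Proof.
move=> u0 H j; have [C HC] := H j; exists `|C| => // y.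
by rewrite (le_trans (HC y))// ler_wpM2r// ler_norm.
Qed.

Lemma semi_lipschitz_moderate j f (g : 'I_d -> 'rV[R]_d -> A) u m (C : R) y h :
  (forall y h, u (y + h) <= u y * rho h ^+ m) ->
  (forall i z, partial_cvg i f z (g i z)) -> 0 <= C ->
  (forall i z, semi j (g i z) <= C * u z) -> (forall y, 0 < u y) ->
  semi j (f (y + h) - f y) <= C * u y * rho h ^+ m * \sum_i `|h 0 i|.
Proof.
move=> um df C0 bg u0; apply: (semi_lipschitz df) => i z zh.
rewrite (le_trans (bg i z))// -mulrA ler_wpM2l// -[z](subrK y) addrC.
rewrite (le_trans (um _ _))// ler_wpM2l ?(ltW (u0 y))// lerXn2r ?nnegrE ?(ltW (rho_gt0 _))//.
by apply: rho_le => k; rewrite !mxE.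
Qed.

Lemma norm_sum_le (h : 'rV[R]_d) : \sum_i `|h 0 i| <= d%:R * `|h|.
Proof.
rewrite (@le_trans _ _ (\sum_(i < d) `|h|))//.
  by apply: ler_sum => i _; exact: rV_coord_le.
by rewrite sumr_const card_ord mulr_natl.
Qed.

(** Existence of partial derivatives does not give continuity; local boundedness of all of them
    does, through a local Lipschitz estimate. *)
Lemma bounded_partials_continuous f (g : 'I_d -> 'rV[R]_d -> A) :
  (forall i y, partial_cvg i f y (g i y)) ->
  (forall i, exists2 u, moderate u & dominated u (g i)) -> continuous f.
Proof.
move=> df dg y; apply/continuous_semiP => j e e0.
have /choice[B HB] : forall i, exists B, forall z : 'rV[R]_d,
    `|z - y| <= 1 -> semi j (g i z) <= B.
  move=> i; have [u [u0 [m um]] bu] := dg i.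
  have [C C0 HC] := dominatedP (fun y => ltW (u0 y)) bu j.
  exists (C * (u y * rho (const_mx 1 : 'rV[R]_d) ^+ m)) => z zy.
  rewrite (le_trans (HC z))// ler_wpM2l// -[z](subrK y) addrC.
  rewrite (le_trans (um _ _))// ler_wpM2l ?(ltW (u0 y))//.
  rewrite lerXn2r ?nnegrE ?(ltW (rho_gt0 _))//; apply: rho_le => k.
  by rewrite [in leRHS]mxE normr1 (le_trans (rV_coord_le _ _)).
pose M := \sum_i `|B i|.
have BM i : B i <= M.
  rewrite /M (bigD1 i)//= (le_trans (ler_norm _))// lerDl.
  exact: sumr_ge0.
have M0 : 0 <= M by exact: sumr_ge0.
have D0 : 0 < M * d%:R + 1 by rewrite ltr_wpDl// mulr_ge0.
exists (Num.min 1 (e / (M * d%:R + 1))); first by rewrite lt_min ltr01 divr_gt0.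
move=> h; rewrite lt_min => /andP[h1 he].
have := @semi_lipschitz _ _ _ j f g M y h df.
move=> /(_ _)/le_lt_trans; apply.
  move=> i z zh; rewrite (le_trans (HB i z _))//.
  rewrite (le_trans _ (ltW h1))// [leLHS]/Num.norm/= mx_normrE; apply/bigmax_leP => /=.
  by split=> // -[a b] _; rewrite /= ord1 !mxE (le_trans (zh b))// rV_coord_le.
rewrite (@le_lt_trans _ _ (M * (d%:R * `|h|)))// ?ler_wpM2l// ?norm_sum_le//.
rewrite mulrA (@le_lt_trans _ _ ((M * d%:R + 1) * `|h|))//.
  by rewrite ler_wpM2r// lerDl.
by rewrite -ltr_pdivlMl// mulrC.
Qed.

(** Variant of [smooth_coind] in which continuity comes from the bounds on the derivatives, which
    are again members of the class. *)
Lemma smooth_coind_dominated (P : ('rV[R]_d -> A) -> Prop) :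
  (forall f, P f -> exists2 u, moderate u & dominated u f) ->
  (forall f i, P f -> exists2 g, P g & forall y, partial_cvg i f y (g y)) ->
  forall f, P f -> smooth f /\ forall s, P (foldr partial f s).
Proof.
move=> bP dP; apply: smooth_coind => // f Pf.
have /choice[g Hg] : forall i, exists g, P g /\ forall y, partial_cvg i f y (g y).
  by move=> i; have [g ? ?] := dP f i Pf; exists g.
by apply: (@bounded_partials_continuous _ g) => i => [y|]; have [/bP] := Hg i.
Qed.

(** Symbols of weight [u], whose derivatives obey the same bound as the function. In contrast to
    [symbol_set], the notion concerns a single coefficient and applies to weights such as
    [rho ^+ M], which are not smooth. *)
Definition symb u f := smooth f /\ forall s, dominated u (foldr partial f s).

Lemma symb_coind u (P : ('rV[R]_d -> A) -> Prop) : moderate u ->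
  (forall f, P f -> dominated u f) ->
  (forall f i, P f -> exists2 g, P g & forall y, partial_cvg i f y (g y)) ->
  forall f, P f -> symb u f.
Proof.
move=> mu bP dP f Pf.
have [|sf Ps] := @smooth_coind_dominated P _ dP f Pf.
  by move=> g /bP bg; exists u.
by split=> // s; exact/bP/Ps.
Qed.

Lemma symb_smooth u f : symb u f -> smooth f. Proof. by case. Qed.

Lemma symb_dominated u f : symb u f -> dominated u f.
Proof. by move=> [_ /(_ [::])]. Qed.

Lemma symb_partial u f i : symb u f -> symb u (partial i f).
Proof.
move=> [sf bf]; split=> [|s]; first exact: smooth_partial.
by have := bf (rcons s i); rewrite -cats1 foldr_cat.
Qed.

Lemma symb_cvg u f i y : symb u f -> partial_cvg i f y (partial i f y).
Proof. by move=> [sf _]; exact: smooth_partial_cvg0. Qed.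

Lemma symb_linear u f g c : (forall y, 0 <= u y) ->
  symb u f -> symb u g -> symb u (c *: f + g).
Proof.
move=> u0 [sf bf] [sg bg]; split=> [|s j]; first exact: smooth_linear.
have [C1 H1] := bf s j; have [C2 H2] := bg s j.
exists (cmod c * C1 + C2) => y; rewrite foldr_partial_linear// !fctE.
rewrite (le_trans (semiD _ _ _))// mulrDl lerD// semiZc -mulrA ler_wpM2l//.
exact: cmod_ge0.
Qed.

Lemma symb0 u : (forall y, 0 <= u y) -> symb u (fun=> 0 : A).
Proof.
move=> u0; split=> [|s j]; first exact: smooth0.
by exists 0 => y; rewrite foldr_partial0 semi0 mul0r.
Qed.

Lemma dominated_le u v C f : (forall y, u y <= C * v y) -> (forall y, 0 <= u y) ->
  dominated u f -> dominated v f.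
Proof.
move=> uv u0 bf j; have [D D0 HD] := dominatedP u0 bf j; exists (D * C) => y.
by rewrite (le_trans (HD y))// -mulrA ler_wpM2l.
Qed.

Lemma symb_le u v C f : (forall y, u y <= C * v y) -> (forall y, 0 <= u y) ->
  symb u f -> symb v f.
Proof. by move=> uv u0 [sf bf]; split=> // s; exact: dominated_le (bf s). Qed.

Lemma symb_translate u f h : moderate u -> symb u f -> symb u (translate h f).
Proof.
move=> [u0 [m um]] [sf bf]; split=> [|s j]; first exact: smooth_translate.
have [C C0 HC] := dominatedP (fun y => ltW (u0 y)) (bf s) j.
exists (C * rho h ^+ m) => y; rewrite foldr_partial_translate//.
by rewrite (le_trans (HC _))// -mulrA ler_wpM2l// mulrC.
Qed.

End Symbols.

(** * Integrals of rapidly decaying functions *)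

Section SimpleFunctions.
Context {R : realType} {A : frechetType R}.
Context {disp : measure_display} {T : measurableType disp}.
Variable m : {measure set T -> \bar R}.
Implicit Types (s : seq (set T * A)) (f : T -> A).

Lemma simple_eval_cons p s x :
  simple_eval (p :: s) x = (\1_(p.1) x)%:C *: p.2 + simple_eval s x.
Proof. by rewrite /simple_eval big_cons. Qed.

Lemma simple_consE p s : simple m (p :: s) ->
  [/\ measurable p.1, (m p.1 < +oo)%E & simple m s].
Proof.
move=> sps; have [|mp mpoo] := sps p; first by rewrite inE eqxx.
by split=> // q qs; apply: sps; rewrite inE qs orbT.
Qed.

(** The constant [c] carries the induction: on the first set the value is added to [c], off it
    nothing changes. As [A] has no sigma-algebra, measurability is stated for seminorms only. *)
Lemma measurable_semi_simple j s c : simple m s ->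
  measurable_fun setT (fun x => semi j (c + simple_eval s x)).
Proof.
elim: s c => [|p s IH] c.
  by move=> _; under eq_fun do rewrite /simple_eval big_nil; exact: measurable_cst.
move=> /simple_consE[mp _ ss].
rewrite (_ : (fun _ => _) = (fun x =>
    \1_(p.1) x * semi j (c + p.2 + simple_eval s x) +
    (1 - \1_(p.1) x) * semi j (c + simple_eval s x))).
  apply: measurable_funD; apply: measurable_funM.
  - exact: measurable_indic.
  - exact: IH.
  - by apply: measurable_funB => //; exact: measurable_indic.
  - exact: IH.
apply/funext => x; rewrite simple_eval_cons indicE.
case: (x \in p.1) => /=.
  by rewrite scale1r addrA mul1r subrr mul0r addr0.
by rewrite scale0r add0r mul0r subr0 mul1r add0r.
Qed.

Lemma measurable_EFin_semi_simple D j s c : simple m s -> measurable D ->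
  measurable_fun D (fun x => (semi j (c + simple_eval s x))%:E).
Proof.
move=> ss mD; apply/measurable_EFinP; apply: measurable_funTS.
exact: measurable_semi_simple.
Qed.

(** The sets in [s] may overlap, so the triangle inequality for the integral is proved by cutting
    [B] along the first set [p.1]: inside it [c] becomes [c + p.2], outside it [c] is unchanged. *)
Lemma semi_simple_integral_on j s B c : simple m s -> measurable B -> (m B < +oo)%E ->
  ((semi j ((fine (m B))%:C *: c + \sum_(p <- s) (fine (m (p.1 `&` B)))%:C *: p.2))%:E
   <= \int[m]_(x in B) (semi j (c + simple_eval s x))%:E)%E.
Proof.
elim: s B c => [|p s IH] B c ss mB Boo.
  rewrite big_nil addr0; under eq_integral do rewrite /simple_eval big_nil addr0.
  rewrite integral_cst// semiZr ger0_norm ?fine_ge0// mulrC EFinM fineK//.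
  by rewrite ge0_fin_numE.
have [mp poo ss'] := simple_consE ss.
have mBp : measurable (B `&` p.1) by exact: measurableI.
have mBp' : measurable (B `\` p.1) by exact: measurableD.
have BE : B = (B `&` p.1) `|` (B `\` p.1) by rewrite setUIDK.
have fin (D E : set T) : measurable D -> measurable E -> (m E < +oo)%E -> D `<=` E ->
    m D \is a fin_num.
  move=> mD mE Eoo DE; rewrite ge0_fin_numE//; apply: le_lt_trans Eoo.
  by apply: le_measure => //; rewrite inE.
have split (D : set T) : measurable D ->
    fine (m (D `&` B)) = fine (m (D `&` (B `&` p.1))) + fine (m (D `&` (B `\` p.1))).
  move=> mD; rewrite -fineD; last 2 first.
  - by apply: (fin _ B) => //; [exact: measurableI|move=> x [_ []]].
  - by apply: (fin _ B) => //; [exact: measurableI|move=> x [_ []]].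
  rewrite -measureU//; last 3 first.
  - exact: measurableI.
  - exact: measurableI.
  - by rewrite -subset0 => x [[_ [_ ?]] [_ [_ ?]]].
  by rewrite -setIUr -BE.
have splitB : fine (m B) = fine (m (B `&` p.1)) + fine (m (B `\` p.1)).
  by have := split setT measurableT; rewrite !setTI.
have IH1 := IH (B `&` p.1) (c + p.2) ss' mBp (le_lt_trans (measureIl _ mB mp) Boo).
have Bp'oo : (m (B `\` p.1) < +oo)%E.
  by apply: le_lt_trans Boo; apply: le_measure => //; rewrite inE.
have IH2 := IH (B `\` p.1) c ss' mBp' Bp'oo.
rewrite [X in (_ <= integral _ X _)%E]BE ge0_integral_setU//=; last 3 first.
- by apply: measurable_EFin_semi_simple => //; rewrite -BE.
- by move=> x _; rewrite lee_fin semi_ge0.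
- by apply/disj_setPS => x [[_ ?] [_ ?]].
rewrite (_ : (\int[m]_(x in _) _)%E =
    \int[m]_(x in B `&` p.1) (semi j (c + p.2 + simple_eval s x))%:E)%E; last first.
  apply: eq_integral => x; rewrite inE => -[_ px].
  by rewrite simple_eval_cons indicE mem_set// scale1r addrA.
rewrite (_ : (\int[m]_(x in B `\` _) _)%E =
    \int[m]_(x in B `\` p.1) (semi j (c + simple_eval s x))%:E)%E; last first.
  apply: eq_integral => x; rewrite inE => -[_ px].
  by rewrite simple_eval_cons indicE memNset// scale0r add0r.
apply: le_trans (leeD IH1 IH2); rewrite -EFinD lee_fin big_cons.
rewrite (le_trans _ (semiD _ _ _))//; rewrite le_eqVlt; apply/orP; left; apply/eqP; congr (semi j _).
rewrite splitB scale_realDl scalerDr.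
rewrite (_ : p.1 `&` B = B `&` p.1); last by rewrite setIC.
rewrite (_ : \sum_(q <- s) _ = \sum_(q <- s) (fine (m (q.1 `&` (B `&` p.1))))%:C *: q.2
   + \sum_(q <- s) (fine (m (q.1 `&` (B `\` p.1))))%:C *: q.2); first by zmod.
rewrite -big_split; apply: eq_big_seq => q qs /=.
by rewrite split ?scale_realDl//; have [] := ss' q qs.
Qed.

Lemma semi_simple_integral j s : simple m s ->
  ((semi j (simple_integral m s))%:E <= \int[m]_x (semi j (simple_eval s x))%:E)%E.
Proof.
move=> ss.
(* The union of the sets of [s]: it has finite measure, and the simple function vanishes outside
   it. *)
have [B [mB Boo sB]] : exists B, [/\ measurable B, (m B < +oo)%E &
    forall p, p \in s -> p.1 `<=` B].
  elim: s ss => [|p s IH] ss; first by exists set0; rewrite measure0.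
  have [mp poo /IH[B [mB Boo sB]]] := simple_consE ss.
  exists (p.1 `|` B); split; first exact: measurableU.
    by rewrite (le_lt_trans (measureU2 _ mp mB))// lte_add_pinfty.
  move=> q; rewrite inE => /orP[/eqP ->|/sB qB]; first exact: subsetUl.
  by apply: subset_trans qB _; exact: subsetUr.
have := semi_simple_integral_on j 0 ss mB Boo; rewrite scaler0 add0r.
rewrite (_ : \sum_(p <- s) _ = simple_integral m s); last first.
  by apply: eq_big_seq => p /sB pB; rewrite setIidl.
move=> /le_trans; apply; under eq_integral do rewrite add0r.
apply: ge0_subset_integral => //.
  have := measurable_EFin_semi_simple j 0 ss measurableT.
  by under eq_fun do rewrite add0r.
by move=> x _; rewrite lee_fin semi_ge0.
Qed.

Definition simple_scale (c : R[i]) s := [seq (p.1, c *: p.2) | p <- s].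

Lemma simple_scale_simple c s : simple m s -> simple m (simple_scale c s).
Proof. by move=> ss p /mapP[q /ss ? ->]. Qed.

Lemma simple_cat s s' : simple m s -> simple m s' -> simple m (s ++ s').
Proof. by move=> ss ss' p; rewrite mem_cat => /orP[/ss|/ss']. Qed.

Lemma simple_evalD c s s' x :
  simple_eval (simple_scale c s ++ s') x = c *: simple_eval s x + simple_eval s' x.
Proof.
rewrite /simple_eval big_cat big_map /= scaler_sumr; congr (_ + _).
by apply: eq_bigr => p _; rewrite !scalerA mulrC.
Qed.

Lemma simple_integralD c s s' :
  simple_integral m (simple_scale c s ++ s') =
  c *: simple_integral m s + simple_integral m s'.
Proof.
rewrite /simple_integral big_cat big_map /= scaler_sumr; congr (_ + _).
by apply: eq_bigr => p _; rewrite !scalerA mulrC.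
Qed.

Lemma simple_integral_dist j s s' f : simple m s -> simple m s' ->
  measurable_fun setT (fun x => semi j (f x - simple_eval s x)) ->
  measurable_fun setT (fun x => semi j (f x - simple_eval s' x)) ->
  ((semi j (simple_integral m s - simple_integral m s'))%:E <=
   \int[m]_x (semi j (f x - simple_eval s x))%:E +
   \int[m]_x (semi j (f x - simple_eval s' x))%:E)%E.
Proof.
move=> ss ss' ms ms'.
have ss'' : simple m (simple_scale (-1) s' ++ s).
  by apply: simple_cat => //; exact: simple_scale_simple.
have := semi_simple_integral j ss''; rewrite simple_integralD scaleN1r addrC.
move=> /le_trans; apply; rewrite -ge0_integralD//; last 4 first.
- by move=> x _; rewrite lee_fin semi_ge0.
- exact/measurable_EFinP.
- by move=> x _; rewrite lee_fin semi_ge0.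
- exact/measurable_EFinP.
apply: ge0_le_integral => //.
- by move=> x _; rewrite lee_fin semi_ge0.
- have := measurable_EFin_semi_simple j 0 ss'' measurableT.
  by under eq_fun do rewrite add0r.
- by apply/measurable_EFinP; exact: measurable_funD.
move=> x _; rewrite -EFinD lee_fin simple_evalD scaleN1r addrC.
by rewrite (le_trans (semi_dist_le j _ (f x) _))// lerD2r semi_distrC.
Qed.

(** Makes the choice by [xget] in [integral] canonical. *)
Lemma bochner_unique f v v' :
  bochner_integral m f v -> bochner_integral m f v' -> v = v'.
Proof.
move=> [s [ss ms is_ vs]] [s' [ss' ms' is_' vs']].
apply/eqP; rewrite -subr_eq0; apply/eqP; apply: semi_eq0 => j e e0.
have e4 : 0 < e / 4 by rewrite divr_gt0.
have near_ (u : nat -> seq (set T * A)) (l : A) :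
    (forall j, (\int[m]_x (semi j (f x - simple_eval (u k) x)%R)%:E)%E
        @[k --> \oo] --> 0%E) -> simple_integral m (u k) @[k --> \oo] --> l ->
    \forall k \near \oo, (\int[m]_x (semi j (f x - simple_eval (u k) x)%R)%:E
        <= (e / 4)%:E)%E /\ semi j (simple_integral m (u k) - l) < e / 4.
  move=> iu /cvg_semiP ul; near=> k; split; last by near: k; exact: ul.
  near: k; have /fine_cvgP[fu /cvgrPdist_lt/(_ _ e4) cu] := iu j.
  apply: filterS2 fu cu => k fk; rewrite sub0r normrN => ck.
  rewrite -(fineK fk) lee_fin; apply: le_trans (ltW ck); exact: ler_norm.
near \oo => k.
have [I1 D1] : (\int[m]_x (semi j (f x - simple_eval (s k) x)%R)%:E
        <= (e / 4)%:E)%E /\ semi j (simple_integral m (s k) - v) < e / 4.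
  by near: k; exact: near_.
have [I2 D2] : (\int[m]_x (semi j (f x - simple_eval (s' k) x)%R)%:E
        <= (e / 4)%:E)%E /\ semi j (simple_integral m (s' k) - v') < e / 4.
  by near: k; exact: near_.
have := le_trans (simple_integral_dist (ss k) (ss' k) (ms j k) (ms' j k)) (leeD I1 I2).
rewrite -EFinD lee_fin => D3.
rewrite (le_trans (semi_dist_le j _ (simple_integral m (s k)) _))//.
have := semi_dist_le j (simple_integral m (s k)) (simple_integral m (s' k)) v'.
by rewrite semi_distrC in D1; move: D1 D2 D3; lra.
Unshelve. all: by end_near. Qed.

(** The majorant [g] is measurable by assumption, whereas [bochner_integral] records measurability
    only for the seminorms of the differences between [f] and the simple functions. *)
Lemma bochner_bound f v j (g : T -> R) : bochner_integral m f v ->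
  measurable_fun setT g -> (forall x, semi j (f x) <= g x) ->
  ((semi j v)%:E <= \int[m]_x (g x)%:E)%E.
Proof.
move=> [s [ss ms is_ /cvg_semiP vs]] mg fg.
apply/lee_addgt0Pr => e e0; have e2 : 0 < e / 2 by rewrite divr_gt0.
near \oo => k.
have D : semi j (simple_integral m (s k) - v) < e / 2 by near: k; exact: vs.
have I : (\int[m]_x (semi j (f x - simple_eval (s k) x)%R)%:E <= (e / 2)%:E)%E.
  near: k; have /fine_cvgP[fu /cvgrPdist_lt/(_ _ e2) cu] := is_ j.
  apply: filterS2 fu cu => k fk; rewrite sub0r normrN => ck.
  rewrite -(fineK fk) lee_fin; apply: le_trans (ltW ck); exact: ler_norm.
have B : ((semi j (simple_integral m (s k)))%:E <= (e / 2)%:E + \int[m]_x (g x)%:E)%E.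
  apply: le_trans (semi_simple_integral j (ss k)) _.
  have g0 x : 0 <= g x by exact: le_trans (semi_ge0 _ _) (fg x).
  apply: le_trans (leeD I (lexx _)); rewrite -ge0_integralD//; last 4 first.
  - by move=> x _; rewrite lee_fin semi_ge0.
  - exact/measurable_EFinP.
  - by move=> x _; rewrite lee_fin.
  - exact/measurable_EFinP.
  apply: ge0_le_integral => //.
  - by move=> x _; rewrite lee_fin semi_ge0.
  - have := measurable_EFin_semi_simple j 0 (ss k) measurableT.
    by under eq_fun do rewrite add0r.
  - by apply/measurable_EFinP; exact: measurable_funD.
  move=> x _; rewrite -EFinD lee_fin; apply: le_trans (lerD (lexx _) (fg x)).
  by have := semi_dist_le j (simple_eval (s k) x) (f x) 0; rewrite !subr0 semi_distrC.
have : ((semi j v)%:E <= (e / 2)%:E + (semi j (simple_integral m (s k)))%:E)%E.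
  rewrite -EFinD lee_fin; have := semi_dist_le j v (simple_integral m (s k)) 0.
  by rewrite !subr0 => /le_trans; apply; rewrite lerD2r semi_distrC ltW.
move=> /le_trans; apply; apply: le_trans (leeD (lexx _) B) _.
by rewrite addeA -EFinD -splitr addeC.
Unshelve. all: by end_near. Qed.

End SimpleFunctions.

Section Invariance.
Context {R : realType} {disp : measure_display} {T : measurableType disp}.
Variable m : {measure set T -> \bar R}.

Lemma ge0_integral_invariant (phi : T -> T) (f : T -> \bar R) :
  measurable_fun setT phi -> (forall E, measurable E -> m (phi @^-1` E) = m E) ->
  measurable_fun setT f -> (forall x, (0 <= f x)%E) ->
  (\int[m]_x f (phi x) = \int[m]_x f x)%E.
Proof.
move=> mphi inv mf f0.
have := @ge0_integral_pushforward _ _ _ _ _ _ mphi m setT f measurableT mf.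
rewrite preimage_setT => <- //.
by apply: eq_measure_integral => E mE _; exact: inv.
Qed.

End Invariance.

Section LebesgueTranslation.
Context {R : realType}.
Local Notation mu := (@lebesgue_measure R).

Lemma measurable_translation (a : R) :
  measurable_fun [set: measurableTypeR R] (fun x : measurableTypeR R => x + a : measurableTypeR R).
Proof. by apply: measurable_funD. Qed.

Lemma lebesgue_translation (a : R) (E : set (measurableTypeR R)) : measurable E ->
  mu ((fun x => x + a) @^-1` E) = mu E.
Proof.
move=> mE; symmetry.
apply: (@lebesgue_measure_unique _ (measure_function_pushforward__canonical__measure_function_Measure
  mu (measurable_translation a))) => //.
move=> _ [[b c] _ <-] /=; rewrite /pushforward.
rewrite (_ : _ @^-1` _ = `]b - a, c - a]%classic); last first.
  by apply/seteqP; split=> x /=; rewrite !in_itv /= ltrBlDr lerBrDr.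
rewrite !lebesgue_measure_itv /= !lte_fin ltrD2r; case: ifP => // _.
by rewrite -!EFinD; congr EFin; ring.
Qed.

Lemma continuous_one_add_normV : continuous (fun x : R => (1 + `|x|) ^- 2).
Proof.
move=> x; apply: cvgV; first by rewrite expf_neq0// gt_eqF// ltr_pwDl.
by apply: cvgM; apply: cvgD; try exact: cvg_cst; exact: norm_continuous.
Qed.

(** Comparison with [1 / (1 + x ^+ 2)], of known integral. *)
Lemma integral_one_add_norm :
  (\int[mu]_x (((1 + `|x|) ^- 2)%:E) < +oo)%E.
Proof.
have H : (\int[mu]_x ((oneDsqr x)^-1)%:E < +oo)%E.
  rewrite ge0_symfun_integralT.
  - rewrite (_ : [set x | _] = `[0%R, +oo[%classic); last first.
      by apply/seteqP; split=> x /=; rewrite in_itv /= andbT.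
    by rewrite integral0y_oneDsqr -EFinM ltry.
  - by move=> x; rewrite invr_ge0 (le_trans ler01)// oneDsqr_ge1.
  - exact: continuous_oneDsqrV.
  - by move=> x /=; rewrite /oneDsqr sqrrN.
apply: le_lt_trans H; apply: ge0_le_integral => //.
- by apply/measurable_EFinP; apply: continuous_measurable_fun; exact: continuous_one_add_normV.
- by apply/measurable_EFinP; apply: continuous_measurable_fun; exact: continuous_oneDsqrV.
move=> x _; rewrite lee_fin lef_pV2 ?posrE.
- rewrite /oneDsqr sqrrD expr1n mul1r real_normK ?num_real// -addrA lerD2l lerDr.
  by rewrite mulrn_wge0.
- by rewrite exprn_gt0// ltr_pwDl.
- by rewrite (lt_le_trans ltr01)// oneDsqr_ge1.
Qed.

End LebesgueTranslation.

Section SigmaFiniteCopy.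
Context {R : realType} {disp : measure_display} {T : measurableType disp}.
Variables (m : {measure set T -> \bar R}) (sf : sigma_finite setT m).

(* An alias of [m] on which Fubini's theorem finds [sf] by instance inference. *)
Definition sigma_finite_copy of sigma_finite setT m : set T -> \bar R := m.
HB.instance Definition _ := Measure.copy (sigma_finite_copy sf) m.
HB.instance Definition _ :=
  Measure_isSigmaFinite.Build _ _ _ (sigma_finite_copy sf) sf.

End SigmaFiniteCopy.

Section PositiveIntegrable.
Context {R : realType} {disp : measure_display} {T : measurableType disp}.
Variable m : {measure set T -> \bar R}.
Variable w : T -> R.
Hypotheses (mw : measurable_fun setT w) (w0 : forall x, 0 < w x).
Hypothesis iw : (\int[m]_x (w x)%:E < +oo)%E.

Lemma finite_measure_superlevel (E : set T) (c : R) : measurable E -> 0 < c ->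
  (forall x, E x -> c <= w x) -> (m E < +oo)%E.
Proof.
move=> mE c0 cw.
suff H : (c%:E * m E <= \int[m]_x (w x)%:E)%E.
  have := le_lt_trans H iw; case: (m E) => [r _||//]; first exact: ltry.
  by rewrite mulry gtr0_sg// mul1e.
rewrite -integral_cst//; apply: (@le_trans _ _ (\int[m]_(x in E) (w x)%:E)%E).
  apply: ge0_le_integral => //.
  - by move=> x _; rewrite lee_fin ltW.
  - by apply/measurable_EFinP; exact: measurable_funTS.
apply: ge0_subset_integral => //; first exact/measurable_EFinP.
by move=> x _; rewrite lee_fin ltW.
Qed.

(** [measured_space] keeps no proof of sigma-finiteness, which Tonelli's theorem asks for; the
    superlevel sets of a positive integrable function provide it. *)
Lemma sigma_finite_positive_integrable : sigma_finite setT m.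
Proof.
exists (fun n => w @^-1` `[n.+1%:R^-1, +oo[%classic).
  apply/seteqP; split=> // x _; exists (Num.truncn (w x)^-1) => //=.
  rewrite in_itv /= andbT invf_ple ?posrE//.
  by rewrite ltW// truncnS_gt.
move=> n; have mF : measurable (w @^-1` `[n.+1%:R^-1, +oo[%classic).
  by rewrite -[X in measurable X]setTI; exact: mw.
split=> //; apply: (finite_measure_superlevel (c := n.+1%:R^-1)) => //.
by move=> x /=; rewrite in_itv /= andbT.
Qed.

End PositiveIntegrable.

(** * Lebesgue measure on a product of lines *)

Section LebesgueSpace.
Context {R : realType}.
Local Notation carrier d := (ms_carrier (lebesgue_space R d)).
Local Notation leb d := (ms_measure (lebesgue_space R d)).

Lemma row_of_rho d (t : carrier d.+1) :
  rho (row_of t) = (1 + `|t.2 : R|) * rho (row_of t.1).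
Proof.
rewrite [row_of t]/(row_mx _ _) (@rho_row_mx R 1 d); congr (_ * _).
by rewrite /rho big_ord1 mxE eqxx mulr1n.
Qed.

Lemma measurable_row_of d i :
  measurable_fun setT (fun t : carrier d => row_of t 0 i).
Proof.
elim: d i => [[]//|d IH] i.
case: (@split_ordP 1 d i) => k ->.
  rewrite (_ : (fun _ => _) = (fun t : carrier d.+1 => t.2 : R)) /=.
    exact: measurable_snd.
  apply/funext => t.
  transitivity (row_mx ((t.2 : R)%:M : 'rV_1) (row_of t.1) 0 (lshift d k)) => //.
  by rewrite row_mxEl mxE ord1 eqxx mulr1n.
rewrite (_ : (fun _ => _) = (fun t : carrier d.+1 => row_of t.1 0 k)) /=.
  exact: (measurableT_comp (IH k)).
apply/funext => t.
transitivity (row_mx ((t.2 : R)%:M : 'rV_1) (row_of t.1) 0 (rshift 1 k)) => //.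
by rewrite row_mxEr.
Qed.

Lemma measurable_rho_row_of d : measurable_fun setT (fun t : carrier d => rho (row_of t)).
Proof.
elim: d => [|d IH].
  by under eq_fun do rewrite /rho big_ord0; exact: measurable_cst.
under eq_fun do rewrite row_of_rho.
apply: measurable_funM.
  apply: measurable_funD => //; apply: (measurableT_comp (@normr_measurable _ setT)).
  exact: measurable_snd.
exact: (measurableT_comp IH).
Qed.

Lemma measurable_rho_row_ofV d :
  measurable_fun setT (fun t : carrier d => rho (row_of t) ^- 2).
Proof.
have c := @continuous_one_add_normV R.
rewrite (_ : (fun _ => _) = (fun x : R => ((1 + `|x|) ^+ 2)^-1) \o
    (fun t : carrier d => rho (row_of t) - 1)); last first.
  apply/funext => t /=; rewrite ger0_norm ?subr_ge0 ?rho_ge1//.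
  by rewrite addrC subrK.
apply: measurableT_comp; first exact: continuous_measurable_fun.
by apply: measurable_funB => //; exact: measurable_rho_row_of.
Qed.

Lemma integral_rho d : (\int[leb d]_t (rho (row_of t) ^- 2)%:E < +oo)%E.
Proof.
elim: d => [|d IH].
  under eq_integral do rewrite /rho big_ord0 expr1n invr1.
  by rewrite integral_cst//= diracT mule1 ltry.
(* The induction hypothesis itself gives the sigma-finiteness needed by Tonelli's theorem in the
   next dimension. *)
have sf : sigma_finite setT (leb d).
  apply: sigma_finite_positive_integrable IH; first exact: measurable_rho_row_ofV.
  by move=> t; rewrite invr_gt0 exprn_gt0// rho_gt0.
have := @fubini_tonelli1 _ _ _ _ _ (sigma_finite_copy sf) (@lebesgue_measure R)
  (fun t : carrier d.+1 => (rho (row_of t) ^- 2)%:E).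
move=> /= ->; last 2 first.
- by apply/measurable_EFinP; exact: (@measurable_rho_row_ofV d.+1).
- by move=> t; rewrite lee_fin invr_ge0 exprn_ge0// ltW// rho_gt0.
have I1 := @integral_one_add_norm R.
have I0 : (0 <= \int[lebesgue_measure]_x (((1 + `|x : R|) ^- 2)%:E))%E.
  by apply: integral_ge0 => x _; rewrite lee_fin invr_ge0 exprn_ge0// addr_ge0.
pose r := fine (\int[lebesgue_measure]_x (((1 + `|x : R|) ^- 2)%:E))%E.
have rE : (\int[lebesgue_measure]_x (((1 + `|x : R|) ^- 2)%:E) = r%:E)%E.
  by rewrite fineK// ge0_fin_numE.
rewrite (eq_integral (fun t => (r%:E * (rho (row_of t) ^- 2)%:E)%E)); last first.
  move=> t _; rewrite /fubini_F -rE muleC -ge0_integralZl_EFin//; last 2 first.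
  - by apply/measurable_EFinP; apply: continuous_measurable_fun; exact: continuous_one_add_normV.
  - by rewrite invr_ge0 exprn_ge0// ltW// rho_gt0.
  apply: eq_integral => x _; rewrite (@row_of_rho d (t, x)) /=.
  by rewrite exprMn invfM mulrC EFinM.
rewrite ge0_integralZl_EFin//.
- by apply: lte_mul_pinfty => //; rewrite lee_fin fine_ge0.
- by move=> t _; rewrite lee_fin invr_ge0 exprn_ge0// ltW// rho_gt0.
- by apply/measurable_EFinP; exact: measurable_rho_row_ofV.
- by rewrite fine_ge0.
Qed.

End LebesgueSpace.

Section Shift.
Context {R : realType}.
Local Notation carrier d := (ms_carrier (lebesgue_space R d)).
Local Notation leb d := (ms_measure (lebesgue_space R d)).

Fixpoint shift_of (d : nat) : 'rV[R]_d -> carrier d -> carrier d :=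
  if d is d'.+1 then
    fun h t => (shift_of (rsubmx (h : 'rV_(1 + d'))) t.1, (t.2 : R) + h 0 0)
  else fun _ t => t.

Lemma row_of_shift d (h : 'rV[R]_d) t : row_of (shift_of h t) = row_of t + h.
Proof.
elim: d h t => [|d IH] h t; first by apply/rowP => -[].
transitivity (row_mx (((t.2 : R) + h 0 0)%:M : 'rV_1)
  (row_of (shift_of (rsubmx (h : 'rV_(1 + d))) t.1))) => //.
rewrite IH -[h in RHS](@hsubmxK _ 1 1 d); apply: esym.
transitivity (row_mx ((t.2 : R)%:M : 'rV_1) (row_of t.1) +
  row_mx (lsubmx (h : 'rV_(1 + d))) (rsubmx (h : 'rV_(1 + d)))) => //.
rewrite add_row_mx (_ : _ + lsubmx _ = ((t.2 : R) + h 0 0)%:M)//.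
apply/rowP => i; rewrite !mxE !ord1 !eqxx !mulr1n.
by congr (_ + h 0 _); exact: val_inj.
Qed.

Lemma measurable_shift d (h : 'rV[R]_d) : measurable_fun setT (shift_of h).
Proof.
elim: d h => [|d IH] h; first exact: measurable_id.
apply/measurable_fun_pairP; split.
  exact: (measurableT_comp (IH _)).
exact: (measurableT_comp (@measurable_translation R (h 0 0))).
Qed.

(** By sections: translation invariance on the line for the last factor, then the induction
    hypothesis for the integral over the others. *)
Lemma shift_preserves d (h : 'rV[R]_d) (E : set (carrier d)) : measurable E ->
  leb d (shift_of h @^-1` E) = leb d E.
Proof.
elim: d h E => [//|d IH] h E mE.
transitivity (\int[leb d]_t (lebesgue_measure (xsection E
    (shift_of (rsubmx (h : 'rV_(1 + d))) t))))%E.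
  apply: eq_integral => t _.
  have mx : measurable (xsection E (shift_of (rsubmx (h : 'rV_(1 + d))) t)).
    exact: measurable_xsection.
  rewrite -(lebesgue_translation (h 0 0) mx) /=; apply: (congr1 (@lebesgue_measure R)).
  by apply/seteqP; split=> x /=; rewrite /xsection /= !inE.
apply: (ge0_integral_invariant (f := lebesgue_measure \o xsection E)) => //.
- exact: measurable_shift.
- exact: IH.
- exact: measurable_fun_xsection.
Qed.

End Shift.

(** * Approximation by step functions on grids *)

Section GridApproximation.
Context {R : realType} {A : frechetType R} {d : nat}.
Local Notation carrier := (ms_carrier (lebesgue_space R d)).
Local Notation leb := (ms_measure (lebesgue_space R d)).
Implicit Types (f g : 'rV[R]_d -> A).

(* The cube [-K, K)^d is cut into cells of side 1/K, with K = k + 1. *)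
Definition grid_index k := {ffun 'I_d -> 'I_(2 * k.+1 * k.+1)}.
Definition grid_point k (z : grid_index k) : 'rV[R]_d :=
  \row_i ((z i)%:R / k.+1%:R - k.+1%:R).
Definition grid_cell k (z : grid_index k) : set carrier :=
  [set t | forall i, grid_point z 0 i <= row_of t 0 i < grid_point z 0 i + k.+1%:R^-1].
Definition grid f k : seq (set carrier * A) :=
  [seq (@grid_cell k z, f (@grid_point k z)) | z <- enum {: grid_index k}].

Lemma grid_cell_measurable k (z : grid_index k) : measurable (grid_cell z).
Proof.
rewrite (_ : grid_cell z = \bigcap_(i in [set: 'I_d])
    ((fun t : carrier => row_of t 0 i) @^-1`
      `[grid_point z 0 i, grid_point z 0 i + k.+1%:R^-1[%classic)); last first.
  by apply/seteqP; split=> t /= H i; have := H i; rewrite /= in_itv /= => // /(_ I).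
apply: fin_bigcap_measurable => // i _.
rewrite -[X in measurable X]setTI.
by apply: measurable_row_of => //; exact: measurable_itv.
Qed.

Lemma grid_cell_close k (z : grid_index k) t : grid_cell z t ->
  forall i, `|row_of t 0 i - grid_point z 0 i| <= k.+1%:R^-1.
Proof.
move=> zt i; have /andP[a b] := zt i; rewrite ger0_norm ?subr_ge0//.
by rewrite lerBlDl ltW.
Qed.

Lemma grid_cell_inj k (z z' : grid_index k) t : grid_cell z t -> grid_cell z' t -> z = z'.
Proof.
move=> zt z't; apply/ffunP => i; apply/val_inj => /=.
have K0 : 0 < k.+1%:R :> R by rewrite ltr0n.
have /andP[] := zt i; have /andP[] := z't i; rewrite !mxE.
set x := row_of t 0 i => a' b' a b.
have H (p q : nat) : p%:R / k.+1%:R - k.+1%:R <= x ->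
    x < q%:R / k.+1%:R - k.+1%:R + k.+1%:R^-1 -> (p <= q)%N.
  move=> px xq; have := le_lt_trans px xq.
  rewrite addrAC ltrD2r -[X in _ + X]mul1r -mulrDl ltr_pM2r ?invr_gt0//.
  by rewrite natr1 ltr_nat.
by apply/eqP; rewrite eqn_leq (H _ _ a b')// (H _ _ a' b).
Qed.

Lemma grid_cell_ex k t : (forall i, `|row_of t 0 i| < k.+1%:R) ->
  exists z : grid_index k, grid_cell z t.
Proof.
move=> tk; have K0 : 0 < k.+1%:R :> R by rewrite ltr0n.
pose v i := (row_of t 0 i + k.+1%:R) * k.+1%:R.
have v0 i : 0 <= v i.
  by rewrite mulr_ge0// -lerBlDr sub0r; have := tk i; rewrite ltr_norml => /andP[/ltW].
have vK i : (Num.truncn (v i) < 2 * k.+1 * k.+1)%N.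
  have := truncn_itv (v0 i) => /andP[a _]; rewrite -(ltr_nat R).
  apply: le_lt_trans a _; rewrite natrM /v ltr_pM2r// natrM mulr_natl mulr2n ltrD2r.
  by have := tk i; rewrite ltr_norml => /andP[_].
exists [ffun i => Ordinal (vK i)] => i; rewrite !mxE ffunE /=.
have /andP[a b] := truncn_itv (v0 i).
rewrite lerBlDr ler_pdivrMr// a /= addrAC -[X in _ + X - _]mul1r -mulrDl natr1.
by rewrite ltrBrDr ltr_pdivlMr.
Qed.

Lemma grid_eval f k (z : grid_index k) t : grid_cell z t -> simple_eval (grid f k) t = f (grid_point z).
Proof.
move=> zt; rewrite /simple_eval big_map big_enum /= (bigD1 z)//= big1 => [|z' z'z].
  by rewrite indicE mem_set// scale1r addr0.
rewrite indicE memNset ?scale0r// => z't.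
by move/eqP: z'z; apply; exact: (grid_cell_inj z't zt).
Qed.

Lemma grid_eval0 f k t : (forall z : grid_index k, ~ grid_cell z t) ->
  simple_eval (grid f k) t = 0.
Proof.
move=> Nt; rewrite /simple_eval big_map big1// => z _.
by rewrite indicE memNset ?scale0r//; exact: Nt.
Qed.

(** Continuity makes the step functions on the grids converge pointwise, and the decay provides the
    integrable majorant of dominated convergence. *)
Definition decaying f := continuous f /\ dominated (fun y => rho y ^- 2) f.

Let w (t : carrier) : R := rho (row_of t) ^- 2.

Let w0 t : 0 < w t. Proof. by rewrite invr_gt0 exprn_gt0// rho_gt0. Qed.

Lemma simple_grid f k : simple leb (grid f k).
Proof.
move=> _ /mapP[z _ ->] /=; split; first exact: grid_cell_measurable.
(* A lower bound of [w] on the cell, whose side is at most 1; since [w] is integrable, the cell has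
   finite measure. *)
pose c := (rho (grid_point z) * rho (const_mx 1 : 'rV[R]_d)) ^- 2.
apply: (@finite_measure_superlevel _ _ _ _ w _ _ _ _ c) => //.
- exact: measurable_rho_row_ofV.
- exact: integral_rho.
- exact: grid_cell_measurable.
- by rewrite invr_gt0 exprn_gt0// mulr_gt0// rho_gt0.
move=> t zt; rewrite /c /w lef_pV2 ?posrE ?exprn_gt0 ?mulr_gt0 ?rho_gt0//.
rewrite lerXn2r ?nnegrE ?mulr_ge0 ?(ltW (rho_gt0 _))//.
rewrite -[row_of t](subrK (grid_point z)) addrC.
rewrite (le_trans (rhoD _ _))// ler_wpM2l ?(ltW (rho_gt0 _))//.
apply: rho_le => i; rewrite !mxE normr1.
by have := grid_cell_close zt i; rewrite !mxE => /le_trans; apply; rewrite invf_le1 ?ltr0n// ler1n.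
Qed.

(** Uniform in [k]: a cell has side at most 1, so passing from [t] to the corner of its cell changes
    [rho] by a bounded factor. *)
Lemma grid_bound f j C : 0 <= C -> (forall y, semi j (f y) <= C * rho y ^- 2) ->
  forall k t, semi j (simple_eval (grid f k) t) <=
    C * rho (const_mx 1 : 'rV[R]_d) ^+ 2 * w t.
Proof.
move=> C0 fC k t; have [[z zt]|] := pselect (exists z : grid_index k, grid_cell z t); last first.
  move=> Nz; rewrite grid_eval0 ?semi0; last by move=> z zt; apply: Nz; exists z.
  by rewrite mulr_ge0 ?(ltW (w0 _))// mulr_ge0// exprn_ge0// ltW// rho_gt0.
rewrite (grid_eval _ zt) (le_trans (fC _))// -mulrA ler_wpM2l//.
rewrite /w -exprVn -[rho (row_of t) ^- 2]exprVn -exprMn.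
rewrite lerXn2r ?nnegrE ?mulr_ge0 ?invr_ge0 ?(ltW (rho_gt0 _))//.
rewrite ler_pdivlMr ?rho_gt0// mulrC ler_pdivrMr ?rho_gt0// mulrC.
rewrite -[row_of t](subrK (grid_point z)) addrC.
rewrite (le_trans (rhoD _ _))// ler_wpM2l ?(ltW (rho_gt0 _))//.
apply: rho_le => i; rewrite !mxE normr1.
by have := grid_cell_close zt i; rewrite !mxE => /le_trans; apply; rewrite invf_le1 ?ltr0n// ler1n.
Qed.

Lemma grid_cvg f j t : continuous f ->
  (semi j (f (row_of t) - simple_eval (grid f k) t))%:E @[k --> \oo] --> 0%E.
Proof.
move=> cf; apply: cvg_EFin; first by apply: nearW.
apply/cvgrPdist_lt => e e0.
have /continuous_semiP/(_ j e e0)[del d0 Hd] : {for row_of t, continuous f} by exact: cf.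
pose N := maxn (Num.truncn `|row_of t|).+1 (Num.truncn del^-1).+1.
exists N => // k /= Nk.
have tk : `|row_of t| < k.+1%:R.
  apply: lt_trans (truncnS_gt _) _; rewrite ltr_nat ltnS.
  exact: leq_trans (leq_maxl _ _) Nk.
have kd : k.+1%:R^-1 < del.
  rewrite invf_plt ?posrE ?ltr0n//; apply: lt_trans (truncnS_gt _) _.
  by rewrite ltr_nat ltnS; exact: leq_trans (leq_maxr _ _) Nk.
have [z zt] : exists z : grid_index k, grid_cell z t.
  by apply: grid_cell_ex => i; exact: le_lt_trans (rV_coord_le _ _) tk.
rewrite sub0r normrN ger0_norm ?semi_ge0// (grid_eval _ zt) semi_distrC.
rewrite -[grid_point z](subrK (row_of t)) [_ - _ + _]addrC; apply: Hd.
apply: le_lt_trans kd; rewrite [leLHS]/Num.norm/= mx_normrE; apply/bigmax_leP => /=.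
split=> [|[a i] _]; first by rewrite invr_ge0.
by rewrite /= ord1 !mxE distrC; have := grid_cell_close zt i; rewrite !mxE.
Qed.

(** [f] is a pointwise limit of its step functions, which makes the function a limit of seminorms of
    simple functions, known to be measurable. *)
Lemma measurable_semi_grid f j k : continuous f ->
  measurable_fun setT (fun t => semi j (f (row_of t) - simple_eval (grid f k) t)).
Proof.
move=> cf; apply: (@measurable_fun_cvg _ _ _ _
  (fun l t => semi j (simple_eval (grid f l) t - simple_eval (grid f k) t))).
  move=> l; have s : simple leb (simple_scale (-1) (grid f k) ++ grid f l).
    by apply: simple_cat; [apply: simple_scale_simple|]; exact: simple_grid.
  have := measurable_semi_simple j 0 s.
  by under eq_fun do rewrite simple_evalD scaleN1r add0r addrC.
move=> t _; have /fine_cvgP[_ /cvgrPdist_lt H] := @grid_cvg f j t cf.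
apply/cvgrPdist_lt => e e0; near=> l.
have : `|0 - semi j (f (row_of t) - simple_eval (grid f l) t)| < e.
  by near: l; exact: H.
rewrite sub0r normrN ger0_norm ?semi_ge0// => He; apply: le_lt_trans He.
set a := f _; set b := simple_eval (grid f l) t; set c := simple_eval (grid f k) t.
rewrite ler_norml; have H1 := semi_dist_le j a b c; have H2 := semi_dist_le j b a c.
by rewrite (semi_distrC j b a) in H2; apply/andP; split; lra.
Unshelve. all: by end_near. Qed.

Lemma grid_integral_cvg f j : decaying f ->
  (\int[leb]_t (semi j (f (row_of t) - simple_eval (grid f k) t))%:E)%E
    @[k --> \oo] --> 0%E.
Proof.
move=> [cf bf]; have [|C C0 HC] := dominatedP _ bf j.
  by move=> y; rewrite invr_ge0 exprn_ge0// ltW// rho_gt0.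
pose D := C + C * rho (const_mx 1 : 'rV[R]_d) ^+ 2.
have D0 : 0 <= D by rewrite addr_ge0// mulr_ge0// exprn_ge0// ltW// rho_gt0.
have := @dominated_convergence _ _ _ leb setT measurableT
  (fun k t => (semi j (f (row_of t) - simple_eval (grid f k) t))%:E) (cst 0%E)
  (fun t => (D * w t)%:E).
case=> //.
- by move=> k; apply/measurable_EFinP; exact: measurable_semi_grid.
- by apply: aeW => t _; exact: grid_cvg.
- apply/integrableP; split.
    apply/measurable_EFinP; apply: measurable_funM => //.
    exact: measurable_rho_row_ofV.
  under eq_integral => t _ do
    rewrite gee0_abs ?lee_fin ?mulr_ge0 ?(ltW (w0 _))// EFinM.
  rewrite ge0_integralZl_EFin//.
  + apply: lte_mul_pinfty => //; exact: integral_rho.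
  + by move=> t _; rewrite lee_fin ltW.
  + by apply/measurable_EFinP; exact: measurable_rho_row_ofV.
- apply: aeW => t k _; rewrite gee0_abs ?lee_fin ?semi_ge0//.
  rewrite (le_trans (semiB _ _ _))// /D mulrDl lerD ?HC//.
  exact: grid_bound.
by move=> _ _; rewrite integral0.
Qed.

Lemma grid_simple_integral_cvg f : decaying f ->
  exists v : A, simple_integral leb (grid f k) @[k --> \oo] --> v.
Proof.
move=> df; apply: semi_complete => j e e0; have e2 : 0 < e / 2 by rewrite divr_gt0.
have /fine_cvgP[[N1 _ fu] /cvgrPdist_lt/(_ _ e2)[N2 _ cu]] := grid_integral_cvg j df.
have H k : (maxn N1 N2 <= k)%N ->
    (\int[leb]_t (semi j (f (row_of t) - simple_eval (grid f k) t))%:E < (e / 2)%:E)%E.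
  rewrite geq_max => /andP[/fu fk /cu]; rewrite /= sub0r normrN => ck.
  by rewrite -(fineK fk) lte_fin; apply: le_lt_trans ck; exact: ler_norm.
exists (maxn N1 N2) => p q /H Hp /H Hq; rewrite -lte_fin.
apply: (@le_lt_trans _ _ _ _ _ (simple_integral_dist (f := f \o @row_of R d) _ _ _ _)).
- exact: simple_grid.
- exact: simple_grid.
- by apply: measurable_semi_grid; exact: df.1.
- by apply: measurable_semi_grid; exact: df.1.
by rewrite [in ltRHS](splitr e) EFinD lteD.
Qed.

Lemma bochner_grid f (v : A) : decaying f ->
  simple_integral leb (grid f k) @[k --> \oo] --> v ->
  bochner_integral leb (f \o @row_of R d) v.
Proof.
move=> df fv; exists (grid f); split=> //.
- exact: simple_grid.
- by move=> j k; apply: measurable_semi_grid; exact: df.1.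
- by move=> j; exact: grid_integral_cvg.
Qed.

Lemma integral_bochner f (v : A) : bochner_integral leb (f \o @row_of R d) v -> Defs.integral f = v.
Proof. by move=> fv; apply: xget_unique => // v' /bochner_unique; apply. Qed.

(** The integral becomes the limit of one explicit sequence of Riemann sums. They depend linearly on
    [f], hence so does the integral. *)
Lemma integral_spec f : decaying f ->
  simple_integral leb (grid f k) @[k --> \oo] --> Defs.integral f /\
  bochner_integral leb (f \o @row_of R d) (Defs.integral f).
Proof.
move=> df; have [v fv] := grid_simple_integral_cvg df.
by have b := bochner_grid df fv; rewrite (integral_bochner b).
Qed.

Definition integral_const : R := fine (\int[leb]_t (w t)%:E)%E.

Lemma integral_const_ge0 : 0 <= integral_const.
Proof. by apply/fine_ge0/integral_ge0 => t _; rewrite lee_fin ltW. Qed.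

Lemma semi_integral f j C : decaying f -> 0 <= C ->
  (forall y, semi j (f y) <= C * rho y ^- 2) ->
  semi j (Defs.integral f) <= C * integral_const.
Proof.
move=> df C0 fC; have [_ b] := integral_spec df.
have mw : measurable_fun setT w by exact: measurable_rho_row_ofV.
have := bochner_bound (j := j) (g := fun t => C * w t) b _ _.
move=> /(_ (measurable_funM _ _) _); rewrite -lee_fin => H.
apply: le_trans (H _ _ _) _ => //; first by move=> t; exact: fC.
under eq_integral do rewrite EFinM.
rewrite ge0_integralZl_EFin//; last 2 first.
- by move=> t _; rewrite lee_fin ltW.
- exact/measurable_EFinP.
by rewrite EFinM fineK// ge0_fin_numE ?integral_rho//; apply: integral_ge0 => t _; rewrite lee_fin ltW.
Qed.

Lemma decaying_linear c f g : decaying f -> decaying g -> decaying (c *: f + g).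
Proof.
move=> [cf bf] [cg bg]; split=> [y|j]; first exact: cvg_linear (cf y) (cg y).
have [C1 H1] := bf j; have [C2 H2] := bg j.
exists (cmod c * C1 + C2) => y; rewrite !fctE.
rewrite (le_trans (semiD _ _ _))// mulrDl lerD// semiZc -mulrA ler_wpM2l//.
exact: cmod_ge0.
Qed.

Lemma integral_linear c f g : decaying f -> decaying g ->
  Defs.integral (c *: f + g) = c *: Defs.integral f + Defs.integral g.
Proof.
move=> df dg; have [sf _] := integral_spec df; have [sg _] := integral_spec dg.
have [s _] := integral_spec (decaying_linear c df dg).
apply: (cvg_unique frechet_hausdorff s); rewrite (_ : (fun k => _) = fun k =>
  c *: simple_integral leb (grid f k) + simple_integral leb (grid g k)).
  exact: cvg_linear.
apply/funext => k; rewrite /simple_integral !big_map scaler_sumr -big_split /=.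
by apply: eq_bigr => z _; rewrite !fctE scalerDr !scalerA mulrC.
Qed.

Lemma integral_translate h f : decaying f -> Defs.integral (translate h f) = Defs.integral f.
Proof.
move=> df; have [_ [s [ss ms is_ vs]]] := integral_spec df.
apply: integral_bochner.
(* The approximating simple functions of [f], with their sets pulled back by the translation. *)
pose s' k := [seq (shift_of h @^-1` p.1, p.2) | p <- s k].
have ev k t : simple_eval (s' k) t = simple_eval (s k) (shift_of h t).
  by rewrite /simple_eval big_map; apply: eq_bigr => p _.
exists s'; split.
- move=> k _ /mapP[p /ss[mp poo] ->] /=; rewrite shift_preserves//; split=> //.
  by rewrite -[X in measurable X]setTI; exact: measurable_shift.
- move=> j k; under eq_fun do rewrite ev /= /translate -row_of_shift.
  exact: (measurableT_comp (ms j k) (measurable_shift h)).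
- move=> j; rewrite (_ : (fun k => _) = fun k =>
    (\int[leb]_x (semi j ((f \o @row_of R d) x - simple_eval (s k) x)%R)%:E)%E)//.
  apply/funext => k; under eq_integral do rewrite ev /= /translate -row_of_shift.
  apply: (@ge0_integral_invariant _ _ _ leb (shift_of h) (fun x =>
    (semi j ((f \o @row_of R d) x - simple_eval (s k) x)%R)%:E)).
  + exact: measurable_shift.
  + exact: shift_preserves.
  + exact/measurable_EFinP/ms.
  + by move=> t; rewrite lee_fin semi_ge0.
rewrite (_ : (fun k => _) = fun k => simple_integral leb (s k))//.
apply/funext => k; rewrite /simple_integral big_map; apply: eq_big_seq => p ps /=.
by rewrite shift_preserves//; have [] := ss k p ps.
Qed.

End GridApproximation.

(** * Iterated integrals: translation and integration of derivatives *)

Section DoubleIntegral.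
Context {R : realType} {A : frechetType R} {d : nat}.
Local Notation body2 := 'rV[R]_(d + d).
Implicit Types (F G : body2 -> A) (C : R).
Local Notation W := (@integral_const R d).
Local Notation rhom2 := (fun z => rho z ^- 2).

Definition double_integral G : A :=
  Defs.integral (fun y1 : 'rV[R]_d => Defs.integral (fun y2 : 'rV[R]_d =>
    G (row_mx y1 y2))).

(** What the iterated integral requires. The decay splits between the two blocks since [rho] does;
    the bounds on the first derivatives make the inner integral continuous in the outer variable. *)
Definition tame G := [/\ smooth G, dominated rhom2 G &
  forall i, dominated rhom2 (partial i G)].

Lemma rhom2_ge0 e (y : 'rV[R]_e) : 0 <= rho y ^- 2.
Proof. by rewrite invr_ge0 exprn_ge0// ltW// rho_gt0. Qed.

Lemma moderate_rhom2 e : moderate (fun y : 'rV[R]_e => rho y ^- 2).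
Proof. exact/moderateV/moderateX/moderate_rho. Qed.

Lemma dominated_linear e (u : 'rV[R]_e -> R) (f g : 'rV[R]_e -> A) c :
  dominated u f -> dominated u g -> dominated u (c *: f + g).
Proof.
move=> bf bg j; have [C1 H1] := bf j; have [C2 H2] := bg j.
exists (cmod c * C1 + C2) => y; rewrite !fctE.
rewrite (le_trans (semiD _ _ _))// mulrDl lerD// semiZc -mulrA ler_wpM2l//.
exact: cmod_ge0.
Qed.

Lemma dominated_translate e (u : 'rV[R]_e -> R) (f : 'rV[R]_e -> A) (h : 'rV[R]_e) :
  moderate u -> dominated u f -> dominated u (translate h f).
Proof.
move=> [u0 [m um]] bf j; have [C C0 HC] := dominatedP (fun z => ltW (u0 z)) bf j.
exists (C * rho h ^+ m) => y.
by rewrite (le_trans (HC _))// -mulrA ler_wpM2l// mulrC.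
Qed.

Lemma tame_linear c F G : tame F -> tame G -> tame (c *: F + G).
Proof.
move=> [sF bF dF] [sG bG dG]; split.
- exact: smooth_linear.
- exact: dominated_linear.
- move=> i; rewrite partial_linear; first exact: dominated_linear.
  + by move=> y; exists (partial i F y); exact: smooth_partial_cvg0.
  + by move=> y; exists (partial i G y); exact: smooth_partial_cvg0.
Qed.

Lemma tame_translate (h : body2) G : tame G -> tame (translate h G).
Proof.
move=> [sG bG dG]; split.
- exact: smooth_translate.
- by apply: dominated_translate => //; exact: moderate_rhom2.
- move=> i; rewrite partial_translate//.
  by apply: dominated_translate => //; exact: moderate_rhom2.
Qed.

Lemma norm_row_mx0 (y : 'rV[R]_d) : `|row_mx 0 y : body2| <= `|y|.
Proof.
rewrite [leLHS]/Num.norm/= mx_normrE; apply/bigmax_leP => /=; split=> // -[a i] _ /=.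
rewrite ord1; case: (split_ordP i) => k ->.
  by rewrite row_mxEl mxE normr0.
by rewrite row_mxEr rV_coord_le.
Qed.

Lemma tame_inner G y1 : tame G -> decaying (fun y2 => G (row_mx y1 y2)).
Proof.
move=> [sG bG _]; split=> [y2|j].
  apply/continuous_semiP => j e e0.
  have /continuous_semiP/(_ j e e0)[del d0 Hd] : {for row_mx y1 y2, continuous G} by
    exact: smooth_continuous.
  exists del => // h hd; rewrite -[y1]addr0 -add_row_mx addr0; apply: Hd.
  exact: le_lt_trans (norm_row_mx0 _) hd.
have [C C0 HC] := dominatedP (@rhom2_ge0 _) bG j; exists C => y2.
rewrite (le_trans (HC _))// rho_row_mx exprMn invfM ler_wpM2l// ler_piMl ?rhom2_ge0//.
by rewrite invf_le1 ?exprn_gt0 ?rho_gt0// exprn_ege1// rho_ge1.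
Qed.

Lemma semi_inner G j C y1 : tame G -> 0 <= C ->
  (forall y, semi j (G y) <= C * rho y ^- 2) ->
  semi j (Defs.integral (fun y2 => G (row_mx y1 y2))) <= C * rho y1 ^- 2 * W.
Proof.
move=> tG C0 HC; apply: semi_integral => //.
- exact: tame_inner.
- by rewrite mulr_ge0// rhom2_ge0.
by move=> y; rewrite (le_trans (HC _))// rho_row_mx exprMn invfM mulrA.
Qed.

Lemma sum_row_mxl (y : 'rV[R]_d) : \sum_i `|(row_mx y 0 : body2) 0 i| = \sum_i `|y 0 i|.
Proof.
rewrite big_split_ord /= [X in _ + X]big1 ?addr0 => [|i _].
  by apply: eq_bigr => i _; rewrite row_mxEl.
by rewrite row_mxEr mxE normr0.
Qed.

Lemma tame_lipschitz G j : tame G -> exists2 C, 0 <= C & forall y h : body2,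
  (`|h| <= 1) -> semi j (G (y + h) - G y) <= C * rho y ^- 2 * \sum_i `|h 0 i|.
Proof.
move=> [sG _ dG]; have [u0 [m um]] := @moderate_rhom2 (d + d).
have /choice[B HB] : forall i, exists C, 0 <= C /\ forall y : body2, semi j (partial i G y) <= C * rho y ^- 2.
  by move=> i; have [C C0 HC] := dominatedP (@rhom2_ge0 _) (dG i) j; exists C.
pose M := \sum_i B i.
have BM i : B i <= M.
  rewrite /M (bigD1 i)//= lerDl sumr_ge0// => k _; exact: (HB k).1.
have M0 : 0 <= M by apply: sumr_ge0 => k _; exact: (HB k).1.
exists (M * rho (const_mx 1 : body2) ^+ m) => [|y h h1].
  by rewrite mulr_ge0// exprn_ge0// ltW// rho_gt0.
have := @semi_lipschitz_moderate _ _ _ j G (fun i => partial i G) _ m M y h um _ M0 _ u0.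
move=> /(_ _ _)/le_trans; apply.
- by move=> i z; exact: smooth_partial_cvg0.
- by move=> i z; rewrite (le_trans ((HB i).2 z))// ler_wpM2r// rhom2_ge0.
rewrite [leRHS](_ : _ = M * rho y ^- 2 * rho (const_mx 1 : body2) ^+ m * \sum_i `|h 0 i|);
  last by ring.
rewrite ler_wpM2r ?sumr_ge0// ler_wpM2l ?mulr_ge0 ?rhom2_ge0//.
rewrite lerXn2r ?nnegrE ?(ltW (rho_gt0 _))//; apply: rho_le => i.
by rewrite [in leRHS]mxE normr1 (le_trans (rV_coord_le _ _)).
Qed.

Lemma norm_row_mxl (y : 'rV[R]_d) : `|row_mx y 0 : body2| <= `|y|.
Proof.
rewrite [leLHS]/Num.norm/= mx_normrE; apply/bigmax_leP => /=; split=> // -[a i] _ /=.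
rewrite ord1; case: (split_ordP i) => k ->.
  by rewrite row_mxEl rV_coord_le.
by rewrite row_mxEr mxE normr0.
Qed.

Lemma tame_outer G : tame G ->
  decaying (fun y1 => Defs.integral (fun y2 => G (row_mx y1 y2))).
Proof.
move=> tG; split=> [y1|j]; last first.
  have [_ bG _] := tG; have [C C0 HC] := dominatedP (@rhom2_ge0 _) bG j.
  by exists (C * W) => y1; rewrite mulrAC; exact: semi_inner.
apply/continuous_semiP => j e e0.
have [C C0 HC] := tame_lipschitz j tG.
pose K := C * rho y1 ^- 2 * d%:R * W.
have K0 : 0 <= K by rewrite !mulr_ge0// ?rhom2_ge0// integral_const_ge0.
have K1 : 0 < K + 1 by rewrite ltr_wpDl.
exists (Num.min 1 (e / (K + 1))); first by rewrite lt_min ltr01 divr_gt0.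
move=> h; rewrite lt_min => /andP[h1 he].
rewrite -scaleN1r addrC -integral_linear; [|exact: tame_inner..].
apply: (@le_lt_trans _ _ (K * `|h|)); last first.
  rewrite (@le_lt_trans _ _ ((K + 1) * `|h|))//; first by rewrite ler_wpM2r// lerDl.
  by rewrite -ltr_pdivlMl// mulrC.
rewrite [leRHS](_ : _ = C * rho y1 ^- 2 * (d%:R * `|h|) * W); last by rewrite /K; ring.
apply: semi_integral.
- by apply: decaying_linear; exact: tame_inner.
- by rewrite !mulr_ge0// rhom2_ge0.
move=> y2; rewrite !fctE scaleN1r addrC -[y2 in row_mx (y1 + h) y2]addr0 -add_row_mx.
rewrite (le_trans (HC _ _ _))//; first exact: le_trans (norm_row_mxl _) (ltW h1).
rewrite sum_row_mxl rho_row_mx exprMn invfM.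
rewrite [leRHS](_ : _ = C * (rho y1 ^- 2 * rho y2 ^- 2) * (d%:R * `|h|)); last by ring.
by rewrite ler_wpM2l ?norm_sum_le// !mulr_ge0// rhom2_ge0.
Qed.

Lemma double_integral_linear c F G : tame F -> tame G ->
  double_integral (c *: F + G) = c *: double_integral F + double_integral G.
Proof.
move=> tF tG; rewrite /double_integral -integral_linear; [|exact: tame_outer..].
congr Defs.integral; apply/funext => y1.
by rewrite !fctE -integral_linear; [|exact: tame_inner..].
Qed.

Lemma semi_double_integral G j C : tame G -> 0 <= C ->
  (forall y, semi j (G y) <= C * rho y ^- 2) ->
  semi j (double_integral G) <= C * W ^+ 2.
Proof.
move=> tG C0 HC; rewrite expr2 mulrA; apply: semi_integral.
- exact: tame_outer.
- by rewrite mulr_ge0// integral_const_ge0.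
- by move=> y1; rewrite mulrAC; exact: semi_inner.
Qed.

Lemma double_integral_translate (h : body2) G : tame G ->
  double_integral (translate h G) = double_integral G.
Proof.
move=> tG; rewrite /double_integral -[RHS](integral_translate (lsubmx h)); last exact: tame_outer.
congr Defs.integral; apply/funext => y1; rewrite [RHS]/translate.
rewrite -[RHS](integral_translate (rsubmx h)); last exact: tame_inner.
by congr Defs.integral; apply/funext => y2; rewrite /translate -[h in LHS]hsubmxK add_row_mx.
Qed.

(** The integral of [G (y + h e_i) - G y] vanishes by translation invariance, so that of
    [h * partial i G] is, up to sign, the integral of a remainder of order [h ^+ 2 * rho ^- 2]; it
    remains to divide by [h]. The order of integration is never interchanged. *)
Lemma double_integral_partial i G : tame G -> tame (partial i G) ->
  double_integral (partial i G) = 0.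
Proof.
move=> tG tdG; have [sG _ _] := tG; apply: semi_eq0 => j e e0.
have [C C0 HC] := tame_lipschitz j tdG.
pose K := C * W ^+ 2.
have K0 : 0 <= K by rewrite mulr_ge0// exprn_ge0// integral_const_ge0.
have K1 : 0 < K + 1 by rewrite ltr_wpDl.
pose h := Num.min 1 (e / (K + 1)).
have h0 : 0 < h by rewrite lt_min ltr01 divr_gt0.
have h1 : h <= 1 by rewrite ge_min lexx.
pose ei := delta_mx 0 i : body2.
have sumE (t : R) : \sum_k `|(t *: ei) 0 k| = `|t|.
  rewrite (bigD1 i)//= !mxE !eqxx mulr1 big1 ?addr0// => k ki.
  by rewrite !mxE eqxx (negPf ki) mulr0 normr0.
have nE (t : R) : `|t *: ei| <= `|t|.
  rewrite [leLHS]/Num.norm/= mx_normrE; apply/bigmax_leP => /=; split=> // -[a k] _ /=.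
  by rewrite !mxE; case: (_ && _); rewrite ?mulr1 ?mulr0 ?normr0.
pose D := (-1) *: G + translate (h *: ei) G.
have tD : tame D by apply: tame_linear => //; exact: tame_translate.
have tT : tame ((- h%:C) *: partial i G + D) by exact: tame_linear.
have E : double_integral ((- h%:C) *: partial i G + D) = - (h%:C *: double_integral (partial i G)).
  rewrite double_integral_linear// double_integral_linear//; last exact: tame_translate.
  rewrite double_integral_translate//.
  by rewrite scaleN1r addNr addr0 scaleNr.
have : semi j (double_integral ((- h%:C) *: partial i G + D)) <= C * h * h * W ^+ 2.
  apply: semi_double_integral => //; first by rewrite !mulr_ge0// ltW.
  move=> y; rewrite /D !fctE /translate scaleN1r scaleNr.
  rewrite (_ : _ + _ = G (y + h *: ei) - G y - h%:C *: partial i G y); last by zmod.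
  rewrite (le_trans (@partial_mean_value _ _ _ j i G (partial i G) y h (partial i G y)
    (C * rho y ^- 2 * h) _ _))//.
  - by move=> t _; exact: smooth_partial_cvg0.
  - move=> t; rewrite (gtr0_norm h0) => th; rewrite (le_trans (HC _ _ _))//.
      by rewrite (le_trans (nE t))// (le_trans th).
    by rewrite sumE ler_wpM2l// mulr_ge0// rhom2_ge0.
  - by rewrite (gtr0_norm h0) le_eqVlt; apply/orP; left; apply/eqP; ring.
rewrite E semiN semiZr (gtr0_norm h0) => H.
have : semi j (double_integral (partial i G)) <= K * h.
  by rewrite -(ler_pM2l h0) (le_trans H)// le_eqVlt; apply/orP; left; apply/eqP; rewrite /K; ring.
move=> /le_trans; apply; apply: (@le_trans _ _ ((K + 1) * h)).
  by rewrite ler_wpM2r ?ltW// ltrDl.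
by rewrite -ler_pdivlMl// mulrC ge_min lexx orbT.
Qed.

End DoubleIntegral.

(** * Oscillating integrals *)

Section ScalarFactors.
Context {R : realType} {A : frechetType R} {d : nat}.
Implicit Types (f g : 'rV[R]_d -> A).
Local Notation e_ i := (delta_mx 0 i : 'rV[R]_d).

Definition scalar_deriv i (a : 'rV[R]_d -> R[i]) (y : 'rV[R]_d) (a' : R[i]) :=
  forall e, 0 < e -> exists2 del, 0 < del & forall h : R, `|h| < del ->
    cmod (a (y + h *: e_ i) - a y - h%:C * a') <= e * `|h|.

Lemma scalar_deriv_quadratic i (a : 'rV[R]_d -> R[i]) y (a' : R[i]) (C : R) : 0 <= C ->
  (forall h : R, cmod (a (y + h *: e_ i) - a y - h%:C * a') <= C * h ^+ 2) ->
  scalar_deriv i a y a'.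
Proof.
move=> C0 H e e0; have C1 : 0 < C + 1 by rewrite ltr_wpDl.
exists (e / (C + 1)) => [|h hd]; first by rewrite divr_gt0.
rewrite (le_trans (H h))// -(real_normK (num_real h)) expr2 mulrA ler_wpM2r//.
apply: (@le_trans _ _ ((C + 1) * `|h|)); first by rewrite ler_wpM2r// lerDl.
by rewrite -ler_pdivlMl// mulrC ltW.
Qed.

Lemma partial_cvg_scale i (a : 'rV[R]_d -> R[i]) f y (a' : R[i]) l : scalar_deriv i a y a' ->
  partial_cvg i f y l ->
  partial_cvg i (fun z => a z *: f z) y (a' *: f y + a y *: l).
Proof.
move=> Ha /partial_cvgP Hf; apply/partial_cvgP => j e e0.
pose M := cmod (a y) + semi j (f y) + 1.
have M0 : 0 < M by rewrite /M ltr_wpDl// addr_ge0 ?cmod_ge0 ?semi_ge0.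
pose e1 := Num.min 1 (e / 2 / M).
have e10 : 0 < e1 by rewrite lt_min ltr01 !divr_gt0.
have e1M : e1 * (cmod (a y) + semi j (f y)) <= e / 2.
  apply: (@le_trans _ _ (e1 * M)); first by rewrite ler_wpM2l ?(ltW e10)// /M lerDl.
  by rewrite -ler_pdivlMr// ge_min lexx orbT.
have [d1 d10 H1] := Ha e1 e10; have [d2 d20 H2] := Hf j e1 e10.
pose Q := (cmod a' + 1) * (semi j l + 1).
have Q0 : 0 < Q by rewrite mulr_gt0// ltr_wpDl// ?cmod_ge0// semi_ge0.
exists (Num.min (Num.min d1 d2) (e / 2 / Q)); first by rewrite !lt_min d10 d20 !divr_gt0.
move=> h; rewrite !lt_min => /andP[/andP[hd1 hd2] hd3].
have {}H1 := H1 h hd1; have {}H2 := H2 h hd2.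
set z := y + h *: e_ i in H1 H2 *.
(* Two first order remainders and a product of increments, the latter of second order in [h]. *)
have -> : a z *: f z - a y *: f y - h%:C *: (a' *: f y + a y *: l) =
    a y *: (f z - f y - h%:C *: l) + (a z - a y - h%:C * a') *: f y +
    (a z - a y) *: (f z - f y).
  rewrite !scalerBl !scalerBr !scalerDr !scalerA [a y * h%:C]mulrC.
  by zmod.
have Da : cmod (a z - a y) <= (cmod a' + 1) * `|h|.
  rewrite -[a z - a y](subrK (h%:C * a')) (le_trans (cmodD _ _))//.
  rewrite cmodM cmod_real mulrDl mul1r addrC [cmod a' * _]mulrC lerD2l (le_trans H1)//.
  by rewrite ler_piMl// ge_min lexx.
have Df : semi j (f z - f y) <= (semi j l + 1) * `|h|.
  rewrite -[f z - f y](subrK (h%:C *: l)) (le_trans (semiD _ _ _))//.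
  rewrite semiZr mulrDl mul1r addrC [semi j l * _]mulrC lerD2l (le_trans H2)//.
  by rewrite ler_piMl// ge_min lexx.
rewrite (le_trans (semiD _ _ _))// (splitr e) mulrDl lerD//.
  rewrite (le_trans (semiD _ _ _))// !semiZc.
  apply: (@le_trans _ _ (e1 * (cmod (a y) + semi j (f y)) * `|h|)); last by rewrite ler_wpM2r.
  rewrite mulrDr mulrDl lerD//.
    by rewrite [e1 * _]mulrC -mulrA ler_wpM2l ?cmod_ge0.
  by rewrite mulrAC ler_wpM2r ?semi_ge0.
rewrite semiZc; apply: (@le_trans _ _ ((cmod a' + 1) * `|h| * ((semi j l + 1) * `|h|))).
  by rewrite ler_pM ?cmod_ge0 ?semi_ge0.
rewrite mulrACA mulrA ler_wpM2r// mulrC -ler_pdivlMr//; exact: ltW.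
Qed.

End ScalarFactors.

Section Phase.
Context {R : realType}.
Implicit Types s t : R.

Lemma expiD s t : expi (s + t) = expi s * expi t.
Proof.
apply/eqP; rewrite /expi eq_complex /= cosD sinD eqxx /=.
by rewrite addrC [cos s * _]mulrC eqxx.
Qed.

Lemma cmod_expi t : cmod (expi t) = 1.
Proof.
apply/eqP; rewrite -(@eqrXn2 _ 2) ?cmod_ge0// expr1n cmod_sqr /=.
by rewrite cos2Dsin2.
Qed.

Lemma cmod_le (z : R[i]) : cmod z <= `|complex.Re z| + `|complex.Im z|.
Proof.
rewrite -(@ler_pXn2r _ 2) ?nnegrE ?cmod_ge0 ?addr_ge0// cmod_sqr.
have := mulr_ge0 (normr_ge0 (complex.Re z)) (normr_ge0 (complex.Im z)).
by rewrite sqrrD !real_normK ?num_real//; lra.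
Qed.

Lemma is_derive_eps (phi : R -> R) l : is_derive (0 : R) 1 phi l ->
  forall e, 0 < e -> exists2 del, 0 < del & forall t, `|t| < del ->
    `|phi t - phi 0 - t * l| <= e * `|t|.
Proof.
move=> [dphi <-] e e0.
have /cvgrPdist_lt/(_ e e0) : (fun h : R => h^-1 *: (phi (h *: 1 + 0) - phi 0)) @ 0^' --> 'D_1 phi 0.
  exact: dphi.
rewrite near_withinE => /nbhs_ballP[del d0 Hd]; exists del => // t td.
have [->|t0] := eqVneq t 0; first by rewrite subrr mul0r subr0 normr0 mulr0.
have := Hd t; rewrite /ball/= sub0r normrN => /(_ td t0) /ltW.
rewrite addr0 [t *: 1]mulr1 => H.
rewrite (_ : _ - _ = - (t * ('D_1 phi 0 - t^-1 *: (phi t - phi 0)))).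
  by rewrite normrN normrM mulrC ler_wpM2r.
by rewrite mulrBr [t^-1 *: _]/(t^-1 * _) mulrA mulfV// mul1r opprB.
Qed.

Lemma expi_deriv0 e : 0 < e -> exists2 del, 0 < del & forall t : R, `|t| < del ->
  cmod (expi t - 1 - (0 +i* t)) <= e * `|t|.
Proof.
move=> e0; have e2 : 0 < e / 2 by rewrite divr_gt0.
have [d1 d10 H1] := is_derive_eps (is_derive_cos (0 : R)) e2.
have [d2 d20 H2] := is_derive_eps (is_derive_sin (0 : R)) e2.
exists (Num.min d1 d2); first by rewrite lt_min d10.
move=> t; rewrite lt_min => /andP[/H1 {}H1 /H2 {}H2].
rewrite (le_trans (cmod_le _))//= (splitr e) mulrDl lerD//.
  by move: H1; rewrite sin0 cos0 oppr0 mulr0 !subr0 addr0.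
by move: H2; rewrite sin0 cos0 mulr1 !subr0.
Qed.

End Phase.

Section QuantitativeBounds.
Context {R : realType} {A : frechetType R} {d : nat}.
Implicit Types (f g : 'rV[R]_d -> A) (u v : 'rV[R]_d -> R) (B C : R).

(** [symb] with explicit constants, for one seminorm and derivatives of order at most [K].
    Continuity estimates need the constant of the result to be linear in [B], with a factor chosen
    before the function. *)
Fixpoint derivs_le j K u B f : Prop :=
  (forall y, semi j (f y) <= B * u y) /\
  if K is K'.+1 then forall i, derivs_le j K' u B (partial i f) else True.

Lemma derivs_leP j K u B f : derivs_le j K u B f <->
  forall s, (size s <= K)%N -> forall y, semi j (foldr partial f s y) <= B * u y.
Proof.
elim: K f => [|K IH] f /=.
  split=> [[H _] s|H]; first by rewrite leqn0 => /nilP ->.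
  by split=> //; exact: (H [::]).
split=> [[H Hd] s|H].
  case/lastP: s => [|s i]; first by move=> _; exact: H.
  by rewrite size_rcons ltnS -cats1 foldr_cat; apply: (IH _).1 => /=; exact: Hd.
split; first exact: (H [::]).
move=> i; apply/IH => s sK y; have := H (rcons s i).
by rewrite size_rcons -cats1 foldr_cat; apply.
Qed.

Lemma derivs_le0 j K u B f y : derivs_le j K u B f -> semi j (f y) <= B * u y.
Proof. by case: K => [|K] []. Qed.

Lemma derivs_le_weaken j K K' u v B B' f : (K' <= K)%N ->
  (forall y, B * u y <= B' * v y) -> derivs_le j K u B f -> derivs_le j K' v B' f.
Proof.
move=> KK uv /derivs_leP H; apply/derivs_leP => s sK y.
by rewrite (le_trans _ (uv y))// H// (leq_trans sK).
Qed.

Lemma derivs_le_linear j K u B1 B2 f g c : smooth f -> smooth g ->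
  derivs_le j K u B1 f -> derivs_le j K u B2 g ->
  derivs_le j K u (cmod c * B1 + B2) (c *: f + g).
Proof.
move=> sf sg /derivs_leP Hf /derivs_leP Hg; apply/derivs_leP => s sK y.
rewrite foldr_partial_linear// !fctE (le_trans (semiD _ _ _))// semiZc mulrDl lerD ?Hg//.
by rewrite -mulrA ler_wpM2l ?cmod_ge0// Hf.
Qed.

Lemma symb_derivs_le j K u f : (forall y, 0 <= u y) -> symb u f ->
  exists2 B, 0 <= B & derivs_le j K u B f.
Proof.
move=> u0; elim: K f => [|K IH] f sf.
  have [C C0 HC] := dominatedP u0 (symb_dominated sf) j.
  by exists C => //=; split.
have [C C0 HC] := dominatedP u0 (symb_dominated sf) j.
have /choice[B HB] : forall i, exists B, 0 <= B /\ derivs_le j K u B (partial i f).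
  by move=> i; have [B B0 HB] := IH _ (symb_partial i sf); exists B.
have S0 : 0 <= \sum_i B i by apply: sumr_ge0 => i _; exact: (HB i).1.
exists (C + \sum_i B i); first by rewrite addr_ge0.
split=> [y|i].
  by rewrite (le_trans (HC y))// ler_wpM2r// lerDl.
apply: derivs_le_weaken (HB i).2 => // y; rewrite ler_wpM2r//.
rewrite (bigD1 i)//= addrCA lerDl addr_ge0// sumr_ge0// => k _; exact: (HB k).1.
Qed.

Lemma derivs_le_symb u f : smooth f ->
  (forall j K, exists B, derivs_le j K u B f) -> symb u f.
Proof.
move=> sf H; split=> // s j; have [B /derivs_leP HB] := H j (size s).
by exists B => y; exact: HB.
Qed.

End QuantitativeBounds.

Section Resolvent.
Context {R : realType} {A : frechetType R} {d : nat}.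
Implicit Types (f g : 'rV[R]_d -> A) (u v : 'rV[R]_d -> R) (B C : R).
Local Notation e_ i := (delta_mx 0 i : 'rV[R]_d).
Local Notation coordw t := (fun y : 'rV[R]_d => 1 + `|y 0 t|).

Definition resolvent (c : R) t (y : 'rV[R]_d) : R[i] := (1 +i* (c * y 0 t))^-1.
Definition resolvent_mul c t f : 'rV[R]_d -> A := fun y => resolvent c t y *: f y.

Lemma one_imag_neq0 (s : R) : (1 +i* s : R[i]) != 0.
Proof. by rewrite eq_complex /= oner_eq0. Qed.

Lemma cmod_one_imag (s : R) : 1 <= cmod (1 +i* s) /\ `|s| <= cmod (1 +i* s).
Proof.
have H : cmod (1 +i* s) ^+ 2 = 1 + s ^+ 2 by rewrite cmod_sqr /= expr1n.
split; rewrite -(@ler_pXn2r _ 2) ?nnegrE ?cmod_ge0// H ?expr1n ?lerDl ?sqr_ge0//.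
by rewrite real_normK ?num_real// lerDr.
Qed.

Lemma cmod_resolvent_le1 c t y : cmod (resolvent c t y) <= 1.
Proof.
by rewrite cmodV invf_le1 ?(lt_le_trans ltr01)//; exact: (cmod_one_imag _).1.
Qed.

Lemma cmod_resolvent c t y : c != 0 ->
  cmod (resolvent c t y) <= (1 + `|c|^-1) / (1 + `|y 0 t|).
Proof.
move=> c0; have [H1 H2] := cmod_one_imag (c * y 0 t).
have b0 : 0 < 1 + `|y 0 t| by rewrite ltr_pwDl.
rewrite cmodV ler_pdivlMr// mulrC ler_pdivrMr ?(lt_le_trans ltr01)//.
rewrite mulrDl mul1r lerD// ler_pdivlMl ?normr_gt0//.
by rewrite -normrM.
Qed.

Lemma resolvent_deriv c t i y : scalar_deriv i (resolvent c t) y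
  (- ((0 +i* (c * (i == t)%:R)) * resolvent c t y ^+ 2)).
Proof.
apply: (@scalar_deriv_quadratic _ _ _ _ _ _ (c ^+ 2)) => [|h]; first exact: sqr_ge0.
rewrite /resolvent !mxE eqxx andTb; have [->|it] := eqVneq t i; last first.
  rewrite (_ : 0 +i* (c * false%:R) = 0 :> R[i]); last by rewrite mulr0.
  by rewrite mulr0 addr0 subrr sub0r mul0r oppr0 mulr0 oppr0 cmod0 mulr_ge0 ?sqr_ge0.
rewrite !mulr1.
set p := 1 +i* (c * y 0 i); set q := 1 +i* (c * (y 0 i + h)).
have p0 : p != 0 by exact: one_imag_neq0.
have q0 : q != 0 by exact: one_imag_neq0.
have qp : q - p = h%:C * (0 +i* c).
  by apply/eqP; rewrite eq_complex /=; apply/andP; split; apply/eqP; ring.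
(* The first order remainder of [1 / p] in closed form; as the inverses have modulus at most 1, it
   is at most [c ^+ 2 * h ^+ 2]. *)
have -> : q^-1 - p^-1 - h%:C * - ((0 +i* c) * p^-1 ^+ 2) = (q - p) ^+ 2 * p^-1 ^+ 2 * q^-1.
  rewrite mulrN opprK mulrA -qp.
  by field; rewrite p0 q0.
have nqp : cmod (q - p) = `|h| * `|c|.
  rewrite qp cmodM cmod_real; congr (_ * _); apply/eqP.
  by rewrite -(@eqrXn2 _ 2) ?cmod_ge0// cmod_sqr /= expr0n add0r real_normK ?num_real.
have cV (s : R) : cmod (1 +i* s)^-1 <= 1.
  by rewrite cmodV invf_le1 ?(lt_le_trans ltr01)//; exact: (cmod_one_imag _).1.
have hc : `|h| * `|c| * (`|h| * `|c|) = c ^+ 2 * h ^+ 2.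
  by rewrite mulrACA -!expr2 !real_normK ?num_real// mulrC.
rewrite [(q - p) ^+ 2]expr2 [p^-1 ^+ 2]expr2 !cmodM nqp.
set P := cmod p^-1; set Q := cmod q^-1; have PQ : P * P * Q <= 1.
  by rewrite !mulr_ile1 ?mulr_ge0 ?cmod_ge0 ?cV.
have X0 : 0 <= c ^+ 2 * h ^+ 2 by rewrite mulr_ge0// sqr_ge0.
have := ler_wpM2l X0 PQ; rewrite mulr1 -hc; apply: le_trans.
by rewrite le_eqVlt; apply/orP; left; apply/eqP; ring.
Qed.

Lemma partial_cvg_resolvent c t i f y l : partial_cvg i f y l ->
  partial_cvg i (resolvent_mul c t f) y (resolvent c t y *:
    ((- (0 +i* (c * (i == t)%:R))) *: resolvent_mul c t f y + l)).
Proof.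
move=> fl; have := partial_cvg_scale (resolvent_deriv c t i y) fl.
rewrite /resolvent_mul; set b := 0 +i* _; set r := resolvent c t y.
suff -> : r *: (- b *: (r *: f y) + l) = - (b * r ^+ 2) *: f y + r *: l by [].
by rewrite scalerDr !scalerA; congr (_ *: _ + _); ring.
Qed.

(** Differentiating the resolvent [r] produces [r ^+ 2], so the iterated derivatives of [r f]
    involve higher and higher powers of [r]. This class contains them, being closed under
    differentiation and under multiplication by [r]. Its domination by [u] only uses that [r] has
    modulus at most 1; the gain of decay is added afterwards. *)
Inductive resolvent_class c t u : ('rV[R]_d -> A) -> Prop :=
| ResolventBase f of symb u f : resolvent_class c t u f
| ResolventStep (b : R[i]) f g of resolvent_class c t u f & resolvent_class c t u g :
    resolvent_class c t u (b *: resolvent_mul c t f + g).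

Lemma resolvent_class_smooth c t u f : moderate u -> resolvent_class c t u f ->
  smooth f /\ forall s, resolvent_class c t u (foldr partial f s).
Proof.
move=> mu; have u0 y : 0 <= u y by rewrite ltW//; exact: mu.1.
apply: smooth_coind_dominated => {f} g.
  move=> Pg; exists u => //; elim: Pg => [{}g /symb_dominated//|b g1 g2 _ IH1 _ IH2] j.
  have [C1 C10 H1] := dominatedP u0 IH1 j; have [C2 H2] := IH2 j.
  exists (cmod b * C1 + C2) => y; rewrite !fctE (le_trans (semiD _ _ _))//.
  rewrite mulrDl lerD// !semiZc -mulrA ler_wpM2l ?cmod_ge0//.
  by rewrite (le_trans _ (H1 y))// ler_piMl ?semi_ge0// cmod_resolvent_le1.
move=> i; elim=> [{}g sg|b g1 g2 P1 [h1 Ph1 H1] P2 [h2 Ph2 H2]].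
  exists (partial i g); first exact/ResolventBase/symb_partial.
  by move=> y; exact: symb_cvg sg.
exists (b *: resolvent_mul c t ((- (0 +i* (c * (i == t)%:R))) *: resolvent_mul c t g1 + h1) + h2).
  by do 2 apply: ResolventStep => //.
by move=> y; apply: partial_cvg_linear => //; exact: partial_cvg_resolvent.
Qed.

Lemma resolvent_class_mul c t u f : moderate u ->
  resolvent_class c t u f -> resolvent_class c t u (resolvent_mul c t f).
Proof.
move=> mu Pf; rewrite (_ : resolvent_mul c t f = 1 *: resolvent_mul c t f + (fun=> 0)).
  apply: ResolventStep => //; apply: ResolventBase; apply: symb0 => y.
  by rewrite ltW//; exact: mu.1.
by apply/funext => y; rewrite !fctE scale1r addr0.
Qed.

Lemma partial_resolvent_mul c t i f : smooth f -> partial i (resolvent_mul c t f) =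
  resolvent_mul c t ((- (0 +i* (c * (i == t)%:R))) *: resolvent_mul c t f + partial i f).
Proof.
move=> sf; apply/funext => y; apply: partialE.
exact/partial_cvg_resolvent/smooth_partial_cvg0.
Qed.

(** Induction on the order: [partial i (r f) = r (b r f + partial i f)], where the bracket again
    belongs to the class. The term [b r f] is bounded by the induction hypothesis with its gain
    discarded, and the outer [r] then gains the factor once; whence [C * (|c| * C + 1)]. *)
Lemma derivs_le_resolvent_class c t j K : c != 0 -> exists2 C, 0 <= C &
  forall u f B, moderate u -> resolvent_class c t u f -> 0 <= B ->
    derivs_le j K u B f ->
    derivs_le j K (fun y => u y / (1 + `|y 0 t|)) (C * B) (resolvent_mul c t f).
Proof.
move=> c0; have bound u f B : (forall y, 0 <= u y) -> 0 <= B ->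
    (forall y, semi j (f y) <= B * u y) -> forall y,
    semi j (resolvent_mul c t f y) <= (1 + `|c|^-1) * B * (u y / (1 + `|y 0 t|)).
  move=> u0 B0 HB y; rewrite semiZc.
  rewrite (le_trans (ler_pM _ _ (cmod_resolvent t y c0) (HB y)))// ?cmod_ge0 ?semi_ge0//.
  by rewrite le_eqVlt; apply/orP; left; apply/eqP; rewrite mulrACA [_^-1 * _]mulrC.
have C00 : 0 <= 1 + `|c|^-1 by rewrite addr_ge0// invr_ge0.
elim: K => [|K [C C0 IH]].
  exists (1 + `|c|^-1) => // u f B mu sf B0 [HB _]; split=> //.
  by apply: bound => // y; rewrite ltW//; exact: mu.1.
have C10 : 0 <= C * (`|c| * C + 1) by rewrite mulr_ge0// addr_ge0// mulr_ge0.
exists (1 + `|c|^-1 + C * (`|c| * C + 1)); first by rewrite addr_ge0.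
move=> u f B mu Pf B0 HBf; have [HB HdB] := HBf.
have u0 y : 0 <= u y by rewrite ltW//; exact: mu.1.
have w0 y : 0 <= u y / (1 + `|y 0 t|) by rewrite divr_ge0// addr_ge0.
have uw y : u y / (1 + `|y 0 t|) <= u y.
  by rewrite ler_piMr// invf_le1 ?lerDl// ltr_pwDl.
split=> [y|i].
  by rewrite (le_trans (bound _ _ _ u0 B0 HB y))// ler_wpM2r// ler_wpM2r// lerDl.
have HK : derivs_le j K u B f by apply: derivs_le_weaken HBf.
have [sf Pdf] := resolvent_class_smooth mu Pf.
have Pr := resolvent_class_mul mu Pf.
have [sr _] := resolvent_class_smooth mu Pr.
rewrite partial_resolvent_mul//; set b := - _.
have bc : cmod b <= `|c|.
  rewrite /b cmodN (le_trans (cmod_le _))//= normr0 add0r normrM ler_piMr//.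
  by case: (_ == _); rewrite ?normr1 ?normr0.
have Hr : derivs_le j K u (C * B) (resolvent_mul c t f).
  apply: derivs_le_weaken (IH u f B mu Pf B0 HK) => // y.
  by rewrite ler_wpM2l// mulr_ge0.
have Hf' := derivs_le_linear b sr (smooth_partial i sf) Hr (HdB i).
have B'0 : 0 <= cmod b * (C * B) + B by rewrite addr_ge0// mulr_ge0 ?cmod_ge0// mulr_ge0.
have := IH u _ _ mu (ResolventStep b Pf (Pdf [:: i])) B'0 Hf'.
apply: derivs_le_weaken => // y; rewrite ler_wpM2r//.
rewrite [leRHS](_ : _ = (1 + `|c|^-1) * B + C * (`|c| * (C * B) + B)); last by ring.
rewrite (@le_trans _ _ (C * (`|c| * (C * B) + B)))//; last by rewrite lerDr mulr_ge0.
by rewrite ler_wpM2l// lerD2r ler_wpM2r// mulr_ge0.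
Qed.

Lemma derivs_le_resolvent c t j K : c != 0 -> exists2 C, 0 <= C &
  forall u f B, moderate u -> symb u f -> 0 <= B -> derivs_le j K u B f ->
    derivs_le j K (fun y => u y / (1 + `|y 0 t|)) (C * B) (resolvent_mul c t f).
Proof.
move=> /(derivs_le_resolvent_class t j K)[C C0 H]; exists C => // u f B mu sf.
exact/H/ResolventBase.
Qed.

Lemma symb_resolvent c t u f : c != 0 -> moderate u -> symb u f ->
  symb (fun y => u y / (1 + `|y 0 t|)) (resolvent_mul c t f).
Proof.
move=> c0 mu sf; have u0 y : 0 <= u y by rewrite ltW//; exact: mu.1.
apply: derivs_le_symb.
  by have [] := resolvent_class_smooth mu (resolvent_class_mul mu (ResolventBase c t sf)).
move=> j K; have [B B0 HB] := symb_derivs_le j K u0 sf.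
by have [C C0 H] := derivs_le_resolvent t j K c0; exists (C * B); exact: H.
Qed.

Definition coord_mul t f : 'rV[R]_d -> A := fun y => (y 0 t)%:C *: f y.

Lemma partial_cvg_coord_mul t i f y l : partial_cvg i f y l ->
  partial_cvg i (coord_mul t f) y ((i == t)%:R *: f y + (y 0 t)%:C *: l).
Proof.
move=> fl; apply: partial_cvg_scale fl.
apply: (@scalar_deriv_quadratic _ _ _ _ _ _ 0) => // h.
rewrite !mxE eqxx andTb eq_sym mul0r; set X := (X in cmod X).
suff -> : X = 0 by rewrite cmod0.
rewrite /X; case: (i == t); rewrite /= !(mulr1n, mulr0n, mulr1, mulr0, addr0, subr0, subrr)//.
by rewrite rmorphD/= [X in X - _]addrAC subrr add0r subrr.
Qed.

Lemma symb_coord_mul t u f : moderate u -> symb u f ->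
  symb (fun y => u y * (1 + `|y 0 t|)) (coord_mul t f).
Proof.
move=> mu sf; have u0 y : 0 <= u y by rewrite ltW//; exact: mu.1.
pose v y := u y * (1 + `|y 0 t|).
have mv : moderate v by apply: moderateM => //; exact: moderate_coord.
have v0 y : 0 <= v y by rewrite ltW//; exact: mv.1.
have uv y : u y <= 1 * v y by rewrite mul1r ler_peMr// lerDl.
(* Products by the coordinate are not stable under differentiation: the derivative of the coordinate
   leaves a term of weight [u], collected in [f2]. *)
pose P g := exists f1 f2, [/\ symb u f1, symb v f2 & g = coord_mul t f1 + f2].
apply: (@symb_coind _ _ _ v P) => //.
- move=> _ [f1 [f2 [s1 s2 ->]]] j.
  have [C1 C10 H1] := dominatedP u0 (symb_dominated s1) j.
  have [C2 H2] := symb_dominated s2 j.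
  exists (C1 + C2) => y; rewrite fctE (le_trans (semiD _ _ _))// mulrDl lerD//.
  rewrite semiZr mulrC mulrA ler_pM ?semi_ge0// lerDr//.
- move=> _ i [f1 [f2 [s1 s2 ->]]].
  exists (coord_mul t (partial i f1) + ((i == t)%:R *: f1 + partial i f2)).
    exists (partial i f1), ((i == t)%:R *: f1 + partial i f2); split=> //.
      exact: symb_partial.
    by apply: symb_linear => //; [exact: symb_le uv u0 s1|exact: symb_partial].
  move=> y; have := partial_cvg_linear (c := 1) (i := i) (y := y)
      (partial_cvg_coord_mul (t := t) (symb_cvg s1)) (symb_cvg s2).
  by rewrite !scale1r !fctE [coord_mul _ _ _ + _]addrCA addrA.
- exists f, (fun=> 0); split=> //; first exact: symb0.
  by apply/funext => y; rewrite fctE addr0.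
Qed.

End Resolvent.

(** * Integration by parts against a quadratic phase *)

Section Oscillating.
Context {R : realType} {A : frechetType R} {d : nat}.
Local Notation D := (d + d)%N.
Local Notation body2 := 'rV[R]_D.
Local Notation e_ i := (delta_mx 0 i : body2).
Local Notation coordw t := (fun y : body2 => 1 + `|y 0 t|).
Local Notation rpow m := (fun y : body2 => rho y ^- m).
Implicit Types (F G : body2 -> A) (u v : body2 -> R) (B C : R).

(** [E] is an abstract exponential of a quadratic form without squares: along the direction [i] it
    is a pure oscillation of frequency [c i * y 0 (sigma i)], itself constant along [i] as
    [sigma i != i]. *)
Variables (E : body2 -> R[i]) (sigma : 'I_D -> 'I_D) (c : 'I_D -> R).
Hypothesis E_shift : forall i (y : body2) (h : R),
  E (y + h *: e_ i) = E y * expi (h * (c i * y 0 (sigma i))).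
Hypothesis E_unit : forall y, cmod (E y) = 1.
Hypothesis c_neq0 : forall i, c i != 0.
Hypothesis sigma_inj : injective sigma.
Hypothesis sigma_neq : forall i, sigma i != i.

Definition phase_mul F : body2 -> A := fun y => E y *: F y.

Lemma phase_deriv i y : scalar_deriv i E y ((0 +i* (c i * y 0 (sigma i))) * E y).
Proof.
move=> e e0; move: (c i * y 0 (sigma i)) (E_shift i y) => t E_shift_t.
have t1 : 0 < `|t| + 1 by rewrite ltr_wpDl.
have [|d1 d10 H] := @expi_deriv0 R (e / (`|t| + 1)); first by rewrite divr_gt0.
exists (d1 / (`|t| + 1)) => [|h hd]; first by rewrite divr_gt0.
rewrite E_shift_t (_ : _ - _ = E y * (expi (h * t) - 1 - (0 +i* (h * t)))); last first.
  rewrite (_ : 0 +i* (h * t) = h%:C * (0 +i* t)); first by ring.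
  by apply/eqP; rewrite eq_complex /=; apply/andP; split; apply/eqP; ring.
rewrite cmodM E_unit mul1r.
have ht : `|h * t| < d1.
  rewrite [`|h * t|]normrM (@le_lt_trans _ _ (`|h| * (`|t| + 1)))//.
    by rewrite ler_wpM2l// lerDl.
  by rewrite -ltr_pdivlMr.
rewrite (le_trans (H _ ht))// [`|h * t|]normrM.
rewrite [leLHS](_ : _ = e * `|h| * (`|t| / (`|t| + 1))); last by ring.
by rewrite ler_piMr ?mulr_ge0 ?(ltW e0)// ler_pdivrMr// mul1r lerDl.
Qed.

Lemma partial_cvg_phase i F y l : partial_cvg i F y l ->
  partial_cvg i (phase_mul F) y
    (E y *: ((0 +i* c i) *: coord_mul (sigma i) F y + l)).
Proof.
move=> Fl; have := partial_cvg_scale (phase_deriv i y) Fl.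
suff -> : E y *: ((0 +i* c i) *: coord_mul (sigma i) F y + l) =
  ((0 +i* (c i * y 0 (sigma i))) * E y) *: F y + E y *: l by [].
rewrite scalerDr /coord_mul !scalerA; congr (_ *: _ + _).
rewrite (_ : 0 +i* (c i * y 0 (sigma i)) = (0 +i* c i) * (y 0 (sigma i))%:C); first by ring.
by apply/eqP; rewrite eq_complex /=; apply/andP; split; apply/eqP; ring.
Qed.

Definition phase_partial i F : body2 -> A :=
  (0 +i* c i) *: coord_mul (sigma i) F + partial i F.

Lemma symb_phase_partial i u F : moderate u -> symb u F ->
  symb (fun y => u y * (1 + `|y 0 (sigma i)|)) (phase_partial i F).
Proof.
move=> mu sF; have mv := moderateM mu (moderate_coord (sigma i)).
apply: symb_linear; first by move=> y; rewrite ltW//; exact: mv.1.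
  exact: symb_coord_mul.
apply: (@symb_le _ _ _ u _ 1); last exact: symb_partial.
  by move=> y; rewrite mul1r ler_peMr ?lerDl// ltW//; exact: mu.1.
by move=> y; rewrite ltW//; exact: mu.1.
Qed.

Lemma smooth_phase u F : moderate u -> symb u F ->
  smooth (phase_mul F) /\ forall i, partial i (phase_mul F) = phase_mul (phase_partial i F).
Proof.
move=> mu sF; split; last first.
  by move=> i; apply/funext => y; apply: partialE; apply: partial_cvg_phase; exact: symb_cvg sF.
pose P g := exists G v, [/\ moderate v, symb v G & g = phase_mul G].
apply: (smooth_coind_dominated (P := P) _ _ _).1.
- move=> _ [G [v [mv sG ->]]]; exists v => // j; have [C HC] := symb_dominated sG j.
  by exists C => y; rewrite semiZc E_unit mul1r.
- move=> _ i [G [v [mv sG ->]]]; exists (phase_mul (phase_partial i G)).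
    exists (phase_partial i G), (fun y => v y * (1 + `|y 0 (sigma i)|)).
    split=> //; first exact/moderateM/moderate_coord.
    exact: symb_phase_partial.
  by move=> y; apply: partial_cvg_phase; exact: symb_cvg sG.
- by exists F, u.
Qed.

Lemma moderate_rpow m : moderate (rpow m).
Proof. exact/moderateV/moderateX/moderate_rho. Qed.

Lemma rpow_ge0 m (y : body2) : 0 <= rho y ^- m.
Proof. by rewrite invr_ge0 exprn_ge0// ltW// rho_gt0. Qed.

Lemma rpow_le m n (y : body2) : (m <= n)%N -> rho y ^- n <= 1 * rho y ^- m.
Proof.
move=> mn; rewrite mul1r lef_pV2 ?posrE ?exprn_gt0 ?rho_gt0//.
by rewrite ler_weXn2l// rho_ge1.
Qed.

Lemma rpow_coord m t (y : body2) : rho y ^- m.+1 * (1 + `|y 0 t|) <= 1 * rho y ^- m.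
Proof.
rewrite mul1r exprSr invfM -mulrA ler_piMr ?rpow_ge0// mulrC ler_pdivrMr ?rho_gt0//.
by rewrite mul1r coord_le_rho.
Qed.

(** The derivative of the phase grows linearly and costs one power of [rho]. Two such losses on top
    of the integrable exponent 2 explain the exponent 4 used below: [tame] controls first
    derivatives, and integration by parts integrates a function that is already a derivative. *)
Lemma symb_phase_partial_rpow i m G : symb (rpow m.+1) G ->
  symb (rpow m) (phase_partial i G).
Proof.
move=> sG; apply: symb_le (symb_phase_partial i (moderate_rpow m.+1) sG).
  by move=> y; exact: rpow_coord.
by move=> y; rewrite mulr_ge0 ?rpow_ge0// addr_ge0.
Qed.

Lemma tame_phase G : symb (rpow 3) G -> tame (phase_mul G).
Proof.
move=> sG; have [sE dE] := smooth_phase (moderate_rpow 3) sG.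
have b F : symb (rpow 2) F -> dominated (rpow 2) (phase_mul F).
  move=> sF j; have [C HC] := symb_dominated sF j.
  by exists C => y; rewrite semiZc E_unit mul1r.
split=> //.
  apply/b/(symb_le _ _ sG) => y; [exact: (rpow_le y (leqnSn 2))|exact: rpow_ge0].
by move=> i; rewrite dE; apply/b/symb_phase_partial_rpow.
Qed.

Definition reduce i F : body2 -> A :=
  resolvent_mul (c i) (sigma i) ((-1) *: partial i F + F).

Lemma symb_reduce i u F : moderate u -> symb u F ->
  symb (fun y => u y / (1 + `|y 0 (sigma i)|)) (reduce i F).
Proof.
move=> mu sF; apply: symb_resolvent => //; apply: symb_linear => //.
  by move=> y; rewrite ltW//; exact: mu.1.
exact: symb_partial.
Qed.

Lemma symb_reduce_rpow i m G : symb (rpow m) G -> symb (rpow m) (reduce i G).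
Proof.
move=> sG; apply: (symb_le (C := 1) _ _ (symb_reduce i (moderate_rpow m) sG)) => y.
  by rewrite mul1r ler_piMr ?rpow_ge0// invf_le1 ?lerDl// ltr_pwDl.
by rewrite divr_ge0 ?rpow_ge0// addr_ge0.
Qed.

(* Integration by parts: [E = r * (E + d_i E)], where [r = 1 / (1 + i c_i y_(sigma i))]
   is constant in the direction [i]. *)
Lemma double_integral_reduce i G : symb (rpow 4) G ->
  double_integral (phase_mul (reduce i G)) = double_integral (phase_mul G).
Proof.
move=> sG; pose H := resolvent_mul (c i) (sigma i) G.
have sH : symb (rpow 4) H.
  apply: (@symb_le _ _ _ (fun y => rho y ^- 4 / (1 + `|y 0 (sigma i)|)) _ 1).
  - move=> y; rewrite mul1r ler_piMr ?rpow_ge0// invf_le1 ?lerDl// ltr_pwDl//.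
  - by move=> y; rewrite divr_ge0 ?rpow_ge0// addr_ge0.
  - by apply: symb_resolvent => //; exact: moderate_rpow.
have s3 F : symb (rpow 4) F -> symb (rpow 3) F.
  by move=> sF; apply: (symb_le _ _ sF) => y; [exact: (rpow_le y (leqnSn 3))|exact: rpow_ge0].
have tG := tame_phase (s3 _ sG).
have tH := tame_phase (s3 _ sH).
have tr := tame_phase (s3 _ (symb_reduce_rpow i sG)).
have [_ dH] := smooth_phase (moderate_rpow 4) sH.
have tdH : tame (partial i (phase_mul H)).
  by rewrite dH; apply/tame_phase/symb_phase_partial_rpow.
have := double_integral_partial tH tdH.
rewrite (_ : partial i (phase_mul H) = (-1) *: phase_mul (reduce i G) + phase_mul G); last first.
  apply/funext => y; rewrite dH !fctE /phase_mul /phase_partial scaleN1r !fctE.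
  rewrite partial_resolvent_mul; last exact: symb_smooth sG.
  rewrite (_ : 0 +i* (c i * (i == sigma i)%:R) = 0); last by rewrite eq_sym (negPf (sigma_neq i)) mulr0.
  rewrite oppr0 scale0r add0r.
  rewrite /H /coord_mul /reduce /resolvent_mul !fctE scaleN1r.
  set r := resolvent _ _ _; rewrite -scalerN -scalerDr; congr (_ *: _).
  have r0 : r * (1 + (0 +i* c i) * (y 0 (sigma i))%:C) = 1.
    rewrite (_ : 1 + _ = 1 +i* (c i * y 0 (sigma i))) ?mulVf ?one_imag_neq0//.
    by apply/eqP; rewrite eq_complex /=; apply/andP; split; apply/eqP; ring.
  rewrite !scalerA; set a := _ *: G y.
  have GE : r *: G y + a = G y.
    by rewrite /a -scalerDl -[RHS]scale1r -r0; congr (_ *: _); ring.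
  transitivity (- (- (r *: partial i G y) + r *: G y) + (r *: G y + a)); first by zmod.
  by rewrite GE scalerDr scalerN.
rewrite (double_integral_linear _ tr tG) scaleN1r => /eqP.
by rewrite addrC subr_eq0 => /eqP ->.
Qed.

Lemma double_integral_foldr_reduce l G : symb (rpow 4) G ->
  symb (rpow 4) (foldr reduce G l) /\
  double_integral (phase_mul (foldr reduce G l)) = double_integral (phase_mul G).
Proof.
move=> sG; elim: l => [|i l [sl IH]]; first by split.
split; first exact: (symb_reduce_rpow i sl).
exact: (etrans (double_integral_reduce i sl) IH).
Qed.

Local Notation gain l y := (\prod_(i <- l) (1 + `|y 0 (sigma i)|)).

Lemma gain_gt0 l (y : body2) : 0 < \prod_(i <- l) (1 + `|y 0 (sigma i)|).
Proof. by apply: prodr_gt0 => i _; rewrite ltr_pwDl. Qed.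

Lemma moderate_gain l u : moderate u -> moderate (fun y => u y / gain l y).
Proof.
move=> mu; apply: moderateM => //; apply: moderateV.
elim: l => [|i l IH].
  rewrite (_ : (fun _ => _) = fun=> 1); first exact: moderate1.
  by apply/funext => y; rewrite big_nil.
rewrite (_ : (fun _ => _) = fun y : body2 => (1 + `|y 0 (sigma i)|) * gain l y).
  by apply: moderateM => //; exact: moderate_coord.
by apply/funext => y; rewrite big_cons.
Qed.

Lemma symb_foldr_reduce l u F : moderate u -> symb u F ->
  symb (fun y => u y / gain l y) (foldr reduce F l).
Proof.
move=> mu sF; elim: l => [|i l IH].
  apply: (@symb_le _ _ _ u (fun y => u y / gain [::] y) 1) sF => y.
    by rewrite big_nil divr1 mul1r.
  by rewrite ltW//; exact: mu.1.
have := symb_reduce i (moderate_gain l mu) IH.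
apply: (@symb_le _ _ _ (fun y => u y / gain l y / (1 + `|y 0 (sigma i)|)) (fun y => u y / gain (i :: l) y) 1) => y.
  by rewrite mul1r big_cons [_ * \prod_(_ <- _) _]mulrC invfM mulrA.
by rewrite divr_ge0 ?addr_ge0// ltW//; exact: (moderate_gain l mu).1.
Qed.

Lemma derivs_le_reduce i j K : exists2 C, 0 <= C &
  forall u F B, moderate u -> symb u F -> 0 <= B -> derivs_le j K.+1 u B F ->
    derivs_le j K (fun y => u y / (1 + `|y 0 (sigma i)|)) (C * B) (reduce i F).
Proof.
have [C C0 H] := derivs_le_resolvent (A := A) (sigma i) j K (c_neq0 i).
exists (2 * C); first by rewrite mulr_ge0.
move=> u F B mu sF B0 HF; have u0 y : 0 <= u y by rewrite ltW//; exact: mu.1.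
have HK : derivs_le j K u B F by apply: derivs_le_weaken HF.
have [_ Hd] := HF; have sf := symb_smooth sF.
have := derivs_le_linear (-1) (smooth_partial i sf) sf (Hd i) HK.
rewrite cmodN cmod1 mul1r => H2.
rewrite [2 * C * B](_ : _ = C * (B + B)); last by ring.
apply: H => //; last exact: addr_ge0.
by apply: symb_linear => //; exact: symb_partial.
Qed.

Lemma derivs_le_foldr_reduce l j K : exists2 C, 0 <= C &
  forall u F B, moderate u -> symb u F -> 0 <= B -> derivs_le j (size l + K) u B F ->
    derivs_le j K (fun y => u y / gain l y) (C * B) (foldr reduce F l).
Proof.
elim: l K => [|i l IH] K.
  exists 1 => // u F B mu sF B0 /=; apply: derivs_le_weaken => // y.
  by rewrite big_nil divr1 mul1r.
have [C1 C10 H1] := IH K.+1; have [C2 C20 H2] := derivs_le_reduce i j K.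
exists (C2 * C1) => [|u F B mu sF B0 HF]; first exact: mulr_ge0.
have := H1 u F B mu sF B0; rewrite addnS => /(_ HF) {}H1.
have := H2 _ _ _ (moderate_gain l mu) (symb_foldr_reduce l mu sF) (mulr_ge0 C10 B0) H1.
apply: derivs_le_weaken => // y.
by rewrite big_cons [_ * \prod_(_ <- _) _]mulrC invfM !mulrA.
Qed.

Definition sweeps N : seq 'I_D := flatten (nseq N (enum 'I_D)).

Lemma sweepsS N : sweeps N.+1 = enum 'I_D ++ sweeps N. Proof. by []. Qed.

(** As [sigma] permutes the coordinates, a sweep collects each factor of [rho] once. *)
Lemma gain_sweeps N (y : body2) : gain (sweeps N) y = rho y ^+ N.
Proof.
rewrite /sweeps; elim: N => [|N IH] /=; first by rewrite big_nil.
rewrite big_cat IH exprS; congr (_ * _).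
by rewrite big_enum /= /rho [RHS](reindex_inj sigma_inj).
Qed.

Definition osc_at N F : A := double_integral (phase_mul (foldr reduce F (sweeps N))).

Definition tempered M F := symb (fun y => rho y ^+ M) F.

Lemma moderate_rhoX M : moderate (fun y : body2 => rho y ^+ M).
Proof. exact/moderateX/moderate_rho. Qed.

Lemma rhoX_ge0 M (y : body2) : 0 <= rho y ^+ M.
Proof. by rewrite exprn_ge0// ltW// rho_gt0. Qed.

Lemma rho_ratio M N (y : body2) : (M + 4 <= N)%N -> rho y ^+ M / gain (sweeps N) y <= rho y ^- 4.
Proof.
move=> MN; rewrite gain_sweeps ler_pdivrMr ?exprn_gt0 ?rho_gt0//.
rewrite ler_pdivlMl ?exprn_gt0 ?rho_gt0// -exprD addnC.
by rewrite ler_weXn2l// rho_ge1.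
Qed.

Lemma symb_sweeps M N F : tempered M F -> (M + 4 <= N)%N ->
  symb (rpow 4) (foldr reduce F (sweeps N)).
Proof.
move=> tF MN; apply: (symb_le (C := 1) _ _ (symb_foldr_reduce (sweeps N) (moderate_rhoX M) tF)) => y.
  by rewrite mul1r rho_ratio.
by rewrite divr_ge0 ?rhoX_ge0// ltW// gain_gt0.
Qed.

(** Once the reduced integrand is of order [rho ^- 4], any further sweep is a genuine integration by
    parts and does not change the integral. *)
Lemma osc_atS M N N' F : tempered M F -> (M + 4 <= N <= N')%N -> osc_at N' F = osc_at N F.
Proof.
move=> tF /andP[MN] /subnK <-; elim: (N' - N)%N => [|p IH]; first by rewrite add0n.
apply: etrans IH; rewrite addSn /osc_at sweepsS foldr_cat.
apply: (double_integral_foldr_reduce _ _).2; apply: symb_sweeps tF _.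
exact: leq_trans MN (leq_addl _ _).
Qed.

(* After [M + 4] sweeps of integrations by parts, [F] of growth [rho ^+ M] has
   become integrable; the value does not depend on [M]. *)
Definition osc F : A := osc_at (xget 0%N [set M | tempered M F] + 4) F.

(** Frees [osc] from the exponent chosen in its definition: both numbers of sweeps are compared with
    their maximum. *)
Lemma oscE M N F : tempered M F -> (M + 4 <= N)%N -> osc F = osc_at N F.
Proof.
move=> tF MN; set m := xget 0%N [set M | tempered M F].
have tm : tempered m F by apply: (@xgetPex _ 0%N [set M | tempered M F]); exists M.
have E1 : osc_at (maxn (m + 4) N) F = osc_at (m + 4) F.
  by apply: osc_atS tm _; rewrite leqnn leq_maxl.
have E2 : osc_at (maxn (m + 4) N) F = osc_at N F.
  by apply: osc_atS tF _; rewrite MN leq_maxr.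
by move: E1 E2; rewrite /osc -/m => <- ->.
Qed.

Lemma foldr_reduce_linear l M b F G : tempered M F -> tempered M G ->
  foldr reduce (b *: F + G) l = b *: foldr reduce F l + foldr reduce G l.
Proof.
move=> tF tG; elim: l => //= i l ->; rewrite /reduce.
have sF := symb_smooth (symb_foldr_reduce l (moderate_rhoX M) tF).
have sG := symb_smooth (symb_foldr_reduce l (moderate_rhoX M) tG).
have := foldr_partial_linear b [:: i] sF sG => /= ->.
apply/funext => y; rewrite /resolvent_mul !fctE scalerA mulrC -scalerA -scalerDr.
by congr (_ *: _); rewrite !scaleN1r scalerDr scalerN; zmod.
Qed.

Lemma phase_mul_linear b F G : phase_mul (b *: F + G) = b *: phase_mul F + phase_mul G.
Proof.
by apply/funext => y; rewrite /phase_mul !fctE scalerDr !scalerA mulrC.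
Qed.

Lemma rpow43 G : symb (rpow 4) G -> symb (rpow 3) G.
Proof.
by move=> sG; apply: (symb_le _ _ sG) => y; [exact: (rpow_le y (leqnSn 3))|exact: rpow_ge0].
Qed.

Lemma osc_linear M b F G : tempered M F -> tempered M G ->
  osc (b *: F + G) = b *: osc F + osc G.
Proof.
move=> tF tG; have tFG : tempered M (b *: F + G) by apply: symb_linear => // y; exact: rhoX_ge0.
rewrite !(@oscE M (M + 4)%N)// /osc_at (foldr_reduce_linear _ _ tF tG) phase_mul_linear.
by rewrite double_integral_linear//; apply/tame_phase/rpow43; exact: symb_sweeps (leqnn _).
Qed.

Lemma osc_bound j M : exists K, exists2 C, 0 <= C & forall F B, tempered M F -> 0 <= B ->
  derivs_le j K (fun y => rho y ^+ M) B F -> semi j (osc F) <= C * B.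
Proof.
pose l := sweeps (M + 4).
(* No derivative of the reduced function has to be controlled, hence the order 0; each reduction
   consumes one derivative of [F], hence [size l] of them. *)
have [C C0 H] := derivs_le_foldr_reduce l j 0.
exists (size l + 0)%N, (C * (@integral_const R d) ^+ 2).
  by rewrite mulr_ge0// exprn_ge0// integral_const_ge0.
move=> F B tF B0 HF; rewrite (oscE tF (leqnn _)) mulrAC.
apply: semi_double_integral.
- exact/tame_phase/rpow43/symb_sweeps/leqnn.
- exact: mulr_ge0.
move=> y; rewrite semiZc E_unit mul1r.
rewrite (le_trans (derivs_le0 y (H _ _ _ (moderate_rhoX M) tF B0 HF)))//.
rewrite ler_wpM2l ?mulr_ge0// (le_trans (rho_ratio y (leqnn _)))//.
by have := @rpow_le 2 4 y isT; rewrite mul1r.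
Qed.

Lemma osc_integral F : symb (rpow 4) F -> osc F = double_integral (phase_mul F).
Proof.
move=> sF; have t0 : tempered 0 F.
  apply: (symb_le (C := 1) _ _ sF) => y; last exact: rpow_ge0.
  by have := @rpow_le 0 4 y isT; rewrite !expr0 invr1.
rewrite (oscE t0 (N := 4) isT) /osc_at.
exact: (double_integral_foldr_reduce (sweeps 4) sF).2.
Qed.

End Oscillating.

(** * Tensor products and translations *)

Section Tensor.
Context {R : realType} {A : frechetAlgType R} {d : nat}.
Local Notation D := (d + d)%N.
Local Notation body := 'rV[R]_d.
Local Notation body2 := 'rV[R]_D.
Implicit Types (f g : body -> A) (F G : body2 -> A) (B C : R).

Lemma fmulZl (c : R[i]) (x y z : A) : fmul (c *: x + y) z = c *: fmul x z + fmul y z.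
Proof. exact: fmul_linearl. Qed.

Lemma fmulZr (c : R[i]) (x y z : A) : fmul z (c *: x + y) = c *: fmul z x + fmul z y.
Proof. exact: fmul_linearr. Qed.

Lemma fmul0r (x : A) : fmul x 0 = 0.
Proof.
by have := fmulZr (-1) 0 0 x; rewrite scaler0 addr0 scaleN1r addNr.
Qed.

Lemma fmul0l (x : A) : fmul 0 x = 0.
Proof.
by have := fmulZl (-1) 0 0 x; rewrite scaler0 addr0 scaleN1r addNr.
Qed.

Lemma fmul_bound j : exists J, exists2 C, 0 <= C & forall (a b : A) B1 B2,
  0 <= B1 -> 0 <= B2 -> (forall i, (i <= J)%N -> semi i a <= B1) ->
  (forall i, (i <= J)%N -> semi i b <= B2) -> semi j (fmul a b) <= C * (B1 * B2).
Proof.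
have U : nbhs (fmul (0 : A) 0) [set w : A | semi j w < 1].
  by apply/nbhs_semi; exists j, 1; split=> // y /(_ j (leqnn j)); rewrite fmul0r subr0.
have := @fmul_continuous R A (0, 0) _ U => -[[V1 V2] /= [/nbhs_semi[N1 [e1 [e10 H1]]]
  /nbhs_semi[N2 [e2 [e20 H2]]]]] HV.
pose J := maxn N1 N2; exists J, (4 / (e1 * e2)); first by rewrite divr_ge0// mulr_ge0// ltW.
move=> a b B1 B2 B10 B20 Ha Hb.
have key (r1 r2 : R) : 0 < r1 -> 0 < r2 -> B1 <= r1 -> B2 <= r2 ->
    semi j (fmul a b) <= 4 / (e1 * e2) * (r1 * r2).
  move=> r10 r20 Br1 Br2.
  pose a' := (e1 / 2 / r1)%:C *: a; pose b' := (e2 / 2 / r2)%:C *: b.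
  have s1 : V1 a'.
    apply: H1 => i iN; rewrite subr0 semiZr gtr0_norm ?divr_gt0//.
    rewrite mulrAC ltr_pdivrMr// mulrC.
    have : semi i a <= r1 by rewrite (le_trans (Ha i _))// (leq_trans iN)// leq_maxl.
    move=> H; apply: (@le_lt_trans _ _ (r1 * (e1 / 2))); first by rewrite ler_wpM2r// divr_ge0// ltW.
    by rewrite mulrC ltr_pM2r// ltr_pdivrMr// ltr_pMr// ltr1n.
  have s2 : V2 b'.
    apply: H2 => i iN; rewrite subr0 semiZr gtr0_norm ?divr_gt0//.
    rewrite mulrAC ltr_pdivrMr// mulrC.
    have : semi i b <= r2 by rewrite (le_trans (Hb i _))// (leq_trans iN)// leq_maxr.
    move=> H; apply: (@le_lt_trans _ _ (r2 * (e2 / 2))); first by rewrite ler_wpM2r// divr_ge0// ltW.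
    by rewrite mulrC ltr_pM2r// ltr_pdivrMr// ltr_pMr// ltr1n.
  have := HV (a', b') (conj s1 s2) => /=.
  have lr c x y : fmul x (c *: y) = c *: fmul x y :> A.
    by have := fmulZr c y 0 x; rewrite fmul0r !addr0.
  have ll c x y : fmul (c *: x) y = c *: fmul x y :> A.
    by have := fmulZl c x 0 y; rewrite fmul0l !addr0.
  rewrite /a' /b' lr ll !semiZr !gtr0_norm ?divr_gt0// => /ltW H.
  rewrite -(ler_pM2l (_ : 0 < e1 / 2 / r1)) ?divr_gt0//.
  rewrite -(ler_pM2l (_ : 0 < e2 / 2 / r2)) ?divr_gt0// (le_trans H)//.
  rewrite [leRHS](_ : _ = 1)//; field; rewrite !gt_eqF//.
(* [B1] and [B2] may vanish, which forbids rescaling by them; they are enlarged by a small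
   [t > 0]. *)
apply/ler_addgt0Pr => e e0.
pose q := 4 / (e1 * e2); have q0 : 0 < q by rewrite divr_gt0// mulr_gt0.
pose t := Num.min 1 (e / (q * (B1 + B2 + 1))).
have s0 : 0 < B1 + B2 + 1 by rewrite ltr_wpDl// addr_ge0.
have t0 : 0 < t by rewrite lt_min ltr01 divr_gt0// mulr_gt0.
have := key (B1 + t) (B2 + t); rewrite !ltr_wpDl// !lerDl (ltW t0) => /(_ isT isT isT isT).
move=> /le_trans; apply; rewrite -/q.
have t1 : t <= 1 by rewrite ge_min lexx.
have te : t * (q * (B1 + B2 + 1)) <= e.
  rewrite -ler_pdivlMr; last exact: mulr_gt0.
  by rewrite ge_min lexx orbT.
have : q * ((B1 + t) * (B2 + t)) <= q * (B1 * B2) + t * (q * (B1 + B2 + 1)).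
  rewrite [leRHS](_ : _ = q * (B1 * B2 + t * (B1 + B2 + 1))); last by ring.
  rewrite ler_pM2l//; have : t * t <= t by rewrite ler_piMl// ltW.
  by lra.
by move=> /le_trans; apply; rewrite lerD2l.
Qed.

Definition tensor f g : body2 -> A := fun Y => fmul (f (lsubmx Y)) (g (rsubmx Y)).

Lemma lsubmx_delta (h : R) (i : 'I_d) (Y : body2) :
  (lsubmx (Y + h *: delta_mx 0 (lshift d i)) = lsubmx Y + h *: delta_mx 0 i) *
  (rsubmx (Y + h *: delta_mx 0 (lshift d i)) = rsubmx Y).
Proof.
split; apply/rowP => k; rewrite !mxE.
  by rewrite (inj_eq (@lshift_inj _ _)).
by rewrite eq_rlshift andbF mulr0 addr0.
Qed.

Lemma rsubmx_delta (h : R) (i : 'I_d) (Y : body2) :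
  (rsubmx (Y + h *: delta_mx 0 (rshift d i)) = rsubmx Y + h *: delta_mx 0 i) *
  (lsubmx (Y + h *: delta_mx 0 (rshift d i)) = lsubmx Y).
Proof.
split; apply/rowP => k; rewrite !mxE.
  by rewrite (inj_eq (@rshift_inj _ _)).
by rewrite eq_lrshift andbF mulr0 addr0.
Qed.

Lemma fmulBZl (c : R[i]) (x y z : A) : fmul (c *: (x - y)) z = c *: (fmul x z - fmul y z).
Proof.
rewrite (_ : c *: (x - y) = c *: x + ((- c) *: y + 0)).
  by rewrite !fmulZl fmul0l addr0 scaleNr scalerBr.
by rewrite scaleNr addr0 scalerBr.
Qed.

Lemma fmulBZr (c : R[i]) (x y z : A) : fmul z (c *: (x - y)) = c *: (fmul z x - fmul z y).
Proof.
rewrite (_ : c *: (x - y) = c *: x + ((- c) *: y + 0)).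
  by rewrite !fmulZr fmul0r addr0 scaleNr scalerBr.
by rewrite scaleNr addr0 scalerBr.
Qed.

Lemma partial_cvg_tensorl f g i Y l : partial_cvg i f (lsubmx Y) l ->
  partial_cvg (lshift d i) (tensor f g) Y (fmul l (g (rsubmx Y))).
Proof.
move=> fl; rewrite /partial_cvg /tensor.
under eq_fun do rewrite !lsubmx_delta -fmulBZl.
apply: (@continuous2_cvg _ _ _ _ _ _ _ _ (fun x y : A => fmul x y)) => //.
- exact: (@fmul_continuous R A (_, _)).
- exact: cvg_cst.
Qed.

Lemma partial_cvg_tensorr f g i Y l : partial_cvg i g (rsubmx Y) l ->
  partial_cvg (rshift d i) (tensor f g) Y (fmul (f (lsubmx Y)) l).
Proof.
move=> gl; rewrite /partial_cvg /tensor.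
under eq_fun do rewrite !rsubmx_delta -fmulBZr.
apply: (@continuous2_cvg _ _ _ _ _ _ _ _ (fun x y : A => fmul x y)) => //.
- exact: (@fmul_continuous R A (_, _)).
- exact: cvg_cst.
Qed.

Lemma dominated_tensor (u1 u2 : body -> R) f g : (forall y, 0 <= u1 y) ->
  (forall y, 0 <= u2 y) -> dominated u1 f -> dominated u2 g ->
  dominated (fun Y => u1 (lsubmx Y) * u2 (rsubmx Y)) (tensor f g).
Proof.
move=> u10 u20 bf bg j; have [J [C C0 HC]] := fmul_bound j.
have /choice[b1 H1] : forall i, exists B, 0 <= B /\ forall y, semi i (f y) <= B * u1 y.
  by move=> i; have [B B0 HB] := dominatedP u10 bf i; exists B.
have /choice[b2 H2] : forall i, exists B, 0 <= B /\ forall y, semi i (g y) <= B * u2 y.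
  by move=> i; have [B B0 HB] := dominatedP u20 bg i; exists B.
have S (b : nat -> R) : (forall i, 0 <= b i) -> forall i, (i <= J)%N -> b i <= \sum_(k < J.+1) b k.
  move=> b0 i; rewrite -ltnS => iJ; rewrite (bigD1 (Ordinal iJ))//= lerDl.
  by apply: sumr_ge0.
have b10 i := (H1 i).1; have b20 i := (H2 i).1.
exists (C * ((\sum_(k < J.+1) b1 k) * (\sum_(k < J.+1) b2 k))) => Y.
rewrite (le_trans (HC _ _ ((\sum_(k < J.+1) b1 k) * u1 (lsubmx Y))
  ((\sum_(k < J.+1) b2 k) * u2 (rsubmx Y)) _ _ _ _))//.
- by rewrite mulr_ge0// sumr_ge0.
- by rewrite mulr_ge0// sumr_ge0.
- by move=> i iJ; rewrite (le_trans ((H1 i).2 _))// ler_wpM2r// S.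
- by move=> i iJ; rewrite (le_trans ((H2 i).2 _))// ler_wpM2r// S.
by rewrite mulrACA !mulrA.
Qed.

Lemma partial_tensorl f g i : smooth f ->
  partial (lshift d i) (tensor f g) = tensor (partial i f) g.
Proof.
move=> sf; apply/funext => Y; apply: partialE; apply: partial_cvg_tensorl.
exact: smooth_partial_cvg0.
Qed.

Lemma partial_tensorr f g i : smooth g ->
  partial (rshift d i) (tensor f g) = tensor f (partial i g).
Proof.
move=> sg; apply/funext => Y; apply: partialE; apply: partial_cvg_tensorr.
exact: smooth_partial_cvg0.
Qed.

Lemma moderate_tensor (u1 u2 : body -> R) : moderate u1 -> moderate u2 ->
  moderate (fun Y : body2 => u1 (lsubmx Y) * u2 (rsubmx Y)).
Proof.
move=> [u10 [m1 um1]] [u20 [m2 um2]]; split=> [Y|]; first exact: mulr_gt0.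
have rl (h : body2) : rho (lsubmx h) <= rho h /\ rho (rsubmx h) <= rho h.
  rewrite -{2 4}[h]hsubmxK rho_row_mx.
  by rewrite ler_peMr ?rho_ge1 ?(ltW (rho_gt0 _))// ler_peMl ?rho_ge1 ?(ltW (rho_gt0 _)).
exists (m1 + m2)%N => Y h; rewrite exprD mulrACA !linearD /=.
apply: ler_pM; rewrite ?(ltW (u10 _)) ?(ltW (u20 _))//.
  rewrite (le_trans (um1 _ _))// ler_wpM2l ?(ltW (u10 _))//.
  by rewrite lerXn2r ?nnegrE ?(ltW (rho_gt0 _))//; exact: (rl h).1.
rewrite (le_trans (um2 _ _))// ler_wpM2l ?(ltW (u20 _))//.
by rewrite lerXn2r ?nnegrE ?(ltW (rho_gt0 _))//; exact: (rl h).2.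
Qed.

Lemma symb_tensor (u1 u2 : body -> R) f g : moderate u1 -> moderate u2 ->
  symb u1 f -> symb u2 g ->
  symb (fun Y => u1 (lsubmx Y) * u2 (rsubmx Y)) (tensor f g).
Proof.
move=> m1 m2 sf sg.
apply: (@symb_coind _ _ _ _ (fun F => exists f g, [/\ symb u1 f, symb u2 g & F = tensor f g])).
- exact: moderate_tensor.
- move=> _ [f1 [g1 [s1 s2 ->]]]; apply: dominated_tensor.
  + by move=> y; rewrite ltW//; exact: m1.1.
  + by move=> y; rewrite ltW//; exact: m2.1.
  + exact: symb_dominated.
  + exact: symb_dominated.
- move=> _ i [f1 [g1 [s1 s2 ->]]]; case: (split_ordP i) => k ->.
    exists (tensor (partial k f1) g1).
      by exists (partial k f1), g1; split=> //; exact: symb_partial.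
    by move=> Y; apply: partial_cvg_tensorl; exact: symb_cvg s1.
  exists (tensor f1 (partial k g1)).
    by exists f1, (partial k g1); split=> //; exact: symb_partial.
  by move=> Y; apply: partial_cvg_tensorr; exact: symb_cvg s2.
- by exists f, g.
Qed.

Lemma rho_hsub (Y : body2) : rho Y = rho (lsubmx Y) * rho (rsubmx Y).
Proof. by rewrite -[in LHS](hsubmxK Y) rho_row_mx. Qed.

Lemma tempered_tensor M f g : symb (fun y => rho y ^+ M) f ->
  symb (fun y => rho y ^+ M) g -> tempered M (tensor f g).
Proof.
move=> sf sg; have m := moderateX M (@moderate_rho R d).
apply: (symb_le (C := 1) _ _ (symb_tensor m m sf sg)) => Y.
  by rewrite mul1r rho_hsub exprMn.
by rewrite mulr_ge0// exprn_ge0// ltW// rho_gt0.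
Qed.

(** Each coordinate of the pair belongs to one factor, so a derivative of the tensor product is a
    single tensor product, and the constant [C] does not depend on [K]. *)
Lemma derivs_le_tensor j : exists J, exists2 C, 0 <= C &
  forall K (u1 u2 : body -> R) f g B1 B2,
  (forall y, 0 <= u1 y) -> (forall y, 0 <= u2 y) -> smooth f -> smooth g ->
  0 <= B1 -> 0 <= B2 ->
  (forall i, (i <= J)%N -> derivs_le i K u1 B1 f) ->
  (forall i, (i <= J)%N -> derivs_le i K u2 B2 g) ->
  derivs_le j K (fun Y => u1 (lsubmx Y) * u2 (rsubmx Y)) (C * (B1 * B2)) (tensor f g).
Proof.
have [J [C C0 HC]] := fmul_bound j; exists J, C => // K u1 u2 f g B1 B2 u10 u20.
move=> + + B10 B20; elim: K f g => [|K IH] f g sf sg Hf Hg.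
  split=> // Y; rewrite (le_trans (HC _ _ (B1 * u1 (lsubmx Y)) (B2 * u2 (rsubmx Y)) _ _ _ _))//.
  - exact: mulr_ge0.
  - exact: mulr_ge0.
  - by move=> i /Hf H; exact: derivs_le0 H.
  - by move=> i /Hg H; exact: derivs_le0 H.
  - by rewrite mulrACA !mulrA.
split=> [Y|i].
  rewrite (le_trans (HC _ _ (B1 * u1 (lsubmx Y)) (B2 * u2 (rsubmx Y)) _ _ _ _))//.
  - exact: mulr_ge0.
  - exact: mulr_ge0.
  - by move=> i /Hf H; exact: derivs_le0 H.
  - by move=> i /Hg H; exact: derivs_le0 H.
  - by rewrite mulrACA !mulrA.
case: (split_ordP i) => k ->.
  rewrite partial_tensorl//; apply: IH => //; first exact: smooth_partial.
    by move=> p /Hf[_]; exact.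
  by move=> p /Hg; exact: derivs_le_weaken.
rewrite partial_tensorr//; apply: IH => //; first exact: smooth_partial.
  by move=> p /Hf; exact: derivs_le_weaken.
by move=> p /Hg[_]; exact.
Qed.

Lemma tensor_linearl c f1 f2 g : tensor (c *: f1 + f2) g = c *: tensor f1 g + tensor f2 g.
Proof. by apply/funext => Y; rewrite /tensor !fctE fmulZl. Qed.

Lemma tensor_linearr c f g1 g2 : tensor f (c *: g1 + g2) = c *: tensor f g1 + tensor f g2.
Proof. by apply/funext => Y; rewrite /tensor !fctE fmulZr. Qed.

Lemma translate_tensor (y1 y2 : body) f g :
  translate (row_mx y1 y2) (tensor f g) = tensor (translate y1 f) (translate y2 g).
Proof.
by apply/funext => Y; rewrite /translate /tensor !linearD /= row_mxKl row_mxKr.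
Qed.

End Tensor.

(** * Translates of a function under a linear functional *)

Section TemperedFunctional.
Context {R : realType} {A : frechetAlgType R} {d : nat}.
Local Notation D := (d + d)%N.
Local Notation body := 'rV[R]_d.
Local Notation body2 := 'rV[R]_D.
Implicit Types (f g : body -> A) (F G : body2 -> A) (B C : R).

Variable L : (body2 -> A) -> A.
Hypothesis L_linear : forall M b F G, tempered M F -> tempered M G ->
  L (b *: F + G) = b *: L F + L G.
Hypothesis L_bound : forall j M, exists K, exists2 C, 0 <= C &
  forall F B, tempered M F -> 0 <= B ->
  derivs_le j K (fun y => rho y ^+ M) B F -> semi j (L F) <= C * B.

Lemma tempered_translate M F Y : tempered M F -> tempered M (translate Y F).
Proof. by move=> tF; apply: symb_translate => //; exact/moderateX/moderate_rho. Qed.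

Lemma tempered_linear M b F G : tempered M F -> tempered M G -> tempered M (b *: F + G).
Proof. by apply: symb_linear => y; exact: rhoX_ge0. Qed.

Lemma derivs_le_translate e j K (u v : 'rV[R]_e -> R) B C (f : 'rV[R]_e -> A) Y : smooth f ->
  0 <= B -> (forall y, u (y + Y) <= C * v y) ->
  derivs_le j K u B f -> derivs_le j K v (B * C) (translate Y f).
Proof.
move=> sf B0 uv /derivs_leP H; apply/derivs_leP => s sK y.
by rewrite foldr_partial_translate// (le_trans (H s sK _))// -mulrA ler_wpM2l.
Qed.

Lemma rhoX_translate M (y Y : body2) : rho (y + Y) ^+ M <= rho Y ^+ M * rho y ^+ M.
Proof. by rewrite -exprMn lerXn2r ?nnegrE ?mulr_ge0 ?(ltW (rho_gt0 _))// mulrC rhoD. Qed.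

Lemma dominated_translates M F : tempered M F ->
  dominated (fun Y => rho Y ^+ M) (fun Y => L (translate Y F)).
Proof.
move=> tF j; have [K [C C0 HC]] := L_bound j M.
have [B B0 HB] := symb_derivs_le j K (@rhoX_ge0 _ _ M) tF.
exists (C * B) => Y; rewrite -mulrA; apply: HC.
- exact: tempered_translate.
- by rewrite mulr_ge0// rhoX_ge0.
by apply: derivs_le_translate HB => //; [exact: symb_smooth tF|move=> y; exact: rhoX_translate].
Qed.

Lemma foldr_partial_swap F i s : smooth F ->
  foldr partial (partial i F) s = partial i (foldr partial F s).
Proof.
move=> sF; rewrite -[partial i F]/(foldr partial F [:: i]) -foldr_cat.
by rewrite (foldr_partial_perm sF (t := i :: s))// cats1 perm_rcons.
Qed.

(* Taylor's formula for [Y |-> L (translate Y F)]: the bound on the second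
   order remainder of [F] passes through [L]. *)
Lemma partial_cvg_translates M F i Y : tempered M F ->
  partial_cvg i (fun Y => L (translate Y F)) Y (L (translate Y (partial i F))).
Proof.
move=> tF; apply/partial_cvgP => j e e0.
have [K [C C0 HC]] := L_bound j M.
have [B B0 /derivs_leP HB] := symb_derivs_le j K.+2 (@rhoX_ge0 _ _ M) tF.
have sF := symb_smooth tF.
pose Q := C * (B * (rho Y ^+ M * 2 ^+ M)).
have Q0 : 0 <= Q by rewrite !mulr_ge0// ?rhoX_ge0// exprn_ge0.
have Q1 : 0 < Q + 1 by rewrite ltr_wpDl.
exists (Num.min 1 (e / (Q + 1))); first by rewrite lt_min ltr01 divr_gt0.
move=> h; rewrite lt_min => /andP[h1 he].
set ei := delta_mx 0 i : body2.
pose G := (- h%:C) *: translate Y (partial i F) +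
  ((-1) *: translate Y F + translate (Y + h *: ei) F).
have tdF : tempered M (partial i F) by exact: symb_partial.
have tG : tempered M G.
  apply: tempered_linear; first exact: tempered_translate.
  by apply: tempered_linear; exact: tempered_translate.
have -> : L (translate (Y + h *: ei) F) - L (translate Y F) -
    h%:C *: L (translate Y (partial i F)) = L G.
  have t1 := tempered_translate Y tF; have t2 := tempered_translate (Y + h *: ei) tF.
  rewrite (L_linear _ (tempered_translate Y tdF) (tempered_linear (-1) t1 t2)).
  by rewrite (L_linear _ t1 t2) scaleN1r scaleNr; zmod.
have rho2 t : `|t| <= `|h| -> rho (t *: ei) <= 2.
  move=> th; rewrite /rho (bigD1 i)//= big1 => [|k ki].
    by rewrite !mxE !eqxx !mulr1 -[2]/(1 + 1) lerD2l (le_trans th)// ltW.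
  by rewrite !mxE eqxx (negPf ki) mulr0 normr0 addr0.
have HG : derivs_le j K (fun y => rho y ^+ M) (B * (rho Y ^+ M * 2 ^+ M) * (`|h| * `|h|)) G.
  apply/derivs_leP => s sK Z.
  have sT a H : smooth H -> smooth (translate a H : body2 -> A) by exact: smooth_translate.
  have sd := smooth_partial i sF.
  rewrite /G foldr_partial_linear//; [|exact: sT|apply: smooth_linear; exact: sT].
  rewrite foldr_partial_linear//; [|exact: sT|exact: sT].
  rewrite !foldr_partial_translate// foldr_partial_swap//.
  set P := foldr partial F s; rewrite !fctE /translate scaleN1r scaleNr.
  have sP : smooth P by exact: smooth_foldr.
  set X := (X in semi j X <= _).
  have -> : X = P (Z + (Y + h *: ei)) - P (Z + Y) - h%:C *: partial i P (Z + Y).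
    by rewrite /X; zmod.
  rewrite (addrA Z Y).
  rewrite (le_trans (@partial_mean_value _ _ _ j i P (partial i P) (Z + Y) h
    (partial i P (Z + Y)) (B * (rho Y ^+ M * 2 ^+ M) * rho Z ^+ M * `|h|) _ _))//.
  - by move=> t _; exact: smooth_partial_cvg0.
  - move=> t th; have := @partial_mean_value _ _ _ j i (partial i P) (partial i (partial i P))
      (Z + Y) t 0 (B * (rho Y ^+ M * 2 ^+ M) * rho Z ^+ M).
    rewrite scaler0 subr0 => H; rewrite (le_trans (H _ _))//.
    + by move=> t' _; apply: smooth_partial_cvg0; exact: smooth_partial.
    + move=> t' t't; rewrite subr0.
      have sK2 : (size [:: i, i & s] <= K.+2)%N by rewrite /= !ltnS.
      rewrite (le_trans (HB _ sK2 _))//.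
      rewrite -!mulrA ler_wpM2l//.
      rewrite (@le_trans _ _ ((rho Y * (2 * rho Z)) ^+ M))//; last by rewrite !exprMn.
      rewrite lerXn2r ?nnegrE ?mulr_ge0 ?(ltW (rho_gt0 _))//.
      rewrite (le_trans (rhoD _ _))// (le_trans (ler_wpM2r _ (rhoD _ _))) ?(ltW (rho_gt0 _))//.
      rewrite [leRHS](_ : _ = rho Z * rho Y * 2); last by ring.
      by rewrite ler_wpM2l ?mulr_ge0 ?(ltW (rho_gt0 _))// rho2// (le_trans t't).
    + by rewrite ler_wpM2l// !mulr_ge0// ?rhoX_ge0// exprn_ge0.
  - by rewrite le_eqVlt; apply/orP; left; apply/eqP; ring.
rewrite (le_trans (HC G _ tG _ HG))//.
  by rewrite !mulr_ge0// ?rhoX_ge0// exprn_ge0.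
rewrite mulrA -/Q mulrA ler_wpM2r//.
rewrite (@le_trans _ _ ((Q + 1) * `|h|))//; first by rewrite ler_wpM2r// lerDl.
by rewrite -ler_pdivlMl// mulrC ltW.
Qed.

Lemma symb_translates M F : tempered M F ->
  tempered M (fun Y => L (translate Y F)).
Proof.
move=> tF; apply: (@symb_coind _ _ _ _ (fun V => exists2 F, tempered M F &
  V = fun Y => L (translate Y F))).
- exact/moderateX/moderate_rho.
- by move=> _ [G tG ->]; exact: dominated_translates.
- move=> _ i [G tG ->]; exists (fun Y => L (translate Y (partial i G))).
    by exists (partial i G) => //; exact: symb_partial.
  by move=> Y; apply: partial_cvg_translates tG.
- by exists F.
Qed.

Lemma row_mx_diag_delta (y : body) (h : R) i :
  row_mx (y + h *: delta_mx 0 i) (y + h *: delta_mx 0 i) =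
  row_mx y y + h *: delta_mx 0 (rshift d i) + h *: delta_mx 0 (lshift d i) :> body2.
Proof.
rewrite -[RHS]hsubmxK (lsubmx_delta h i _).1 (lsubmx_delta h i _).2.
by rewrite (rsubmx_delta h i _).1 (rsubmx_delta h i _).2 row_mxKl row_mxKr.
Qed.

(** The diagonal move is split: a step along [r] from [Y], then one along [l] from the displaced
    point [Z], where the continuity of [partial l V] brings the derivative back to [Y]. *)
Lemma partial_cvg_diagonal (V : body2 -> A) i (y : body) : smooth V ->
  partial_cvg i (fun y => V (row_mx y y)) y
    (partial (lshift d i) V (row_mx y y) + partial (rshift d i) V (row_mx y y)).
Proof.
move=> sV; apply/partial_cvgP => j e e0; have e2 : 0 < e / 2 by rewrite divr_gt0.
set Y := row_mx y y : body2; set l := lshift d i; set r := rshift d i.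
have /continuous_semiP/(_ j _ e2)[d1 d10 H1] : {for Y, continuous (partial l V)}.
  by apply: smooth_continuous; exact: smooth_partial.
have /partial_cvgP/(_ j _ e2)[d2 d20 H2] := smooth_partial_cvg0 (i := r) (y := Y) sV.
exists (Num.min (d1 / 4) d2); first by rewrite lt_min divr_gt0.
move=> h; rewrite lt_min => /andP[hd1 hd2].
rewrite row_mx_diag_delta -/Y -/l -/r; set Z := Y + h *: delta_mx 0 r.
have nE t k : `|t *: delta_mx 0 k : body2| <= `|t|.
  rewrite [leLHS]/Num.norm/= mx_normrE; apply/bigmax_leP => /=; split=> // -[a p] _ /=.
  by rewrite !mxE; case: (_ && _); rewrite ?mulr1 ?mulr0 ?normr0.
have H3 : semi j (V (Z + h *: delta_mx 0 l) - V Z - h%:C *: partial l V Y) <= e / 2 * `|h|.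
  apply: (@partial_mean_value _ _ _ j l V (partial l V)).
    by move=> t _; exact: smooth_partial_cvg0.
  move=> t th; rewrite /Z -addrA; apply/ltW/H1/(le_lt_trans (ler_normD _ _)).
  by have := lerD (nE h r) (nE t l); move: hd1 th d10; lra.
have {}H2 := H2 h hd2.
move: H3 H2; move: (V _) (V Z) (V Y) (partial l V Y) (partial r V Y) => a b c' p q H3 H2.
have -> : a - c' - h%:C *: (p + q) = (a - b - h%:C *: p) + (b - c' - h%:C *: q).
  by rewrite scalerDr; zmod.
apply: (le_trans (semiD _ _ _)); rewrite [in leRHS](splitr e) mulrDl.
exact: lerD H3 H2.
Qed.

(** With [L] the oscillating integral, this is the star product without odd variables, up to a
    scalar. *)
Definition twisted f g : body -> A := fun y => L (translate (row_mx y y) (tensor f g)).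

Local Notation rhoX M := (fun y : body => rho y ^+ M).

Lemma partial_cvg_twisted M f g i y : symb (rhoX M) f -> symb (rhoX M) g ->
  partial_cvg i (twisted f g) y (twisted (partial i f) g y + twisted f (partial i g) y).
Proof.
move=> sf sg; have t := tempered_tensor sf sg.
pose V (Y : body2) := L (translate Y (tensor f g)).
have sV : smooth V by apply: symb_smooth (symb_translates t).
have dV k : partial k V = fun Y => L (translate Y (partial k (tensor f g))).
  by apply/funext => Y; apply: partialE; exact: partial_cvg_translates t.
have := partial_cvg_diagonal (i := i) (y := y) sV.
rewrite !dV partial_tensorl ?partial_tensorr//; [exact: symb_smooth sg|exact: symb_smooth sf].
Qed.

(** A crude bound, [rho (row_mx y y)] being [rho y ^+ 2]. It is there for the smoothness of the
    product; the precise weight comes from [twisted_bound]. *)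
Lemma symb_twisted M f g : symb (rhoX M) f -> symb (rhoX M) g ->
  symb (rhoX (M + M)) (twisted f g).
Proof.
move=> sf sg.
pose P h := exists2 F, tempered M F & h = fun y : body => L (translate (row_mx y y) F).
apply: (@symb_coind _ _ _ _ P).
- exact/moderateX/moderate_rho.
- move=> _ [F tF ->] j; have [C HC] := dominated_translates tF j.
  by exists C => y; rewrite exprD -exprMn -rho_row_mx.
- move=> _ i [F tF ->].
  pose V (Y : body2) := L (translate Y F).
  have sV : smooth V by apply: symb_smooth (symb_translates tF).
  have dV k : partial k V = fun Y => L (translate Y (partial k F)).
    by apply/funext => Y; apply: partialE; exact: partial_cvg_translates tF.
  exists (fun y => L (translate (row_mx y y) (1 *: partial (lshift d i) F + partial (rshift d i) F))).
    exists (1 *: partial (lshift d i) F + partial (rshift d i) F) => //.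
    by apply: tempered_linear; exact: symb_partial.
  move=> y; have := partial_cvg_diagonal (i := i) (y := y) sV; rewrite !dV.
  have tl := tempered_translate (row_mx y y) (symb_partial (lshift d i) tF).
  have tr := tempered_translate (row_mx y y) (symb_partial (rshift d i) tF).
  suff -> : L (translate (row_mx y y) (1 *: partial (lshift d i) F + partial (rshift d i) F)) =
    L (translate (row_mx y y) (partial (lshift d i) F)) +
    L (translate (row_mx y y) (partial (rshift d i) F)) by [].
  by rewrite -[X in _ = X + _]scale1r; exact: (L_linear 1 tl tr).
- by exists (tensor f g) => //; exact: tempered_tensor.
Qed.

Lemma partial_twisted M f g i : symb (rhoX M) f -> symb (rhoX M) g ->
  partial i (twisted f g) = 1 *: twisted (partial i f) g + twisted f (partial i g).
Proof.
move=> sf sg; apply/funext => y; rewrite scale1r; apply: partialE.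
exact: partial_cvg_twisted sf sg.
Qed.

Lemma twisted_linearl M c f1 f2 g : symb (rhoX M) f1 -> symb (rhoX M) f2 ->
  symb (rhoX M) g -> twisted (c *: f1 + f2) g = c *: twisted f1 g + twisted f2 g.
Proof.
move=> s1 s2 sg; apply/funext => y; rewrite /twisted tensor_linearl.
have t1 := tempered_translate (row_mx y y) (tempered_tensor s1 sg).
have t2 := tempered_translate (row_mx y y) (tempered_tensor s2 sg).
exact: (L_linear c t1 t2).
Qed.

Lemma twisted_linearr M c f g1 g2 : symb (rhoX M) f -> symb (rhoX M) g1 ->
  symb (rhoX M) g2 -> twisted f (c *: g1 + g2) = c *: twisted f g1 + twisted f g2.
Proof.
move=> sf s1 s2; apply/funext => y; rewrite /twisted tensor_linearr.
have t1 := tempered_translate (row_mx y y) (tempered_tensor sf s1).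
have t2 := tempered_translate (row_mx y y) (tempered_tensor sf s2).
exact: (L_linear c t1 t2).
Qed.

(* The weights [u1], [u2] of the factors only enter through their growth under
   translations, [v1] and [v2]. *)
Lemma twisted_bound j K0 M : exists J K, exists2 C, 0 <= C &
  forall (u1 v1 u2 v2 : body -> R) f g B1 B2,
  (forall y, 0 <= v1 y) -> (forall y, 0 <= v2 y) ->
  (forall y y', u1 (y' + y) <= v1 y * rho y' ^+ M) ->
  (forall y y', u2 (y' + y) <= v2 y * rho y' ^+ M) ->
  symb (rhoX M) f -> symb (rhoX M) g -> 0 <= B1 -> 0 <= B2 ->
  (forall i, (i <= J)%N -> derivs_le i K u1 B1 f) ->
  (forall i, (i <= J)%N -> derivs_le i K u2 B2 g) ->
  derivs_le j K0 (fun y => v1 y * v2 y) (C * (B1 * B2)) (twisted f g).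
Proof.
have [KL [CL CL0 HL]] := L_bound j M; have [J [CT CT0 HT]] := derivs_le_tensor (A := A) (d := d) j.
(* The bound on the values: translating the factors by [y] replaces the weights [u1], [u2] by
   [v1 y], [v2 y] times [rho ^+ M], and [L] is applied with [y] fixed. *)
have base (u1 v1 u2 v2 : body -> R) f g B1 B2 :
    (forall y, 0 <= v1 y) -> (forall y, 0 <= v2 y) ->
    (forall y y', u1 (y' + y) <= v1 y * rho y' ^+ M) ->
    (forall y y', u2 (y' + y) <= v2 y * rho y' ^+ M) ->
    symb (rhoX M) f -> symb (rhoX M) g -> 0 <= B1 -> 0 <= B2 ->
    (forall i, (i <= J)%N -> derivs_le i KL u1 B1 f) ->
    (forall i, (i <= J)%N -> derivs_le i KL u2 B2 g) ->
    forall y, semi j (twisted f g y) <= CL * CT * (B1 * B2) * (v1 y * v2 y).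
  move=> v10 v20 uv1 uv2 sf sg B10 B20 Hf Hg y.
  have -> : CL * CT * (B1 * B2) * (v1 y * v2 y) = CL * (CT * (B1 * v1 y * (B2 * v2 y))) by ring.
  apply: HL.
  - exact/tempered_translate/tempered_tensor.
  - by rewrite !mulr_ge0.
  rewrite translate_tensor.
  have r0 z : 0 <= rhoX M z by rewrite exprn_ge0// ltW// rho_gt0.
  have s1 := smooth_translate y (symb_smooth sf); have s2 := smooth_translate y (symb_smooth sg).
  have := HT KL (rhoX M) (rhoX M) (translate y f) (translate y g) (B1 * v1 y) (B2 * v2 y) r0 r0 s1 s2.
  rewrite !mulr_ge0// => /(_ isT isT) H; apply: derivs_le_weaken (H _ _) => //.
  - by move=> Y; rewrite -exprMn -rho_hsub.
  - by move=> i /Hf; apply: derivs_le_translate => //; exact: symb_smooth sf.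
  - by move=> i /Hg; apply: derivs_le_translate => //; exact: symb_smooth sg.
exists J; elim: K0 => [|K0 [K [C C0 IH]]].
  exists KL, (CL * CT); first exact: mulr_ge0.
  move=> u1 v1 u2 v2 f g B1 B2 v10 v20 uv1 uv2 sf sg B10 B20 Hf Hg; split=> // y.
  exact: base Hf Hg y.
(* [KL] derivatives for the values, [K.+1] because Leibniz' rule spends one before the induction
   hypothesis applies; its two terms give [2 * C]. *)
exists (maxn KL K.+1), (CL * CT + 2 * C); first by rewrite addr_ge0 ?mulr_ge0.
move=> u1 v1 u2 v2 f g B1 B2 v10 v20 uv1 uv2 sf sg B10 B20 Hf Hg.
have BB0 : 0 <= B1 * B2 by exact: mulr_ge0.
have vv0 y : 0 <= v1 y * v2 y by exact: mulr_ge0.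
have wk i K' u B f' : (K' <= maxn KL K.+1)%N -> derivs_le i (maxn KL K.+1) u B f' ->
    derivs_le i K' u B f' :> Prop by move=> KK; exact: derivs_le_weaken.
split=> [y|i].
  rewrite (@le_trans _ _ (CL * CT * (B1 * B2) * (v1 y * v2 y)))//.
    apply: base => // i iJ; apply: wk; rewrite ?leq_maxl//; [exact: Hf|exact: Hg].
  by rewrite ler_wpM2r// ler_wpM2r// lerDl mulr_ge0.
rewrite (partial_twisted i sf sg).
have Hf1 k : (k <= J)%N -> derivs_le k K.+1 u1 B1 f by move=> kJ; apply: wk; rewrite ?leq_maxr//; exact: Hf.
have Hg1 k : (k <= J)%N -> derivs_le k K.+1 u2 B2 g by move=> kJ; apply: wk; rewrite ?leq_maxr//; exact: Hg.
have Hf0 k : (k <= J)%N -> derivs_le k K u1 B1 f by move=> /Hf1; exact: derivs_le_weaken.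
have Hg0 k : (k <= J)%N -> derivs_le k K u2 B2 g by move=> /Hg1; exact: derivs_le_weaken.
have sdf := symb_partial i sf; have sdg := symb_partial i sg.
have I1 := IH u1 v1 u2 v2 (partial i f) g B1 B2 v10 v20 uv1 uv2 sdf sg B10 B20
  (fun k kJ => (Hf1 k kJ).2 i) Hg0.
have I2 := IH u1 v1 u2 v2 f (partial i g) B1 B2 v10 v20 uv1 uv2 sf sdg B10 B20
  Hf0 (fun k kJ => (Hg1 k kJ).2 i).
have := derivs_le_linear 1 (symb_smooth (symb_twisted sdf sg)) (symb_smooth (symb_twisted sf sdg)) I1 I2.
rewrite cmod1 mul1r; apply: derivs_le_weaken => // y; rewrite ler_wpM2r//.
have -> : C * (B1 * B2) + C * (B1 * B2) = 2 * C * (B1 * B2) by ring.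
by rewrite ler_wpM2r// lerDr mulr_ge0.
Qed.

End TemperedFunctional.

(** * Grassmann algebra *)

HB.instance Definition _ (N : nat) (V : zmodType) :=
  GRing.Zmodule.copy (grassmann N V) ({set 'I_N} -> V).

Section GrassmannRing.
Context {N : nat} {C : fieldType}.
Implicit Types (I J K : {set 'I_N}) (a b : grassmann N C).
Local Open Scope set_scope.
Local Notation disj I J := (disjoint (mem I) (mem J)).
Local Notation set0 := finset.set0.

Lemma gaddE a b K : (a + b) K = a K + b K. Proof. by []. Qed.

Definition gsign I J : C := (-1) ^+ inversions I J.

Lemma mulrz_sign (V : lmodType C) (x : V) n : x *~ ((-1) ^+ n) = ((-1) ^+ n : C) *: x.
Proof. by rewrite -scaler_int rmorphXn rmorphN1. Qed.

Lemma gmulE a b K : gmul *%R a b K =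
  \sum_(I : {set 'I_N} | I \subset K) gsign I (K :\: I) * (a I * b (K :\: I)).
Proof. by apply: eq_bigr => I _; rewrite (@mulrz_sign C^o). Qed.

Lemma inversionsUl I J K : disj (I) (J) ->
  inversions (I :|: J) K = (inversions I K + inversions J K)%N.
Proof.
move=> dIJ; rewrite /inversions -cardUI [X in (_ + X)%N]eq_card0 ?addn0.
  by apply: eq_card => p; rewrite !inE; case: (_ \in I); case: (_ \in J); rewrite /= ?orbF ?orbT ?orbb ?andbF.
move=> p; rewrite !inE; have [pI|] := boolP (p.1 \in I); last by rewrite andFb.
by rewrite (disjointFr dIJ pI) /= andbF.
Qed.

Lemma inversionsUr I J K : disj (J) (K) ->
  inversions I (J :|: K) = (inversions I J + inversions I K)%N.
Proof.
move=> dJK; rewrite /inversions -cardUI [X in (_ + X)%N]eq_card0 ?addn0.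
  by apply: eq_card => p; rewrite !inE; case: (_ \in I); case: (_ \in J); case: (_ \in K); case: (_ < _)%N.
move=> p; rewrite !inE; have [pJ|] := boolP (p.2 \in J); last by rewrite /= andbF.
by rewrite (disjointFr dJK pJ) /= !andbF.
Qed.

Lemma inversions0l K : inversions set0 K = 0%N.
Proof. by apply: eq_card0 => p; rewrite !inE. Qed.

Lemma inversions0r K : inversions K set0 = 0%N.
Proof. by apply: eq_card0 => p; rewrite !inE andbF. Qed.

(** Both sides are sums over the decompositions of [K] into three disjoint sets, and the additivity
    of [inversions] makes either sign the product of the three pairwise ones. *)
Lemma gmulA : associative (@gmul N C C C *%R).
Proof.
move=> a b c; apply/funext => K; rewrite !gmulE.
under eq_bigr => I _ do rewrite gmulE mulr_sumr mulr_sumr.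
under [RHS]eq_bigr => U _ do rewrite gmulE mulr_suml mulr_sumr.
rewrite [RHS](exchange_big_dep (fun I : {set 'I_N} => I \subset K)) /=; last first.
  by move=> U I UK IU; exact: fintype.subset_trans IU UK.
apply: eq_bigr => I IK.
(* On the right, [U] is the union of the first two parts; with the first part [I] fixed, the second
   is [J], that is [U] without [I]. *)
rewrite [RHS](reindex_onto (fun J => I :|: J) (fun U => U :\: I)) /=; last first.
  move=> U /andP[_ /fintype.subsetP IU]; apply/finset.setP => x; rewrite !inE; have := IU x.
  by case: (x \in I) => //= ->.
apply: eq_big => [J|J JKI].
  rewrite finset.subsetUl andbT finset.subUset IK /= finset.setDUl finset.setDv finset.set0U.
  rewrite finset.subsetD disjoint_sym; case: (J \subset K) => //=.
  apply/idP/idP => [dIJ|/eqP <-]; first by apply/eqP/finset.setDidPl; rewrite disjoint_sym.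
  by rewrite -finset.setI_eq0 finset.setIDA finset.setIC -finset.setIDA finset.setDv finset.setI0.
have dIJ : disj (I) (J).
  by move: JKI; rewrite finset.subsetD disjoint_sym => /andP[].
have JK : J \subset K by move: JKI; rewrite finset.subsetD => /andP[].
have IJI : (I :|: J) :\: I = J.
  by rewrite finset.setDUl finset.setDv finset.set0U; apply/finset.setDidPl; rewrite disjoint_sym.
rewrite IJI -finset.setDDl /gsign.
have dJM : disj (J) (K :\: I :\: J).
  by rewrite -finset.setI_eq0 finset.setIDA finset.setIC -finset.setIDA finset.setDv finset.setI0.
have E1 : K :\: I = J :|: (K :\: I :\: J).
  by rewrite -{1}(finset.setID (K :\: I) J) (finset.setIidPr JKI).
rewrite {1}E1 (inversionsUr _ dJM) (inversionsUl _ dIJ) !exprD.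
set e1 := _ ^+ inversions I J; set e2 := _ ^+ inversions I _; set e3 := _ ^+ inversions J _.
by ring.
Qed.

Lemma gmul1l : left_id (gone C) (@gmul N C C C *%R).
Proof.
move=> a; apply/funext => K; rewrite gmulE (bigD1 set0) ?finset.sub0set//= big1 => [|I].
  by rewrite finset.setD0 /gsign inversions0l /gone eqxx !mul1r addr0.
by move=> /andP[_ /negPf I0]; rewrite /gone I0 mul0r mulr0.
Qed.

Lemma gmul1r : right_id (gone C) (@gmul N C C C *%R).
Proof.
move=> a; apply/funext => K; rewrite gmulE (bigD1 K)//= big1 => [|I].
  by rewrite finset.setDv /gsign inversions0r /gone eqxx mul1r mulr1 addr0.
move=> /andP[IK NIK]; rewrite /gone finset.setD_eq0 (_ : K \subset I = false) ?mulr0//.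
by apply/negP => KI; move/negP: NIK; apply; rewrite finset.eqEsubset IK.
Qed.

Lemma gmulDl : left_distributive (@gmul N C C C *%R) +%R.
Proof.
move=> a b c; apply/funext => K; rewrite [RHS]gaddE !gmulE -big_split /=.
by apply: eq_bigr => I _; rewrite gaddE mulrDl mulrDr.
Qed.

Lemma gmulDr : right_distributive (@gmul N C C C *%R) +%R.
Proof.
move=> a b c; apply/funext => K; rewrite [RHS]gaddE !gmulE -big_split /=.
by apply: eq_bigr => I _; rewrite gaddE !mulrDr.
Qed.

Lemma gone_neq0 : gone C != 0 :> grassmann N C.
Proof.
apply/eqP => /(congr1 (fun a : grassmann N C => a set0)); rewrite /gone eqxx.
by move=> /eqP; rewrite oner_eq0.
Qed.

HB.instance Definition _ := GRing.Zmodule_isNzRing.Build (grassmann N C)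
  gmulA gmul1l gmul1r gmulDl gmulDr gone_neq0.

Definition gscale (c : C) a : grassmann N C := fun K => c * a K.

Lemma gmul_ringE a b : a * b = gmul *%R a b. Proof. by []. Qed.

Lemma gscaleAl c a b : gscale c (a * b) = gscale c a * b.
Proof.
apply/funext => K; rewrite /gscale !gmul_ringE !gmulE mulr_sumr.
by apply: eq_bigr => I _; ring.
Qed.

Lemma gscaleAr c a b : gscale c (a * b) = a * gscale c b.
Proof.
apply/funext => K; rewrite /gscale !gmul_ringE !gmulE mulr_sumr.
by apply: eq_bigr => I _; ring.
Qed.

Lemma gscale_gscale c e a : gscale c (gscale e a) = gscale (c * e) a.
Proof. by apply/funext => K; rewrite /gscale mulrA. Qed.

Lemma gscale1 a : gscale 1 a = a.
Proof. by apply/funext => K; rewrite /gscale mul1r. Qed.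

Lemma gscale0 a : gscale 0 a = 0.
Proof. by apply/funext => K; rewrite /gscale mul0r. Qed.

Lemma gscaleN1 a : gscale (- 1) a = - a.
Proof. by apply/funext => K; rewrite /gscale mulN1r. Qed.

Lemma gscaler0 c : gscale c 0 = 0.
Proof. by apply/funext => K; rewrite /gscale mulr0. Qed.

Lemma gscaleDr c a b : gscale c (a + b) = gscale c a + gscale c b.
Proof. by apply/funext => K; rewrite /gscale !gaddE mulrDr. Qed.

Lemma gscaleDl c e a : gscale (c + e) a = gscale c a + gscale e a.
Proof. by apply/funext => K; rewrite /gscale !gaddE mulrDl. Qed.

Lemma gsumE (T : Type) (r : seq T) (P : pred T) (F : T -> grassmann N C) K :
  (\sum_(i <- r | P i) F i) K = \sum_(i <- r | P i) F i K.
Proof.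
by elim/big_rec2: _ => [//|i x y _ <-].
Qed.

Lemma gscale_sumr c (T : Type) (r : seq T) (P : pred T) (F : T -> grassmann N C) :
  gscale c (\sum_(i <- r | P i) F i) = \sum_(i <- r | P i) gscale c (F i).
Proof. by apply/funext => K; rewrite /gscale !gsumE mulr_sumr. Qed.

Definition gbasis I : grassmann N C := fun K => (K == I)%:R.

Lemma gbasis_sum a : a = \sum_I gscale (a I) (gbasis I).
Proof.
apply/funext => K; rewrite gsumE (bigD1 K)//= big1 => [|I IK].
  by rewrite /gscale /gbasis eqxx mulr1 addr0.
by rewrite /gscale /gbasis eq_sym (negPf IK) mulr0.
Qed.

Lemma gbasisM I J : gbasis I * gbasis J =
  if disj I J then gscale (gsign I J) (gbasis (I :|: J)) else 0.
Proof.
apply/funext => K; rewrite gmul_ringE gmulE.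
have [IK|IK] := boolP (I \subset K); last first.
  rewrite big1 => [|U UK].
    case: ifP => // _; rewrite /gscale /gbasis (_ : K == I :|: J = false) ?mulr0//.
    by apply/eqP => E; move/negP: IK; apply; rewrite E finset.subsetUl.
  rewrite /gbasis (_ : U == I = false) ?mul0r ?mulr0//.
  by apply/eqP => E; move/negP: IK; apply; rewrite -E.
rewrite (bigD1 I)//= big1 ?addr0 => [|U /andP[_ UI]]; last first.
  by rewrite /gbasis (negPf UI) mul0r mulr0.
rewrite /gbasis eqxx mul1r; have [dIJ|dIJ] := boolP (disj I J).
  rewrite /gscale; have [->|KIJ] := eqVneq K (I :|: J).
    rewrite finset.setDUl finset.setDv finset.set0U.
    by rewrite (_ : J :\: I = J) ?eqxx//; apply/finset.setDidPl; rewrite disjoint_sym.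
  rewrite (_ : K :\: I == J = false) ?mulr0//; apply/eqP => E.
  by move/eqP: KIJ; apply; rewrite -E -{1}(finset.setID K I) (finset.setIidPr IK).
rewrite (_ : K :\: I == J = false) ?mulr0//; apply/eqP => E.
move/negP: dIJ; apply; rewrite -E -finset.setI_eq0 finset.setIDA finset.setIC.
by rewrite -finset.setIDA finset.setDv finset.setI0.
Qed.

Lemma gbasis0 : gbasis set0 = 1. Proof. by []. Qed.

Lemma gvar_basis i : gvar C i = gbasis [set i]. Proof. by []. Qed.

Lemma inversions1 i J : inversions [set i] J = #|[set j in J | (j < i)%N]|.
Proof.
have inj : injective (fun j : 'I_N => (i, j)) by move=> j k [].
rewrite /inversions -(fintype.card_image inj).
apply: eq_card => -[p q]; rewrite !inE /=; apply/idP/fintype.imageP.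
  by move=> /and3P[/eqP -> qJ qi]; exists q; rewrite ?inE ?qJ.
by move=> [j /[!inE] /andP[jJ ji] [-> ->]]; rewrite eqxx jJ.
Qed.

Lemma gvar_anticomm i j : gvar C i * gvar C j = - (gvar C j * gvar C i).
Proof.
rewrite !gvar_basis !gbasisM; have [->|ij] := eqVneq i j.
  by rewrite disjoints1 inE eqxx oppr0.
rewrite !disjoints1 !inE ij eq_sym ij [in RHS]finset.setUC /gsign !inversions1.
have card1 (p q : 'I_N) : #|[set k in [set p] | (k < q)%N]| = (p < q)%N.
  have [pq|pq] := boolP (p < q)%N.
    rewrite (_ : [set k in [set p] | _] = [set p]) ?cards1//.
    by apply/finset.setP => k; rewrite !inE; case: eqVneq => //= ->.
  rewrite (_ : [set k in [set p] | _] = set0) ?cards0//.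
  by apply/finset.setP => k; rewrite !inE; case: eqVneq => //= ->; exact: negbTE.
rewrite !card1; have : (i : nat) != j by rewrite -val_eqE in ij.
by rewrite neq_ltn => /orP[] ij'; rewrite ij' (ltnNge _ _) (ltnW ij') /= -gscaleN1 gscale_gscale
  ?expr0 ?expr1 ?mulr1 ?mulrNN ?mulr1.
Qed.

End GrassmannRing.

(** * Ordered products of anticommuting elements *)

Section SortedProducts.
Local Notation disj I J := (disjoint (mem I) (mem J)).
Local Notation set0 := finset.set0.
Context {N : nat} {C : fieldType} {n : nat}.
Implicit Types (I J K : {set 'I_n}).
Local Open Scope set_scope.

(** Adding a new minimum puts one factor on the left of an ordered product, without any sign. *)
Lemma set_min_ind (P : {set 'I_n} -> Prop) : P set0 ->
  (forall (m : 'I_n) J, (forall j, j \in J -> (m < j)%N) -> P J -> P (m |: J)) -> forall J, P J.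
Proof.
move=> P0 PS J; have [k] := ubnP #|J|; elim: k J => // k IH J Jk.
have [->//|[i iJ]] := set_0Vmem J.
pose m := [arg min_(p < i in J) (p : nat)].
have [mJ mmin] : m \in J /\ forall p, p \in J -> (m <= p)%N.
  by rewrite /m; case: arg_minnP => // p pJ pm; split.
rewrite -(finset.setD1K mJ); apply: PS => [j|].
  rewrite !inE => /andP[jm jJ]; rewrite ltn_neqAle mmin// andbT.
  by rewrite eq_sym -val_eqE in jm.
by apply: IH; move: Jk; rewrite (cardsD1 m) mJ ltnS.
Qed.

Lemma enum_set_min (m : 'I_n) J : (forall j, j \in J -> (m < j)%N) -> enum (m |: J) = m :: enum J.
Proof.
move=> mJ.
have tr : transitive (fun i j : 'I_n => (i < j)%N) by move=> j i k; exact: ltn_trans.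
have ir : irreflexive (fun i j : 'I_n => (i < j)%N) by move=> i; exact: ltnn.
have sE (U : {set 'I_n}) : sorted (fun i j : 'I_n => (i < j)%N) (enum U).
  rewrite /enum_mem sorted_filter// -enumT; have := iota_ltn_sorted 0 n.
  by rewrite -val_enum_ord sorted_map.
apply: (irr_sorted_eq tr ir (sE _)).
  rewrite /= path_min_sorted ?sE//; apply/allP => j.
  by rewrite mem_enum => /mJ.
by move=> j; rewrite mem_enum !inE mem_enum.
Qed.

Variable th : 'I_n -> grassmann N C.

Definition gprod I : grassmann N C := \prod_(i <- enum I) th i.

Lemma gprod0 : gprod set0 = 1.
Proof. by rewrite /gprod (_ : enum set0 = [::]) ?big_nil//; exact: enum_set0. Qed.

Lemma gprod_min (m : 'I_n) J : (forall j, j \in J -> (m < j)%N) ->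
  gprod (m |: J) = th m * gprod J.
Proof. by move=> mJ; rewrite /gprod enum_set_min// big_cons. Qed.

Lemma gprod1 i : gprod [set i] = th i.
Proof.
by rewrite -[[set i]]finset.setU0 gprod_min ?gprod0 ?mulr1// => j; rewrite inE.
Qed.

Hypothesis th_anti : forall i j, th i * th j = - (th j * th i).
Hypothesis th_sqr : forall i, th i * th i = 0.

(** Moving [th i] to its place passes the smaller elements of [J], one sign each; if [i] is already
    there, the square vanishes. *)
Lemma gprod_insert i J : th i * gprod J =
  if i \in J then 0 else
  gscale ((-1) ^+ #|[set j in J | (j < i)%N]|) (gprod (i |: J)).
Proof.
elim/set_min_ind: J => [|m J mJ IH].
  rewrite inE (_ : [set j in set0 | _] = set0) ?cards0.
    by rewrite expr0 gscale1 gprod0 mulr1 finset.setU0 gprod1.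
  by apply/finset.setP => j; rewrite !inE.
have mNJ : m \notin J by apply/negP => /mJ; rewrite ltnn.
rewrite gprod_min// !inE; have [->|im] := eqVneq i m.
  by rewrite mulrA th_sqr mul0r.
rewrite orFb; have [mi|] := ltnP m i; last first.
  rewrite leq_eqVlt val_eqE (negPf im) orFb => im'.
  have iJ : i \notin J by apply/negP => /mJ mi; have := ltn_trans mi im'; rewrite ltnn.
  rewrite (negPf iJ) (_ : [set j in m |: J | _] = set0) ?cards0; last first.
    apply/finset.setP => j; rewrite !inE; apply/negP => /andP[/orP[/eqP ->|/mJ mj] ji].
      by have := ltn_trans im' ji; rewrite ltnn.
    by have := ltn_trans (ltn_trans im' mj) ji; rewrite ltnn.
  rewrite expr0 gscale1 [in RHS]gprod_min ?gprod_min// => j.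
  by rewrite !inE => /orP[/eqP ->//|/mJ]; exact: ltn_trans im'.
rewrite mulrA th_anti mulNr -mulrA IH; case: ifP => iJ; first by rewrite mulr0 oppr0.
rewrite -gscaleAr -gprod_min; last first.
  by move=> j; rewrite !inE => /orP[/eqP ->//|/mJ].
rewrite -gscaleN1 gscale_gscale finset.setUCA; congr (gscale _ _).
rewrite -exprS; congr (_ ^+ _); rewrite (_ : [set j in m |: J | _] = m |: [set j in J | (j < i)%N]).
  by rewrite cardsU1 !inE (negPf mNJ).
by apply/finset.setP => j; rewrite !inE; case: (eqVneq j m) => //= ->; rewrite mi.
Qed.

(** The ordered products of any anticommuting family of square zero obey the rule [gbasisM] of the
    generators; hence [gmorph] below is multiplicative. *)
Lemma gprodM I J : gprod I * gprod J =
  if disj I J then gscale (gsign I J) (gprod (I :|: J)) else 0.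
Proof.
elim/set_min_ind: I => [|m I mI IH].
  by rewrite gprod0 mul1r -finset.setI_eq0 finset.set0I eqxx /gsign inversions0l gscale1 finset.set0U.
have mNI : m \notin I by apply/negP => /mI; rewrite ltnn.
rewrite gprod_min// -mulrA IH.
have -> : disj (m |: I) J = (m \notin J) && disj I J.
  rewrite -!finset.setI_eq0 finset.setIUl finset.setU_eq0; congr (_ && _).
  by rewrite finset.setI_eq0 disjoints1.
have [dIJ|] := boolP (disj I J); last by rewrite mulr0 andbF.
rewrite -gscaleAr gprod_insert !inE (negPf mNI) /= andbT; case: ifP => mJ; first by rewrite gscaler0.
rewrite gscale_gscale finset.setUA; congr (gscale _ _).
rewrite /gsign inversionsUl; last by rewrite disjoints1.
rewrite inversions1 exprD mulrC; congr (_ ^+ _ * _); apply: eq_card => j; rewrite !inE.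
have [/mI mj|//] := boolP (j \in I); rewrite orTb /= (ltnNge j m) (ltnW mj) /=.
by rewrite andbF.
Qed.

End SortedProducts.

Section Substitution.
Local Notation disj I J := (disjoint (mem I) (mem J)).
Local Notation set0 := finset.set0.
Context {N : nat} {C : fieldType}.
Implicit Types (I J K : {set 'I_N}) (a b : grassmann N C).
Local Open Scope set_scope.

Lemma gvar_sqr i : gvar C i * gvar C i = 0 :> grassmann N C.
Proof. by rewrite !gvar_basis gbasisM disjoints1 inE eqxx. Qed.

Lemma gprod_gvar I : gprod (gvar C) I = gbasis I :> grassmann N C.
Proof.
elim/(@set_min_ind N): I => [|m J mJ IH]; first by rewrite gprod0.
rewrite gprod_min// IH gvar_basis gbasisM disjoints1.
have -> : m \notin J by apply/negP => /mJ; rewrite ltnn.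
rewrite /gsign inversions1 (_ : [set j in J | _] = set0) ?cards0 ?gscale1//.
apply/finset.setP => j; rewrite !inE; apply/negP => /andP[/mJ mj jm].
by have := ltn_trans mj jm; rewrite ltnn.
Qed.

Variable th : 'I_N -> grassmann N C.

(** The substitution of [th] for the generators, as given by the universal property of the exterior
    algebra. *)
Definition gmorph a : grassmann N C := \sum_I gscale (a I) (gprod th I).

Lemma gmorphD a b : gmorph (a + b) = gmorph a + gmorph b.
Proof. by rewrite /gmorph -big_split; apply: eq_bigr => I _; rewrite gaddE gscaleDl. Qed.

Lemma gmorph0 : gmorph 0 = 0.
Proof. by rewrite /gmorph big1// => I _; exact: gscale0. Qed.

Lemma gmorph_sum (T : Type) (r : seq T) (P : pred T) (F : T -> grassmann N C) :
  gmorph (\sum_(i <- r | P i) F i) = \sum_(i <- r | P i) gmorph (F i).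
Proof. by apply: (big_morph gmorph gmorphD gmorph0). Qed.

Lemma gmorphZ c a : gmorph (gscale c a) = gscale c (gmorph a).
Proof. by rewrite /gmorph gscale_sumr; apply: eq_bigr => I _; rewrite gscale_gscale. Qed.

Lemma gmorph_basis I : gmorph (gbasis I) = gprod th I.
Proof.
rewrite /gmorph (bigD1 I)//= big1 ?addr0 => [|J JI].
  by rewrite /gbasis eqxx gscale1.
by rewrite /gbasis (negPf JI) gscale0.
Qed.

Lemma gmorph_gvar i : gmorph (gvar C i) = th i.
Proof. by rewrite gvar_basis gmorph_basis gprod1. Qed.

Lemma gmorph1 : gmorph 1 = 1.
Proof. by rewrite -gbasis0 gmorph_basis gprod0. Qed.

Hypothesis th_anti : forall i j, th i * th j = - (th j * th i).
Hypothesis th_sqr : forall i, th i * th i = 0.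

Lemma gmorphM a b : gmorph (a * b) = gmorph a * gmorph b.
Proof.
rewrite {1}(gbasis_sum a) {1}(gbasis_sum b) mulr_suml gmorph_sum [in RHS]/gmorph mulr_suml.
apply: eq_bigr => I _; rewrite mulr_sumr gmorph_sum mulr_sumr.
apply: eq_bigr => J _; rewrite -!gscaleAl -!gscaleAr !gmorphZ gbasisM gprodM//.
by case: ifP => _; rewrite ?gmorphZ ?gmorph_basis// gmorph0.
Qed.

Lemma gmorphX a k : gmorph (a ^+ k) = gmorph a ^+ k.
Proof. by elim: k => [|k IH]; rewrite ?expr0 ?gmorph1// !exprS gmorphM IH. Qed.

Lemma gmorph_prod (T : Type) (r : seq T) (P : pred T) (F : T -> grassmann N C) :
  gmorph (\prod_(i <- r | P i) F i) = \prod_(i <- r | P i) gmorph (F i).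
Proof. exact: (big_morph gmorph gmorphM gmorph1). Qed.

Lemma gexpE a : gexp a = \sum_(k < N.+1) gscale (k`!%:R)^-1 (a ^+ k).
Proof.
apply/funext => K; rewrite gsumE; apply: eq_bigr => k _; rewrite /gscale; congr (_ * _ K).
by elim: (k : nat) => // p IH; rewrite iterS IH exprS.
Qed.

Lemma gmorph_exp a : gmorph (gexp a) = gexp (gmorph a).
Proof.
rewrite !gexpE gmorph_sum; apply: eq_bigr => k _.
by rewrite gmorphZ gmorphX.
Qed.

End Substitution.

(** * Filtration by the degree in a set of variables *)

Section Filtration.
Local Notation disj I J := (disjoint (mem I) (mem J)).
Local Notation set0 := finset.set0.
Context {N : nat} {C : fieldType}.
Implicit Types (I J K : {set 'I_N}) (a b : grassmann N C).
Variable S : {set 'I_N}.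
Local Open Scope set_scope.

Definition degree_lt m a := forall K, (m <= #|K :&: S|)%N -> a K = 0.

Lemma degree_ltD m a b : degree_lt m a -> degree_lt m b -> degree_lt m (a + b).
Proof. by move=> Ha Hb K mK; rewrite gaddE Ha// Hb// addr0. Qed.

(** The successor accounts for the strict bounds: degree at most [m] times degree below [k] is of
    degree below [m + k]. *)
Lemma degree_ltM m k a b : degree_lt m.+1 a -> degree_lt k b -> degree_lt (m + k) (a * b).
Proof.
move=> Ha Hb K mK; rewrite gmul_ringE gmulE big1// => I IK.
have E : #|K :&: S| = (#|I :&: S| + #|(K :\: I) :&: S|)%N.
  rewrite -cardsUI -finset.setIUl [X in _ = (_ + X)%N](_ : _ = 0%N) ?addn0.
    by rewrite -{1}(finset.setID K I) (finset.setIidPr IK).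
  apply/eqP; rewrite cards_eq0; apply/eqP/finset.setP => j; rewrite !inE.
  by case: (j \in I); rewrite ?andbF.
have [mI|mI] := ltnP m #|I :&: S|; first by rewrite Ha// mul0r mulr0.
rewrite Hb ?mulr0//; move: mK; rewrite E => /leq_trans/(_ (leq_add mI (leqnn _))).
by rewrite leq_add2l.
Qed.

Lemma degree_lt_weaken m k a : (m <= k)%N -> degree_lt m a -> degree_lt k a.
Proof. by move=> mk Ha K kK; apply: Ha; exact: leq_trans kK. Qed.

Lemma degree_lt_gvar i : degree_lt (i \in S).+1 (gvar C i).
Proof.
move=> K; rewrite /gvar; have [->|//] := eqVneq K [set i].
have [iS|iS] := boolP (i \in S).
  by move=> /leq_trans/(_ (subset_leq_card (finset.subsetIl _ _))); rewrite cards1.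
by rewrite card_gt0 => /finset.set0Pn[j]; rewrite !inE => /andP[/eqP ->]; rewrite (negPf iS).
Qed.

Variable eta : 'I_N -> grassmann N C.
Hypothesis eta0 : forall i, i \notin S -> eta i = 0.
Hypothesis eta_deg : forall i, degree_lt 1 (eta i).

(** Telescoping. Replacing a variable of [S] by its [eta i], which contains none, lowers the degree
    in [S]; the shifted and the plain monomial thus differ by terms of lower degree. *)
Lemma degree_gprod_shift l :
  degree_lt (count (mem S) l).+1 (\prod_(i <- l) gvar C i) /\
  degree_lt (count (mem S) l) (\prod_(i <- l) (gvar C i + eta i) - \prod_(i <- l) gvar C i).
Proof.
elim: l => [|i l [IH1 IH2]].
  split; last by move=> K _; rewrite !big_nil subrr.
  rewrite big_nil => K; rewrite card_gt0 => K0; rewrite -gbasis0 /gbasis.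
  by have [E|//] := eqVneq K set0; rewrite E finset.set0I eqxx in K0.
have gi : degree_lt (i \in S).+1 (gvar C i) by exact: degree_lt_gvar.
have ei : degree_lt (i \in S).+1 (eta i) by apply: degree_lt_weaken (eta_deg i).
rewrite !big_cons /=; split.
  by rewrite -addnS; apply: degree_ltM.
rewrite (_ : _ - _ = (gvar C i + eta i) *
    (\prod_(j <- l) (gvar C j + eta j) - \prod_(j <- l) gvar C j) +
    eta i * \prod_(j <- l) gvar C j); last by rewrite [in RHS]mulrBr [X in _ = _ - X + _]mulrDl; zmod.
apply: degree_ltD; first by apply: degree_ltM => //; exact: degree_ltD.
have [iS|iS] := boolP (i \in S); last by rewrite eta0// mul0r => K _.
by rewrite -[(true + _)%N]/(0 + (count (mem S) l).+1)%N; apply: degree_ltM.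
Qed.

(* Only the leading monomial of the translate of [th^J] can contain all the
   variables in [S]: this is the translation invariance of the Berezin integral
   over [S]. *)
Lemma gmorph_shift_top a (T : {set 'I_N}) : S \subset T ->
  gmorph (fun i => gvar C i + eta i) a T = a T.
Proof.
move=> ST; rewrite /gmorph gsumE [in RHS](gbasis_sum a) gsumE; apply: eq_bigr => J _.
rewrite /gscale; congr (_ * _); rewrite -gprod_gvar /gprod.
have [_ H] := degree_gprod_shift (enum J).
have E : (count (mem S) (enum J) <= #|T :&: S|)%N ->
  (\prod_(i <- enum J) (gvar C i + eta i)) T - (\prod_(i <- enum J) gvar C i) T = 0 := H T.
apply: subr0_eq; apply: E; rewrite (finset.setIidPr ST) -size_filter.
rewrite -(card_uniqP (filter_uniq _ (enum_uniq _))); apply: subset_leq_card.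
by apply/fintype.subsetP => j; rewrite mem_filter => /andP[].
Qed.

End Filtration.

(** * Translation of the odd variables *)

Section OddVariables.
Context {C : fieldType} {n : nat}.
Local Notation N := (n + (n + n))%N.
Local Notation G := (grassmann N C).
Local Notation xi0 := (fun i : 'I_n => gvar C (odd_index0 i)).
Local Notation xi1 := (fun i : 'I_n => gvar C (odd_index1 i)).
Local Notation xi2 := (fun i : 'I_n => gvar C (odd_index2 i)).
Local Notation odd1 := [set odd_index1 i | i : 'I_n]%SET.
Local Notation odd2 := [set odd_index2 i | i : 'I_n]%SET.

Definition odd_shift (j : 'I_N) : G :=
  match fintype.split j with
  | inl _ => 0
  | inr k => match fintype.split k with
    | inl i => gvar C (odd_index0 i)
    | inr i => gvar C (odd_index0 i)
    end
  end.

Lemma odd_shift0 i : odd_shift (odd_index0 i) = 0.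
Proof. by rewrite /odd_shift /odd_index0 (unsplitK (inl i)). Qed.

Lemma odd_shift1 i : odd_shift (odd_index1 i) = gvar C (odd_index0 i).
Proof. by rewrite /odd_shift /odd_index1 (unsplitK (inr (lshift n i))) (unsplitK (inl i)). Qed.

Lemma odd_shift2 i : odd_shift (odd_index2 i) = gvar C (odd_index0 i).
Proof. by rewrite /odd_shift /odd_index2 (unsplitK (inr (rshift n i))) (unsplitK (inr i)). Qed.

Definition shifted_gvar j : G := gvar C j + odd_shift j.

Lemma odd_shift_cases j : odd_shift j = 0 \/ exists i, odd_shift j = gvar C i.
Proof.
by rewrite /odd_shift; case: (fintype.split j) => k; [left|right; case: (fintype.split k) => i; exists (odd_index0 i)].
Qed.

Lemma shifted_gvar_anticomm i j :
  shifted_gvar i * shifted_gvar j = - (shifted_gvar j * shifted_gvar i).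
Proof.
have D (a b c : G) : a * b = - (b * a) -> a * c = - (c * a) -> a * (b + c) = - ((b + c) * a).
  by move=> E1 E2; rewrite mulrDr mulrDl E1 E2 opprD.
have S (a b : G) : a * b = - (b * a) -> b * a = - (a * b) by move=> ->; rewrite opprK.
have V k l : gvar C k * odd_shift l = - (odd_shift l * gvar C k).
  case: (odd_shift_cases l) => [->|[p ->]]; last exact: gvar_anticomm.
  by rewrite mulr0 mul0r oppr0.
rewrite /shifted_gvar; apply: (D _ _ _); apply: (S _ _); apply: (D _ _ _).
- exact: gvar_anticomm.
- exact: V.
- by apply: (S _ _); exact: V.
case: (odd_shift_cases j) => [->|[p ->]]; last exact: V.
by rewrite mulr0 mul0r oppr0.
Qed.

Lemma shifted_gvar_sqr i : shifted_gvar i * shifted_gvar i = 0.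
Proof.
rewrite /shifted_gvar; case: (odd_shift_cases i) => [->|[j ->]].
  by rewrite addr0 gvar_sqr.
by rewrite mulrDr !mulrDl !gvar_sqr (gvar_anticomm j i) addr0 add0r addNr.
Qed.

Lemma odd_index0_notin i : odd_index0 i \notin (odd1 :|: odd2)%SET.
Proof.
by rewrite inE; apply/norP; split; apply/imsetP => -[k _] /eqP; rewrite /odd_index0 eq_lrshift.
Qed.

Lemma omega1_morph (a b : 'I_n -> G) :
  gmorph shifted_gvar (omega1 a b) =
  omega1 (fun i => gmorph shifted_gvar (a i)) (fun i => gmorph shifted_gvar (b i)).
Proof.
have E (x y : 'I_n -> G) : omega1 x y = gscale 2 (\sum_i x i * y i).
  by apply/funext => K; rewrite /omega1 /gscale gsumE.
rewrite !E gmorphZ gmorph_sum; congr gscale; apply: eq_bigr => i _.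
by rewrite gmorphM//; [exact: shifted_gvar_anticomm|exact: shifted_gvar_sqr].
Qed.

(** The squares vanish, and the cross terms with [xi0] cancel in pairs by anticommutation. *)
Lemma shifted_phase :
  gmorph shifted_gvar (fun K => omega1 xi0 xi1 K + omega1 xi1 xi2 K + omega1 xi2 xi0 K) =
  omega1 xi1 xi2.
Proof.
have -> : (fun K => omega1 xi0 xi1 K + omega1 xi1 xi2 K + omega1 xi2 xi0 K) =
  omega1 xi0 xi1 + omega1 xi1 xi2 + omega1 xi2 xi0 :> G by [].
rewrite !gmorphD !omega1_morph.
have E (x y : 'I_n -> G) : omega1 x y = gscale 2 (\sum_i x i * y i).
  by apply/funext => K; rewrite /omega1 /gscale gsumE.
rewrite !E -!gscaleDr; congr gscale; rewrite -!big_split /=; apply: eq_bigr => i _.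
rewrite !gmorph_gvar /shifted_gvar odd_shift0 odd_shift1 odd_shift2 addr0.
set x0 := gvar C _; set x1 := gvar C (odd_index1 i); set x2 := gvar C (odd_index2 i).
rewrite !mulrDr !mulrDl !gvar_sqr /x0 (gvar_anticomm (odd_index0 i) (odd_index1 i)).
rewrite (gvar_anticomm (odd_index2 i) (odd_index0 i)) -/x0 -/x1 -/x2.
by move: (x1 * x0) (x1 * x2) (x0 * x2) => a b c; zmod.
Qed.

Lemma gprod_shifted1 I : gmorph shifted_gvar (gprod xi1 I) =
  gprod (fun i K => xi1 i K + xi0 i K) I.
Proof.
rewrite /gprod gmorph_prod; [|exact: shifted_gvar_anticomm|exact: shifted_gvar_sqr].
by apply: eq_bigr => i _; rewrite gmorph_gvar /shifted_gvar odd_shift1.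
Qed.

Lemma gprod_shifted2 I : gmorph shifted_gvar (gprod xi2 I) =
  gprod (fun i K => xi2 i K + xi0 i K) I.
Proof.
rewrite /gprod gmorph_prod; [|exact: shifted_gvar_anticomm|exact: shifted_gvar_sqr].
by apply: eq_bigr => i _; rewrite gmorph_gvar /shifted_gvar odd_shift2.
Qed.

(** The odd factor attached to the pair of coefficients of indices [I1] and [I2]: a scalar Grassmann
    element, separated from the values in [A]. *)
Definition odd_coef (th1 th2 : 'I_n -> G) (c : C) (phase : G) (I1 I2 : {set 'I_n}) : G :=
  gprod th1 I1 * gprod th2 I2 * gexp (gscale c phase).

Lemma odd_coef_shift c I1 I2 (T : {set 'I_N}) : (odd1 :|: odd2)%SET \subset T ->
  odd_coef xi1 xi2 c (fun K => omega1 xi0 xi1 K + omega1 xi1 xi2 K + omega1 xi2 xi0 K) I1 I2 T =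
  odd_coef (fun i K => xi1 i K + xi0 i K) (fun i K => xi2 i K + xi0 i K) c
    (omega1 xi1 xi2) I1 I2 T.
Proof.
move=> ST; rewrite -(@gmorph_shift_top N C _ odd_shift _ _ _ T ST) /odd_coef.
- have an := shifted_gvar_anticomm; have sq := shifted_gvar_sqr.
  rewrite !(gmorphM an sq) (gmorph_exp an sq) gmorphZ gprod_shifted1 gprod_shifted2.
  by rewrite shifted_phase.
- move=> j; rewrite inE => /norP[j1 j2]; rewrite /odd_shift.
  case: (split_ordP j) => k jk //; rewrite jk in j1 j2 *.
  case: (split_ordP k) => i ki; rewrite ki in j1 j2.
    by move/imsetP: j1; case; exists i.
  by move/imsetP: j2; case; exists i.
- move=> j; case: (odd_shift_cases j) => [->|]; first by move=> K.
  rewrite /odd_shift; case: (fintype.split j) => [k|k] => [_|]; first by move=> K.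
  have d0 i : degree_lt (odd1 :|: odd2)%SET 1 (gvar C (odd_index0 i) : G).
    have := @degree_lt_gvar N C (odd1 :|: odd2)%SET (odd_index0 i).
    by rewrite (negPf (odd_index0_notin i)).
  by case: (fintype.split k) => i _; exact: d0.
Qed.

End OddVariables.

Section OddProduct.
Context {R : realType} {A : frechetAlgType R} {n : nat}.
Local Notation N := (n + (n + n))%N.
Local Notation G := (grassmann N R[i]).
Local Notation odd1 := [set odd_index1 i | i : 'I_n]%SET.
Local Notation odd2 := [set odd_index2 i | i : 'I_n]%SET.

Lemma fmul_suml (T : Type) (r : seq T) (c : T -> R[i]) (x : T -> A) y :
  fmul (\sum_(i <- r) c i *: x i) y = \sum_(i <- r) c i *: fmul (x i) y.
Proof.
elim: r => [|i r IH]; first by rewrite !big_nil fmul0l.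
by rewrite !big_cons fmulZl IH.
Qed.

Lemma fmul_sumr (T : Type) (r : seq T) (c : T -> R[i]) (x : T -> A) y :
  fmul y (\sum_(i <- r) c i *: x i) = \sum_(i <- r) c i *: fmul y (x i).
Proof.
elim: r => [|i r IH]; first by rewrite !big_nil fmul0r.
by rewrite !big_cons fmulZr IH.
Qed.

Lemma gmul_gsubst (c1 c2 : {set 'I_n} -> A) (th1 th2 : 'I_n -> G) K :
  gmul fmul (gsubst c1 th1) (gsubst c2 th2) K = \sum_I1 \sum_I2
    (gprod th1 I1 * gprod th2 I2) K *: fmul (c1 I1) (c2 I2).
Proof.
under [RHS]eq_bigr => I1 _ do under eq_bigr => I2 _ do rewrite gmul_ringE gmulE scaler_suml.
under [RHS]eq_bigr => I1 _ do rewrite exchange_big.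
rewrite [RHS]exchange_big; apply: eq_bigr => U UK.
rewrite (mulrz_sign (C := R[i])) /gsubst fmul_suml scaler_sumr; apply: eq_bigr => I1 _.
rewrite fmul_sumr !scaler_sumr; apply: eq_bigr => I2 _.
by rewrite !scalerA.
Qed.

Lemma odd_productE a0 lambda (c1 c2 : {set 'I_n} -> A) th1 th2 (phase : G) J :
  odd_product a0 lambda c1 c2 th1 th2 phase J = \sum_I1 \sum_I2
    odd_coef th1 th2 ((0 +i* (2 * a0)) * lambda) phase I1 I2 J *: fmul (c1 I1) (c2 I2).
Proof.
rewrite /odd_product /odd_coef.
have -> : gexp (fun K => (0 +i* (2 * a0)) * lambda * phase K) =
  gexp (gscale ((0 +i* (2 * a0)) * lambda) phase) by [].
set E := gexp _.
under [RHS]eq_bigr => I1 _ do under eq_bigr => I2 _ do rewrite gmul_ringE gmulE scaler_suml.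
under [RHS]eq_bigr => I1 _ do rewrite exchange_big.
rewrite [RHS]exchange_big; apply: eq_bigr => U UJ.
rewrite (mulrz_sign (C := R[i])) gmul_gsubst !scaler_sumr; apply: eq_bigr => I1 _.
rewrite !scaler_sumr; apply: eq_bigr => I2 _.
by rewrite !scalerA [in RHS](mulrC (_ U)) mulrA.
Qed.

(* The coefficient read off by the two Berezin integrals, with its sign. *)
Definition top_set (K : {set 'I_n}) : {set 'I_N} :=
  (odd2 :|: (odd1 :|: [set odd_index0 i | i in K]))%SET.

Definition top_sign (K : {set 'I_n}) : R[i] :=
  let K0 := [set odd_index0 i | i in K]%SET in
  (-1) ^+ inversions odd1 K0 * (-1) ^+ inversions odd2 (odd1 :|: K0)%SET.

Lemma sub_top_set K : (odd1 :|: odd2)%SET \subset top_set K.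
Proof. by rewrite /top_set finset.subUset finset.subsetUl finset.setUCA finset.subsetUl. Qed.

Lemma berezin2E (V : lmodType R[i]) (F : grassmann N V) (K : {set 'I_n}) :
  berezin odd1 (berezin odd2 F) [set odd_index0 i | i in K]%SET =
  top_sign K *: F (top_set K).
Proof.
have dis (p q : 'I_n -> 'I_N) : (forall i j, p i != q j) -> forall (U W : {pred 'I_n}),
    ([set p i | i in U] :&: [set q i | i in W] = finset.set0)%SET.
  move=> pq U W; apply/finset.setP => x; rewrite !inE.
  by apply/negP => /andP[/imsetP[i _ ->] /imsetP[j _ /eqP]]; apply/negP.
have d01 i j : odd_index0 i != odd_index1 j :> 'I_N by rewrite eq_lrshift.
have d02 i j : odd_index0 i != odd_index2 j :> 'I_N by rewrite eq_lrshift.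
have d12 i j : odd_index1 i != odd_index2 j :> 'I_N by rewrite eq_rshift eq_lrshift.
rewrite /berezin -!finset.setI_eq0 finset.setIUl !dis// finset.setU0 eqxx.
by rewrite !(mulrz_sign (C := R[i])) scalerA.
Qed.

End OddProduct.

(** * The star product *)

Section Phase.
Context {R : realType} {k : nat} (a0 : R).
Local Notation body := 'rV[R]_(k + k).
Local Notation body2 := 'rV[R]_((k + k) + (k + k)).
Local Notation phase := (quadratic_phase (k := k) a0).

(* [x_1] is paired with [w_2] and [w_1] with [x_2]. *)
Definition dual_coord (j : 'I_((k + k) + (k + k))) : 'I_((k + k) + (k + k)) :=
  match fintype.split j with
  | inl a => match fintype.split a with
    | inl i => rshift (k + k) (rshift k i)
    | inr i => rshift (k + k) (lshift k i)
    end
  | inr b => match fintype.split b with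
    | inl i => lshift (k + k) (rshift k i)
    | inr i => lshift (k + k) (lshift k i)
    end
  end.

Definition dual_slope (j : 'I_((k + k) + (k + k))) : R :=
  match fintype.split j with
  | inl a => if fintype.split a is inl _ then - (2 * a0) else 2 * a0
  | inr b => if fintype.split b is inl _ then 2 * a0 else - (2 * a0)
  end.

Lemma dual_coord_ll i : dual_coord (lshift (k + k) (lshift k i)) = rshift (k + k) (rshift k i).
Proof. by rewrite /dual_coord (unsplitK (inl (lshift k i))) (unsplitK (inl i)). Qed.
Lemma dual_coord_lr i : dual_coord (lshift (k + k) (rshift k i)) = rshift (k + k) (lshift k i).
Proof. by rewrite /dual_coord (unsplitK (inl (rshift k i))) (unsplitK (inr i)). Qed.
Lemma dual_coord_rl i : dual_coord (rshift (k + k) (lshift k i)) = lshift (k + k) (rshift k i).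
Proof. by rewrite /dual_coord (unsplitK (inr (lshift k i))) (unsplitK (inl i)). Qed.
Lemma dual_coord_rr i : dual_coord (rshift (k + k) (rshift k i)) = lshift (k + k) (lshift k i).
Proof. by rewrite /dual_coord (unsplitK (inr (rshift k i))) (unsplitK (inr i)). Qed.
Definition dual_coordE := (dual_coord_ll, dual_coord_lr, dual_coord_rl, dual_coord_rr).

Lemma dual_slopeE i :
  (dual_slope (lshift (k + k) (lshift k i)) = - (2 * a0)) *
  (dual_slope (lshift (k + k) (rshift k i)) = 2 * a0) *
  (dual_slope (rshift (k + k) (lshift k i)) = 2 * a0) *
  (dual_slope (rshift (k + k) (rshift k i)) = - (2 * a0)).
Proof.
rewrite /dual_slope (unsplitK (inl (lshift k i))) (unsplitK (inl (rshift k i))).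
rewrite (unsplitK (inr (lshift k i))) (unsplitK (inr (rshift k i))).
by rewrite (unsplitK (inl i)) (unsplitK (inr i)).
Qed.

Lemma dual_coord_cases (P : 'I_((k + k) + (k + k)) -> Prop) :
  (forall i, P (lshift (k + k) (lshift k i))) -> (forall i, P (lshift (k + k) (rshift k i))) ->
  (forall i, P (rshift (k + k) (lshift k i))) -> (forall i, P (rshift (k + k) (rshift k i))) ->
  forall j, P j.
Proof.
move=> p1 p2 p3 p4 j; case: (split_ordP j) => a ->; case: (split_ordP a) => i ->.
- exact: p1.
- exact: p2.
- exact: p3.
- exact: p4.
Qed.

Lemma dual_coordK : involutive dual_coord.
Proof. by apply: dual_coord_cases => i; rewrite !dual_coordE. Qed.

Lemma dual_coord_inj : injective dual_coord. Proof. exact: inv_inj dual_coordK. Qed.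

Lemma dual_coord_neq j : dual_coord j != j.
Proof.
by move: j; apply: dual_coord_cases => i; rewrite dual_coordE ?eq_lrshift ?eq_rlshift.
Qed.

Lemma dual_slope_neq0 j : a0 != 0 -> dual_slope j != 0.
Proof.
by move=> a00; move: j; apply: dual_coord_cases => i; rewrite dual_slopeE ?oppr_eq0 mulf_neq0.
Qed.

Lemma omega0Dl (x x' w : 'rV[R]_k) : omega0 (x + x') w = omega0 x w + omega0 x' w.
Proof. by rewrite /omega0 -big_split /=; apply: eq_bigr => i _; rewrite mxE mulrDl. Qed.

Lemma omega0Nl (x w : 'rV[R]_k) : omega0 (- x) w = - omega0 x w.
Proof. by rewrite /omega0 -sumrN; apply: eq_bigr => i _; rewrite mxE mulNr. Qed.

Lemma omega0C (x w : 'rV[R]_k) : omega0 x w = omega0 w x.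
Proof. by apply: eq_bigr => i _; rewrite mulrC. Qed.

Lemma omega0_delta h i (w : 'rV[R]_k) : omega0 (h *: delta_mx 0 i) w = h * w 0 i.
Proof.
rewrite /omega0 (bigD1 i)//= big1 => [|j ji]; first by rewrite !mxE !eqxx mulr1 addr0.
by rewrite !mxE (negPf ji) mulr0 mul0r.
Qed.

Lemma omega0Dr (x w w' : 'rV[R]_k) : omega0 x (w + w') = omega0 x w + omega0 x w'.
Proof. by rewrite omega0C omega0Dl !(omega0C x). Qed.

Lemma omega0_deltar h i (w : 'rV[R]_k) : omega0 w (h *: delta_mx 0 i) = h * w 0 i.
Proof. by rewrite omega0C omega0_delta. Qed.

(** No coordinate multiplies itself in the exponent, which is therefore affine in each of them; the
    formula is exact. *)
Lemma phase_shift i (Y : body2) (h : R) :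
  phase (Y + h *: delta_mx 0 i) = phase Y * expi (h * (dual_slope i * Y 0 (dual_coord i))).
Proof.
rewrite /quadratic_phase -expiD; congr expi.
move: i; apply: dual_coord_cases => i; rewrite dual_coordE dual_slopeE.
- rewrite !(lsubmx_delta h (lshift k i) Y) (lsubmx_delta h i (lsubmx Y)).1 (lsubmx_delta h i (lsubmx Y)).2.
  by rewrite omega0Dl omega0_delta !mxE; ring.
- rewrite !(lsubmx_delta h (rshift k i) Y) (rsubmx_delta h i (lsubmx Y)).1 (rsubmx_delta h i (lsubmx Y)).2.
  by rewrite omega0Dr omega0_deltar !mxE; ring.
- rewrite !(rsubmx_delta h (lshift k i) Y) (lsubmx_delta h i (rsubmx Y)).1 (lsubmx_delta h i (rsubmx Y)).2.
  by rewrite omega0Dl omega0_delta !mxE; ring.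
- rewrite !(rsubmx_delta h (rshift k i) Y) (rsubmx_delta h i (rsubmx Y)).1 (rsubmx_delta h i (rsubmx Y)).2.
  by rewrite omega0Dr omega0_deltar !mxE; ring.
Qed.

Lemma phase_unit Y : cmod (phase Y) = 1. Proof. exact: cmod_expi. Qed.

(** The terms quadratic in [y] cancel, and the cyclic phase becomes the quadratic one at the
    translated point. *)
Lemma star_phase (y y1 y2 : body) :
  expi (2 * a0 * (omega0 (lsubmx y2 - lsubmx y) (rsubmx y1)
    + omega0 (lsubmx y - lsubmx y1) (rsubmx y2)
    + omega0 (lsubmx y1 - lsubmx y2) (rsubmx y))) =
  phase (row_mx y1 y2 - row_mx y y).
Proof.
have subl e1 e2 (a b : 'rV[R]_(e1 + e2)) : lsubmx (a - b) = lsubmx a - lsubmx b.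
  by apply/rowP => i; rewrite !mxE.
have subr e1 e2 (a b : 'rV[R]_(e1 + e2)) : rsubmx (a - b) = rsubmx a - rsubmx b.
  by apply/rowP => i; rewrite !mxE.
rewrite /quadratic_phase; congr (expi (_ * _)).
rewrite !(subl, subr) !(row_mxKl, row_mxKr).
have omega0Br (x w w' : 'rV[R]_k) : omega0 x (w - w') = omega0 x w - omega0 x w'.
  by rewrite omega0Dr (omega0C x (- w')) omega0Nl (omega0C w').
by rewrite !omega0Dl !omega0Nl !omega0Br; ring.
Qed.

End Phase.

(** * Decay of test functions *)

Section CompactSupport.
Context {R : realType} {A : frechetType R} {d : nat}.
Implicit Types (f : 'rV[R]_d -> A).
Local Notation e_ i := (delta_mx 0 i : 'rV[R]_d).
Local Notation supp f := (closure [set y | f y != 0]).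

Lemma norm_delta_le (h : R) i : `|h *: e_ i| <= `|h|.
Proof.
rewrite [leLHS]/Num.norm/= mx_normrE; apply/bigmax_leP => /=; split=> // -[a p] _ /=.
by rewrite !mxE; case: (_ && _); rewrite ?mulr1 ?mulr0 ?normr0.
Qed.

Lemma foldr_partial_support f s y : ~ supp f y -> foldr partial f s y = 0.
Proof.
elim: s y => [|i s IH] y /= ny.
  by apply/eqP/negP => /negP fy; apply: ny; exact: subset_closure.
apply: partialE; apply/partial_cvgP => j e e0.
have oK : open (~` supp f) by apply: closed_openC; exact: closed_closure.
have : nbhs y (~` supp f) by exact: open_nbhs_nbhs.
move=> /nbhs_ballP[del /= d0 Hd]; exists del => // h hd.
rewrite !IH// ?scaler0 ?subrr ?semi0 ?mulr_ge0// ?(ltW e0)//.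
apply: Hd; rewrite -ball_normE /ball_ /= opprD addrA subrr sub0r normrN.
exact: le_lt_trans (norm_delta_le h i) hd.
Qed.

Lemma compact_dominated (K : set 'rV[R]_d) (f : 'rV[R]_d -> A) j :
  compact K -> continuous f -> exists2 C, 0 <= C & forall y, K y -> semi j (f y) <= C.
Proof.
move=> cK cf.
have cs : continuous (fun y => semi j (f y) : R^o).
  move=> y; have FF : Filter (nbhs y) by exact: nbhs_filter.
  apply/cvgrPdist_lt => e e0.
  have /continuous_semiP/(_ j e e0)[del d0 Hd] := cf y.
  apply: (@filterS _ (nbhs y) _ (ball y del)); last exact: nbhsx_ballx.
  move=> z /=; rewrite -ball_normE /ball_ /= => yz.
  have {}Hd : semi j (f z - f y) < e.
    have := Hd (z - y); rewrite (addrC y) subrK; apply; by rewrite -opprB normrN.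
  rewrite ltr_distlC; have := semi_dist_le j (f z) (f y) 0; have := semi_dist_le j (f y) (f z) 0.
  rewrite !subr0 (semi_distrC j (f y)); move: Hd; lra.
have /compact_bounded : compact ((fun y => semi j (f y) : R^o) @` K).
  by apply: continuous_compact => //; apply: continuous_subspaceT.
move=> [M0 [_ HM0]]; have {}HM0 := HM0 (`|M0| + 1); pose M := `|M0| + 1.
have HM : forall x, ((fun y => semi j (f y) : R^o) @` K) x -> `|x| <= M.
  by apply: HM0; rewrite (le_lt_trans (ler_norm _))// ltrDl.
exists `|M| => // y Ky.
rewrite (le_trans (ler_norm _))// (le_trans _ (ler_norm M))//.
by apply: HM; exists y.
Qed.

Lemma rho_norm_le (y : 'rV[R]_d) : rho y <= (1 + `|y|) ^+ d.
Proof.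
rewrite (_ : (1 + `|y|) ^+ d = \prod_(i < d) (1 + `|y|)); last first.
  by rewrite prodr_const card_ord.
apply: ler_prod => i _.
by rewrite addr_ge0//= lerD2l rV_coord_le.
Qed.

Lemma test_symb m f : smooth f -> compactly_supported f -> symb (fun y => rho y ^- m) f.
Proof.
move=> sf cf; split=> // s j.
have [C C0 HC] := compact_dominated j cf (smooth_continuous (smooth_foldr s sf)).
have [M0 [_ HM0]] := compact_bounded cf; pose M := `|M0| + 1.
have HM : forall y, supp f y -> `|y| <= M.
  by apply: HM0; rewrite (le_lt_trans (ler_norm _))// ltrDl.
pose B := (1 + `|M|) ^+ d ^+ m.
have B0 : 0 <= B by rewrite !exprn_ge0// addr_ge0.
exists (C * B) => y; have [Ky|nKy] := pselect (supp f y); last first.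
  rewrite foldr_partial_support// semi0 mulr_ge0// ?mulr_ge0// invr_ge0 exprn_ge0//.
  exact/ltW/rho_gt0.
rewrite (le_trans (HC y Ky))// -mulrA ler_peMr// ler_pdivlMr ?exprn_gt0 ?rho_gt0// mul1r.
rewrite lerXn2r ?nnegrE ?exprn_ge0 ?addr_ge0// ?(ltW (rho_gt0 _))//.
rewrite (le_trans (rho_norm_le y))// lerXn2r ?nnegrE ?addr_ge0// lerD2l.
exact: le_trans (HM y Ky) (ler_norm M).
Qed.

End CompactSupport.

Section IntegralSums.
Context {R : realType} {A : frechetType R} {d : nat}.
Implicit Types (f g : 'rV[R]_d -> A) (F G : 'rV[R]_(d + d) -> A).

Lemma decaying0 : decaying (fun=> 0 : A) (d := d).
Proof.
split; first exact: cst_continuous.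
by move=> j; exists 0 => y; rewrite semi0 mul0r.
Qed.

Lemma integral0 : Defs.integral (fun=> 0 : A) (d := d) = 0.
Proof.
rewrite -[RHS](addNr (Defs.integral (fun=> 0 : A) (d := d))) -scaleN1r.
rewrite -(integral_linear (-1) decaying0 decaying0).
by congr Defs.integral; apply/funext => y; rewrite !fctE scaler0 addr0.
Qed.

Lemma integralZ c f : decaying f -> Defs.integral (fun y => c *: f y) = c *: Defs.integral f.
Proof.
move=> df; rewrite -[RHS]addr0 -integral0 -(integral_linear c df decaying0).
by congr Defs.integral; apply/funext => y; rewrite !fctE addr0.
Qed.

Lemma berezin_integral N (S : {set 'I_N}) (g : 'rV[R]_d -> {set 'I_N} -> A) :
  (forall J, decaying (g^~ J)) ->
  (fun J => Defs.integral (fun y => berezin S (g y) J)) =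
  berezin S (fun J => Defs.integral (fun y => g y J)).
Proof.
move=> dg; apply/funext => J; rewrite /berezin; case: ifP => _; last exact: integral0.
rewrite (mulrz_sign (C := R[i])) -integralZ//; congr Defs.integral.
by apply/funext => y; rewrite (mulrz_sign (C := R[i])).
Qed.

Lemma tame0 : tame (fun=> 0 : A) (d := d).
Proof.
split; first exact: smooth0.
  by move=> j; exists 0 => y; rewrite semi0 mul0r.
move=> i j; exists 0 => y; rewrite (partialE (partial_cvg0 i y)) semi0 mul0r//.
Qed.

Lemma double_integral0 : double_integral (fun=> 0 : A) (d := d) = 0.
Proof. by rewrite /double_integral integral0 integral0. Qed.

Lemma tame_sum (T : Type) (r : seq T) (c : T -> R[i]) (F : T -> 'rV[R]_(d + d) -> A) :
  (forall i, tame (F i)) -> tame (fun Y => \sum_(i <- r) c i *: F i Y) /\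
  double_integral (fun Y => \sum_(i <- r) c i *: F i Y) =
    \sum_(i <- r) c i *: double_integral (F i).
Proof.
move=> tF; elim: r => [|i r [tr IH]].
  rewrite big_nil (_ : (fun Y => _) = fun=> 0); last by apply/funext => Y; rewrite big_nil.
  by split; [exact: tame0|exact: double_integral0].
rewrite (_ : (fun Y => _) = c i *: F i + (fun Y => \sum_(i <- r) c i *: F i Y)); last first.
  by apply/funext => Y; rewrite big_cons !fctE.
split; first exact: tame_linear.
rewrite big_cons -IH; exact: (double_integral_linear (c i) (tF i) tr).
Qed.

End IntegralSums.

(** * Comparison with the defining integral *)

Section StarIntegral.
Context {R : realType} {A : frechetAlgType R} {k n : nat}.
Variables (a0 : R) (lambda kappa : R[i]).
Local Notation N := (n + (n + n))%N.
Local Notation body := 'rV[R]_(k + k).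
Local Notation body2 := 'rV[R]_((k + k) + (k + k)).
Local Notation xi0 := (fun i : 'I_n => gvar R[i] (odd_index0 i)).
Local Notation xi1 := (fun i : 'I_n => gvar R[i] (odd_index1 i)).
Local Notation xi2 := (fun i : 'I_n => gvar R[i] (odd_index2 i)).
Local Notation odd1 := [set odd_index1 i | i : 'I_n]%SET.
Local Notation odd2 := [set odd_index2 i | i : 'I_n]%SET.
Local Notation sets := ({set 'I_n} * {set 'I_n})%type.

Variable L : (body2 -> A) -> A.
Hypothesis L_linear : forall M b F G, tempered M F -> tempered M G ->
  L (b *: F + G) = b *: L F + L G.
Hypothesis L_integral : forall F, symb (fun Y => rho Y ^- 4) F ->
  L F = double_integral (phase_mul (quadratic_phase a0) F).

Definition shifted_coef (J : {set 'I_N}) (I : sets) : R[i] :=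
  odd_coef (fun i K => xi1 i K + xi0 i K) (fun i K => xi2 i K + xi0 i K)
    ((0 +i* (2 * a0)) * lambda) (omega1 xi1 xi2) I.1 I.2 J.

Definition ostar (f1 f2 : superfun A (k + k) n) : superfun A (k + k) n :=
  fun K y => kappa *: (top_sign K *:
    \sum_(I : sets) shifted_coef (top_set K) I *: twisted L (f1 I.1) (f2 I.2) y).

Lemma odd_product_pairE (c1 c2 : {set 'I_n} -> A) th1 th2 (phase : grassmann N R[i]) J :
  odd_product a0 lambda c1 c2 th1 th2 phase J = \sum_(I : sets)
    odd_coef th1 th2 ((0 +i* (2 * a0)) * lambda) phase I.1 I.2 J *: fmul (c1 I.1) (c2 I.2).
Proof. by rewrite odd_productE pair_bigA. Qed.

Lemma shifted_integrandE (f1 f2 : superfun A (k + k) n) y J :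
  shifted_integrand a0 lambda f1 f2 y J = fun _ => fun Y => \sum_(I : sets)
    shifted_coef J I *: translate (row_mx y y) (tensor (f1 I.1) (f2 I.2)) Y.
Proof.
apply/funext => U; apply/funext => Y; rewrite /shifted_integrand odd_product_pairE.
by apply: eq_bigr => I _; rewrite translate_tensor.
Qed.

Lemma L_sum M (r : seq sets) c (F : sets -> body2 -> A) : (forall I, tempered M (F I)) ->
  tempered M (fun Y => \sum_(I <- r) c I *: F I Y) /\
  L (fun Y => \sum_(I <- r) c I *: F I Y) = \sum_(I <- r) c I *: L (F I).
Proof.
move=> tF; have t0 : tempered M ((fun=> 0) : body2 -> A) by apply: symb0 => Y; exact: rhoX_ge0.
elim: r => [|i r [tr IH]].
  rewrite big_nil (_ : (fun Y => _) = fun=> 0); last by apply/funext => Y; rewrite big_nil.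
  split; [exact: t0|rewrite -[RHS](addNr (L (fun=> 0))) -scaleN1r -(L_linear (-1) t0 t0)].
  by congr L; apply/funext => Y; rewrite !fctE scaler0 addr0.
rewrite (_ : (fun Y => _) = c i *: F i + (fun Y => \sum_(i <- r) c i *: F i Y)); last first.
  by apply/funext => Y; rewrite big_cons !fctE.
split; first exact: tempered_linear.
rewrite big_cons -IH; exact: (L_linear (c i) (tF i) tr).
Qed.

Lemma ostar_shifted M (f1 f2 : superfun A (k + k) n) K y :
  (forall I, symb (fun y => rho y ^+ M) (f1 I)) ->
  (forall I, symb (fun y => rho y ^+ M) (f2 I)) ->
  ostar f1 f2 K y = kappa *: berezin odd1 (berezin odd2 (fun J =>
    L (shifted_integrand a0 lambda f1 f2 y J finset.set0)))
      [set odd_index0 i | i in K]%SET.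
Proof.
move=> s1 s2; rewrite berezin2E shifted_integrandE; congr (_ *: (_ *: _)).
rewrite (L_sum (M := M) _ _ _).2// => I.
by apply: tempered_translate; exact: tempered_tensor.
Qed.

Lemma symb_tensor4 (f g : body -> A) : symb (fun y => rho y ^- 4) f ->
  symb (fun y => rho y ^- 4) g -> symb (fun Y => rho Y ^- 4) (tensor f g).
Proof.
move=> sf sg; have m : moderate (fun y : body => rho y ^- 4) by exact/moderateV/moderateX/moderate_rho.
have E : (fun Y : body2 => rho (lsubmx Y) ^- 4 * rho (rsubmx Y) ^- 4) = fun Y => rho Y ^- 4.
  by apply/funext => Y; rewrite (rho_hsub Y) exprMn (invfM (rho (lsubmx Y) ^+ 4)).
by rewrite -E; exact: (symb_tensor m m sf sg).
Qed.

Lemma star_test (f1 f2 : superfun A (k + k) n) : a0 != 0 -> test_fun f1 -> test_fun f2 ->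
  star a0 lambda kappa f1 f2 = ostar f1 f2.
Proof.
move=> a00 t1 t2; apply/funext => K; apply/funext => y.
have s1 I : symb (fun y => rho y ^- 4) (f1 I) by apply: test_symb; [exact: (t1 I).1|exact: (t1 I).2].
have s2 I : symb (fun y => rho y ^- 4) (f2 I) by apply: test_symb; [exact: (t2 I).1|exact: (t2 I).2].
pose T I := translate (row_mx y y) (tensor (f1 I.1) (f2 I.2)).
have sT (I : sets) : symb (fun Y => rho Y ^- 4) (T I).
  by apply: symb_translate (symb_tensor4 _ _) => //; exact/moderateV/moderateX/moderate_rho.
(* The even part of the integrand in the original variables: the phase times the tensor product,
   translated back by [(y, y)]. *)
pose H (I : sets) := translate (- row_mx y y) (phase_mul (quadratic_phase a0) (T I)).
have tP I : tame (phase_mul (quadratic_phase a0) (T I)).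
  exact: (tame_phase (@phase_shift R k a0) (phase_unit a0) (rpow43 (sT I))).
have tH I : tame (H I) by exact: tame_translate.
pose c J (I : sets) := odd_coef xi1 xi2 ((0 +i* (2 * a0)) * lambda)
  (fun K => omega1 xi0 xi1 K + omega1 xi1 xi2 K + omega1 xi2 xi0 K) I.1 I.2 J.
have intE y1 y2 J : star_integrand a0 lambda f1 f2 y y1 y2 J =
    \sum_(I : sets) c J I *: H I (row_mx y1 y2).
  rewrite /star_integrand star_phase odd_product_pairE scaler_sumr; apply: eq_bigr => I _.
  rewrite scalerA mulrC -scalerA /H /translate /phase_mul /T /translate subrK.
  by rewrite /tensor row_mxKl row_mxKr.
pose G J (Y : body2) := \sum_(I : sets) c J I *: H I Y.
have tG J : tame (G J) by exact: (tame_sum (index_enum sets) (c J) tH).1.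
pose g (y1 : body) J := Defs.integral (fun y2 => G J (row_mx y1 y2)).
have inner y1 : superintegral odd2 (fun y2 => star_integrand a0 lambda f1 f2 y y1 y2) =
    berezin odd2 (g y1).
  rewrite /superintegral; congr berezin; apply/funext => J; congr Defs.integral.
  by apply/funext => y2; exact: intE.
rewrite /star /ostar; congr (kappa *: _).
have {}inner : (fun y1 => superintegral odd2 (fun y2 => star_integrand a0 lambda f1 f2 y y1 y2)) =
    fun y1 => berezin odd2 (g y1) by apply/funext => y1; exact: inner.
rewrite inner.
(* The Berezin integral over [odd2] only selects a coefficient and a sign, so it passes outside the
   integral over [y1]. *)
rewrite /superintegral (_ : (fun J => _) = berezin odd2 (fun J => Defs.integral (fun y1 => g y1 J))); last first.
  by apply: berezin_integral => J; exact: tame_outer (tG J).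
rewrite berezin2E; congr (_ *: _).
rewrite -[LHS]/(double_integral (G (top_set K))) (tame_sum (index_enum sets) _ tH).2.
(* The even variables are translated by invariance of the integral, the odd ones by
   [odd_coef_shift], as [top_set] contains both blocks [odd1] and [odd2]. *)
apply: eq_bigr => I _; rewrite (double_integral_translate _ (tP I)) -(L_integral (sT I)).
by rewrite /c (odd_coef_shift _ _ _ (sub_top_set K)).
Qed.

End StarIntegral.

(** * Weights and seminorm topologies *)

Section ProductPolynomials.
Context {R : realType} {d : nat}.
Implicit Types (q : 'I_d -> {poly R}) (Y : 'rV[R]_d).

(** A class of functions stable under partial derivatives, each of which differentiates one factor
    and raises no degree; it yields smooth weights with explicit derivatives. *)
Definition product_poly q Y : R := \prod_i (q i).[Y 0 i].

Lemma continuous_product_poly q : continuous (product_poly q).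
Proof.
rewrite /product_poly; elim: (index_enum _) => [|i r IH] Y.
  under eq_fun do rewrite big_nil.
  exact: cst_continuous.
under eq_fun do rewrite big_cons.
apply: (@continuousM R _ (fun Y : 'rV[R]_d => (q i).[Y 0 i])); last exact: IH.
apply: (@continuous_comp _ _ _ (fun Y : 'rV[R]_d => Y 0 i) (horner (q i))).
  exact: coord_continuous.
exact: continuous_horner.
Qed.

Lemma product_poly_cvg q i Y :
  h^-1 *: ((product_poly q \o shift Y) (h *: delta_mx 0 i) - product_poly q Y)
    @[h --> (0 : R)^'] --> product_poly (fun j => if j == i then (q i)^`() else q j) Y.
Proof.
pose c := \prod_(j | j != i) (q j).[Y 0 j].
have -> : product_poly (fun j => if j == i then (q i)^`() else q j) Y = c * (q i)^`().[Y 0 i].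
  rewrite /product_poly (bigD1 i)//= eqxx mulrC; congr (_ * _).
  by apply: eq_bigr => j /negPf ->.
have E (h : R) : h^-1 *: ((product_poly q \o shift Y) (h *: delta_mx 0 i) - product_poly q Y) =
    c *: (h^-1 *: ((horner (q i) \o shift (Y 0 i)) (h *: 1) - (q i).[Y 0 i])).
  rewrite /product_poly /= (bigD1 i)//= [X in _ - X](bigD1 i)//= !mxE !eqxx.
  rewrite (eq_bigr (fun j => (q j).[Y 0 j])) => [|j ji]; last first.
    by rewrite !mxE (negPf ji) mulr0 add0r.
  by rewrite -mulrBl mulrC -/c /GRing.scale /=; ring.
under eq_fun do rewrite E.
apply: cvgZr.
have [dq <-] := is_derive_poly (q i) (Y 0 i).
exact: dq.
Qed.

Lemma rsmooth_product_poly q : rsmooth (product_poly q) /\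
  forall s, exists q', foldr rpartial (product_poly q) s = product_poly q' /\
    forall i, (size (q' i) <= size (q i))%N.
Proof.
have dE q1 i : rpartial i (product_poly q1) =
    product_poly (fun j => if j == i then (q1 i)^`() else q1 j).
  apply/funext => Y; apply: cvg_lim; [exact: Rhausdorff|exact: product_poly_cvg].
have F s : exists q', foldr rpartial (product_poly q) s = product_poly q' /\
    forall i, (size (q' i) <= size (q i))%N.
  elim: s => [|i s [q' [IH sq]]] /=; first by exists q.
  exists (fun j => if j == i then (q' i)^`() else q' j); split; first by rewrite IH dE.
  move=> j; case: eqVneq => [->|_]; last exact: sq.
  apply: leq_trans (sq i); have [->|q0] := eqVneq (q' i) 0; first by rewrite deriv0.
  exact: ltnW (lt_size_deriv q0).
split=> // s /=; have [q' [-> _]] := F s; split; first exact: continuous_product_poly.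
by move=> i Y; apply/cvg_ex; eexists; exact: product_poly_cvg.
Qed.

End ProductPolynomials.

Section PolynomialWeights.
Context {R : realType} {d : nat}.
Implicit Types (y : 'rV[R]_d).

Lemma horner_le (p : {poly R}) M : (size p <= M.*2.+1)%N ->
  exists2 C, 0 <= C & forall t, `|p.[t]| <= C * (1 + t ^+ 2) ^+ M.
Proof.
move=> sp; exists (\sum_(i < size p) `|p`_i|) => [|t]; first exact: sumr_ge0.
rewrite horner_coef (le_trans (ler_norm_sum _ _ _))// mulr_suml; apply: ler_sum => i _.
rewrite normrM ler_wpM2l// normrX.
have iM : (i <= M.*2)%N by rewrite -ltnS (leq_trans (ltn_ord i)).
have t2 : 1 <= 1 + t ^+ 2 by rewrite lerDl sqr_ge0.
have [t1|t1] := leP `|t| 1; first by rewrite (le_trans (exprn_ile1 _ _ t1))// exprn_ege1.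
rewrite (@le_trans _ _ (`|t| ^+ M.*2))//; first by rewrite ler_weXn2l// ltW.
rewrite -mul2n exprM lerXn2r ?nnegrE ?sqr_ge0 ?addr_ge0 ?sqr_ge0//.
by rewrite -normrX ger0_norm ?sqr_ge0// lerDr.
Qed.

Definition sqr_poly M : {poly R} := (1 + 'X^2) ^+ M.

Lemma size_sqr_poly M : (size (sqr_poly M) <= M.*2.+1)%N.
Proof.
rewrite (leq_trans (size_poly_exp_leq _ _))// ltnS -mul2n leq_mul2r; apply/orP; right.
by rewrite addrC size_polyDl size_polyXn ?size_poly1.
Qed.

(** A smooth stand-in for powers of [rho], which is not differentiable on the coordinate
    hyperplanes, whereas [weight] asks for smoothness. *)
Definition power_weight M y : R := \prod_i (1 + y 0 i ^+ 2) ^+ M.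

Lemma power_weight_gt0 M y : 0 < power_weight M y.
Proof. by apply: prodr_gt0 => i _; rewrite exprn_gt0// ltr_pwDl ?sqr_ge0. Qed.

Lemma power_weightE M : power_weight M = product_poly (fun=> sqr_poly M).
Proof.
apply/funext => y; apply: eq_bigr => i _.
by rewrite /sqr_poly horner_exp !hornerE.
Qed.

Lemma rho_power_weight M y : rho y ^+ M <= 2 ^+ (d * M) * power_weight M y.
Proof.
have -> : 2 ^+ (d * M) * power_weight M y = \prod_(i < d) (2 * (1 + y 0 i ^+ 2)) ^+ M.
  under eq_bigr do rewrite exprMn.
  by rewrite big_split /= prodr_const card_ord -exprM mulnC.
rewrite /rho -prodrXl; apply: ler_prod => i _; rewrite exprn_ge0 ?addr_ge0//=.
rewrite lerXn2r ?nnegrE ?addr_ge0 ?mulr_ge0 ?addr_ge0 ?sqr_ge0//.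
have := sqr_ge0 (`|y 0 i| - 1); rewrite -(real_normK (num_real (y 0 i))).
move: `|_| (normr_ge0 (y 0 i)) => t t0; nra.
Qed.

Lemma power_weight_rho M y : power_weight M y <= rho y ^+ M.*2.
Proof.
rewrite /rho -prodrXl; apply: ler_prod => i _.
rewrite exprn_ge0 ?addr_ge0 ?sqr_ge0//= -mul2n exprM lerXn2r ?nnegrE ?sqr_ge0 ?addr_ge0 ?sqr_ge0//.
rewrite -(real_normK (num_real (y 0 i))).
move: `|_| (normr_ge0 (y 0 i)) => t t0; nra.
Qed.

Definition power_posnum M y : {posnum R} := PosNum (power_weight_gt0 M y).

Lemma weight_power M : weight (power_posnum M).
Proof.
rewrite /weight /=; have [sm F] := @rsmooth_product_poly R d (fun=> sqr_poly M).
rewrite -[X in rsmooth X]/(power_weight M) power_weightE; split=> // beta.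
have [s Es] : exists s, iter_deriv rpartial beta (product_poly (fun=> sqr_poly M)) =
    foldr rpartial (product_poly (fun=> sqr_poly M)) s.
  rewrite /iter_deriv; elim: (enum 'I_d) => [|i e [s es]]; first by exists [::].
  exists (nseq (beta i) i ++ s) => /=; rewrite es foldr_cat.
  by elim: (beta i) => //= n ->.
rewrite -[X in iter_deriv _ _ X]/(product_poly (fun=> sqr_poly M)) Es.
have [q [-> sq]] := F s.
have /choice[C HC] : forall i, exists C, 0 <= C /\ forall t, `|(q i).[t]| <= C * (1 + t ^+ 2) ^+ M.
  by move=> i; have [C C0 HC] := horner_le (leq_trans (sq i) (size_sqr_poly M)); exists C.
exists (\prod_i C i) => y; rewrite -power_weightE /power_weight -big_split /= normr_prod.
by apply: ler_prod => i _; rewrite normr_ge0 (HC i).2.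
Qed.

Lemma poly_bounded_power M C : exists P, forall y, C * power_weight M y = polyfun P y.
Proof.
exists (mpoly.mpolyC d C * \prod_i (1 + mpoly.mpolyX R (mpoly.mnm1 i) ^+ 2) ^+ M) => y.
rewrite /polyfun mpoly.mevalM mpoly.mevalC; congr (_ * _).
rewrite rmorph_prod; apply: eq_bigr => i _ /=.
by rewrite rmorphXn rmorphD rmorphXn /= mpoly.meval1 mpoly.mevalXU.
Qed.

Lemma polyfun_rho (P : mpoly.mpoly d R) :
  exists m, exists2 C, 0 <= C & forall y, `|polyfun P y| <= C * rho y ^+ m.
Proof.
have step (r : seq (mpoly.multinom d)) (c : mpoly.multinom d -> R) :
    exists m, exists2 C, 0 <= C & forall y,
    `|\sum_(k <- r) c k * \prod_i y 0 i ^+ k i| <= C * rho y ^+ m.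
  elim: r => [|k r [m [C C0 IH]]].
    by exists 0%N, 0 => // y; rewrite big_nil normr0 mul0r.
  pose e := \sum_i k i.
  have kb y : `|\prod_i y 0 i ^+ k i| <= rho y ^+ e.
    rewrite normr_prod /rho -prodrXl; apply: ler_prod => i _; rewrite normr_ge0 normrX /=.
    rewrite (@le_trans _ _ ((1 + `|y 0 i|) ^+ k i))//.
      by rewrite lerXn2r ?nnegrE ?addr_ge0// lerDr.
    by rewrite ler_weXn2l ?lerDl// /e (bigD1 i)//= leq_addr.
  exists (maxn e m), (`|c k| + C) => [|y]; first by rewrite addr_ge0.
  rewrite big_cons (le_trans (ler_normD _ _))// mulrDl lerD//.
    rewrite normrM ler_wpM2l// (le_trans (kb y))// ler_weXn2l ?rho_ge1// leq_maxl//.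
  rewrite (le_trans (IH y))// ler_wpM2l// ler_weXn2l ?rho_ge1// leq_maxr//.
have [m [C C0 H]] := step (mpoly.msupp P) (fun k => mpoly.mcoeff k P).
by exists m, C => // y; rewrite /polyfun mpoly.mevalE.
Qed.

End PolynomialWeights.

(** * Topologies generated by seminorms *)

Section SeminormTopology.
Context {R : realType} {E : preTopologicalLmodType R[i]} {J : Type}.
Implicit Types (p : J -> E -> \bar R) (x y z : E).
Local Open Scope ereal_scope.

(** Common interface of the spaces, whose topologies are generated by a subbase; [p] takes values in
    the extended reals, as the norms are suprema. *)
Definition seminorm_topology p :=
  [/\ @open E = [set \bigcup_(i in D') i |
        D' in subset^~ (finI_from (seminorm_balls p) id)],
      forall j x, 0 <= p j x, forall j, p j 0%R = 0 &
      forall j x y, p j (x + y)%R <= p j x + p j y].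

Lemma nbhs_seminorm_ball p j x (e : R) : seminorm_topology p -> (0 < e)%R ->
  nbhs x [set y | p j (y - x)%R < e%:E].
Proof.
move=> [op _ p0 _] e0; apply: open_nbhs_nbhs; split; last by rewrite /= subrr p0 lte_fin.
rewrite op; exists [set [set y | p j (y - x)%R < e%:E]]; last by rewrite bigcup_set1.
by move=> _ ->; apply: finI_from1; exists j, x, e.
Qed.

Lemma nbhs_seminorm_balls p (s : seq J) x (e : R) : seminorm_topology p -> (0 < e)%R ->
  nbhs x [set y | all (fun j => p j (y - x)%R < e%:E) s].
Proof.
move=> tp e0; elim: s => [|j s IH] /=; first by apply: filterS (filterT); [].
apply: filterS (filterI (nbhs_seminorm_ball j x tp e0) IH) => y /= [-> ->] //.
Qed.

(** The balls of the subbase have arbitrary centres [z]. One of radius [e'] containing [x] contains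
    the ball around [x] of radius [e' - p j (x - z)]. *)
Lemma nbhs_seminorm p x (U : set E) : seminorm_topology p -> nbhs x U ->
  exists s, exists2 e : R, (0 < e)%R &
  forall y, all (fun j => p j (y - x)%R < e%:E) s -> U y.
Proof.
move=> [op p0 p00 ptri]; rewrite nbhsE => -[V [oV Vx] VU].
move: oV; rewrite op => -[D' D'sub D'V].
move: Vx; rewrite -D'V => -[W D'W Wx].
have [r rballs rW] := D'sub _ D'W.
have WV y : (forall B, B \in r -> B y) -> U y.
  move=> H; apply: VU; rewrite -D'V; exists W => //; rewrite -rW => B /=; exact: H.
have {rW}xr B : B \in r -> B x by move: Wx; rewrite -rW => H Br; exact: H.
suff [s [e e0 He]] : exists s, exists2 e : R, (0 < e)%R & forall y,
    all (fun j => p j (y - x)%R < e%:E) s -> forall B, B \in (r : seq _) -> B y.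
  by exists s, e => // y /He H; apply: WV.
have {}rballs B : B \in (r : seq _) -> seminorm_balls p B.
  by move=> Br; have := rballs B Br; rewrite inE.
have {}xr B : B \in (r : seq _) -> B x by exact: xr.
elim: (r : seq _) rballs xr => [|B t IH] tb tx.
  by exists [::], 1%R.
have [||s [e e0 He]] := IH; [by move=> C Ct; apply: tb; rewrite inE Ct orbT|
  by move=> C Ct; apply: tx; rewrite inE Ct orbT|].
have Bt : B \in B :: t by rewrite inE eqxx.
have [j [z [e' [e'0 BE]]]] := tb _ Bt.
have := tx _ Bt; rewrite BE /= => xz.
have [a aE] : exists a, p j (x - z)%R = a%:E.
  exists (fine (p j (x - z)%R)); rewrite fineK// fin_numElt (lt_trans xz (ltry _)) andbT.
  exact: lt_le_trans (ltNyr 0%R) (p0 _ _).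
rewrite aE lte_fin in xz.
exists (j :: s), (Num.min e (e' - a))%R; first by rewrite lt_min e0 subr_gt0.
move=> y /= /andP[yj ys] C; rewrite inE => /orP[/eqP CB|Ct]; last first.
  apply: He Ct; apply: sub_all ys => k kx; apply: (lt_le_trans kx).
  by rewrite lee_fin ge_min lexx.
rewrite CB /= (_ : y - z = (y - x) + (x - z))%R; last by rewrite addrA subrK.
apply: (le_lt_trans (ptri _ _ _)); rewrite aE.
rewrite -lteBrDr// -EFinB; apply: (lt_le_trans yj).
by rewrite lee_fin ge_min lexx orbT.
Qed.

Lemma seminorms_bounded p (s : seq J) x : (forall j, p j x < +oo) -> (forall j, 0 <= p j x) ->
  exists2 B : R, (0 <= B)%R & all (fun j => p j x <= B%:E) s.
Proof.
move=> fin p0; elim: s => [|j s [B B0 HB]]; first by exists 0%R.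
have fj : p j x \is a fin_num.
  by rewrite fin_numElt fin andbT; exact: lt_le_trans (ltNyr 0%R) (p0 _).
exists (fine (p j x) + B)%R; first by rewrite addr_ge0// fine_ge0.
rewrite /= -[X in X <= _](fineK fj) lee_fin lerDl B0 /=; apply: sub_all HB => k kB.
by apply: (le_trans kB); rewrite lee_fin lerDr fine_ge0.
Qed.

End SeminormTopology.

Section BilinearContinuity.
Context {R : realType} {E1 E2 E3 : preTopologicalLmodType R[i]} {J1 J2 J3 : Type}.
Context (p1 : J1 -> E1 -> \bar R) (p2 : J2 -> E2 -> \bar R) (p3 : J3 -> E3 -> \bar R).
Local Open Scope ereal_scope.

(** Real bounds [b1], [b2] stand for the seminorms themselves, which avoids products of extended
    reals. *)
Definition bilinear_estimate (Phi : E1 -> E2 -> E3) := forall j, exists s1 s2, exists2 C : R,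
  (0 <= C)%R & forall f1 f2 (b1 b2 : R), (0 <= b1)%R -> (0 <= b2)%R ->
  all (fun i => p1 i f1 <= b1%:E) s1 -> all (fun i => p2 i f2 <= b2%:E) s2 ->
  p3 j (Phi f1 f2) <= (C * (b1 * b2))%:E.

Lemma bilinear_continuous (Phi : {bilinear E1 -> E2 -> E3}) :
  seminorm_topology p1 -> (forall j x, p1 j x < +oo) ->
  seminorm_topology p2 -> (forall j x, p2 j x < +oo) ->
  seminorm_topology p3 -> bilinear_estimate Phi ->
  continuous (fun f : E1 * E2 => Phi f.1 f.2).
Proof.
move=> t1 fin1 t2 fin2 t3 H [x y] U /= /(nbhs_seminorm t3)[s [e e0 sU]].
suff : nbhs (x, y) [set f | all (fun j => p3 j (Phi f.1 f.2 - Phi x y)%R < e%:E) s].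
  by apply: filterS => f /= /sU.
elim: s {sU U} => [|j s IH] /=; first by apply: filterS filterT.
suff Hj : nbhs (x, y) [set f | p3 j (Phi f.1 f.2 - Phi x y)%R < e%:E].
  by apply: filterS (filterI Hj IH) => f /= [-> ->].
have [s1 [s2 [C C0 HC]]] := H j; have [_ p10 _ _] := t1; have [_ p20 _ _] := t2.
have [B1 B10 HB1] := seminorms_bounded s1 (fin1^~ x) (p10^~ x).
have [B2 B20 HB2] := seminorms_bounded s2 (fin2^~ y) (p20^~ y).
(* Since [del <= 1], the three terms of the expansion of [Phi f g - Phi x y] around [(x, y)] add up
   to at most [del * C * (1 + B1 + B2)]; the last 1 makes the inequality strict. *)
pose Q := (C * (1 + B1 + B2) + 1)%R.
have Q0 : (0 < Q)%R by rewrite ltr_wpDl// mulr_ge0// !addr_ge0.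
pose del := Num.min 1%R (e / Q)%R.
have del0 : (0 < del)%R by rewrite lt_min ltr01 divr_gt0.
have del1 : (del <= 1)%R by rewrite ge_min lexx.
have deQ : (del * Q <= e)%R by rewrite -ler_pdivlMr// ge_min lexx orbT.
exists ([set f | all (fun i => p1 i (f - x)%R < del%:E) s1],
        [set f | all (fun i => p2 i (f - y)%R < del%:E) s2]).
  by split; exact: nbhs_seminorm_balls.
move=> [f g] /= [Hf Hg].
have lt_le (T : Type) (q : T -> \bar R) r : all (fun i => q i < del%:E) r -> all (fun i => q i <= del%:E) r.
  by apply: sub_all => i /ltW.
have -> : (Phi f g - Phi x y = Phi (f - x) (g - y) + (Phi (f - x) y + Phi x (g - y)))%R.
  have -> : Phi f g = Phi (f - x + x)%R (g - y + y)%R by rewrite !subrK.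
  by rewrite linearDl /= !linearDr /= !addrA addrK.
have [_ _ _ tri] := t3.
apply: (le_lt_trans (tri _ _ _)); apply: (@le_lt_trans _ _ (C * (del * del) + (C * (del * B2) + C * (B1 * del)))%:E).
  rewrite !EFinD; apply: leeD; first by apply: HC; [exact: ltW|exact: ltW|exact: lt_le|exact: lt_le].
  apply: (le_trans (tri _ _ _)); apply: leeD.
    by apply: HC; [exact: ltW|by []|exact: lt_le|by []].
  by apply: HC; [by []|exact: ltW|by []|exact: lt_le].
rewrite lte_fin (@lt_le_trans _ _ (del * Q)%R)// /Q.
have dd : (C * (del * del) <= C * del)%R by rewrite ler_wpM2l// ler_piMr// ltW.
by move: dd del0; nra.
Qed.

End BilinearContinuity.

Section SupNorms.
Context {R : realType} {A : frechetType R} {d n : nat}.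
Implicit Types (f : superfun A d n) (g u v : 'rV[R]_d -> R) (beta : 'I_d -> nat).

Lemma coef_norm_ge0 j beta f y : 0 <= coef_norm j beta f y.
Proof. by apply: sumr_ge0 => I _; exact: semi_ge0. Qed.

Lemma sup_norm_leP g j beta f b :
  (sup_norm g j beta f <= b%:E)%E <-> forall y, g y * coef_norm j beta f y <= b.
Proof.
split=> [fb y|fb]; last by apply: ge_ereal_sup => _ [y _ <-]; rewrite lee_fin.
by rewrite -lee_fin; apply: le_trans fb; apply: ereal_sup_ubound; exists y.
Qed.

Lemma sup_norm_ge0 g j beta f : (forall y, 0 <= g y) -> (0 <= sup_norm g j beta f)%E.
Proof.
move=> g0; apply: (@le_trans _ _ (g 0 * coef_norm j beta f 0)%:E).
  by rewrite lee_fin mulr_ge0// coef_norm_ge0.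
by apply: ereal_sup_ubound; exists 0.
Qed.

Lemma sup_norm_finP g j beta f : (forall y, 0 <= g y) -> (sup_norm g j beta f < +oo)%E ->
  exists2 b, 0 <= b & (sup_norm g j beta f <= b%:E)%E.
Proof.
move=> g0 fin; have s0 := sup_norm_ge0 j beta f g0.
exists (fine (sup_norm g j beta f)); first exact: fine_ge0.
by rewrite fineK// fin_numElt fin andbT; exact: lt_le_trans (ltNyr 0) s0.
Qed.

Lemma sup_norm0 g j beta : (forall y, 0 <= g y) -> sup_norm g j beta (0 : superfun A d n) = 0%E.
Proof.
move=> g0; apply/eqP; rewrite eq_le sup_norm_ge0// andbT; apply/sup_norm_leP => y.
by rewrite coef_norm0 mulr0.
Qed.

Lemma sup_normD g j beta f1 f2 : (forall y, 0 <= g y) -> supersmooth f1 -> supersmooth f2 ->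
  (sup_norm g j beta (f1 + f2)%R <= sup_norm g j beta f1 + sup_norm g j beta f2)%E.
Proof.
move=> g0 s1 s2; apply: ge_ereal_sup => _ [y _ <-].
have H : (g y * coef_norm j beta (f1 + f2) y <=
    g y * coef_norm j beta f1 y + g y * coef_norm j beta f2 y)%R.
  rewrite -mulrDr ler_wpM2l//; have := coef_norm_linear j beta 1 y s1 s2.
  by rewrite scale1r normr1 mul1r.
apply: (@le_trans _ _ (g y * coef_norm j beta f1 y + g y * coef_norm j beta f2 y)%:E).
  by rewrite lee_fin.
by rewrite EFinD leeD//; apply: ereal_sup_ubound; exists y.
Qed.

(** A word of length at most [K] has letter counts at most [K], so finitely many multi-indices
    suffice. The condition on [g * u] turns the multiplier [g] of the norm into the weight [u]. *)
Lemma derivs_le_sup_norm g u j K f b I : supersmooth f -> (forall y, 1 <= g y * u y) ->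
  (forall y, 0 <= u y) ->
  (forall beta : {ffun 'I_d -> 'I_K.+1}, (sup_norm g j (fun i => beta i) f <= b%:E)%E) ->
  derivs_le j K u b (f I).
Proof.
move=> sf gu u0 fb; apply/derivs_leP => s sK y; rewrite foldr_partial_iter//.
pose beta := [ffun i => inord (count_mem i s)] : {ffun 'I_d -> 'I_K.+1}.
have -> : (fun i => count_mem i s) = (fun i => beta i : nat).
  by apply/funext => i; rewrite ffunE inordK// ltnS (leq_trans (count_size _ _)).
have /sup_norm_leP/(_ y) H := fb beta.
have le1 : semi j (iter_deriv partial (fun i => beta i : nat) (f I) y) <=
    coef_norm j (fun i => beta i : nat) f y.
  by rewrite /coef_norm (bigD1 I)//= lerDl sumr_ge0// => ? _; exact: semi_ge0.
rewrite (le_trans le1)// (@le_trans _ _ (g y * u y * coef_norm j (fun i => beta i) f y))//.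
  by rewrite ler_peMl// coef_norm_ge0.
by rewrite mulrAC ler_wpM2r.
Qed.

Definition deriv_word beta : seq 'I_d := flatten [seq nseq (beta i) i | i <- enum 'I_d].

Lemma sup_norm_derivs_le g v j beta f B C : (forall y, 0 <= g y) ->
  (forall y, g y * v y <= C) -> 0 <= B ->
  (forall I, derivs_le j (size (deriv_word beta)) v B (f I)) ->
  (sup_norm g j beta f <= (#|{set 'I_n}|%:R * (B * C))%:E)%E.
Proof.
move=> g0 gv B0 H; apply/sup_norm_leP => y.
rewrite (@le_trans _ _ (g y * \sum_(I : {set 'I_n}) B * v y))//.
  rewrite ler_wpM2l// /coef_norm; apply: ler_sum => I _.
  by rewrite iter_derivE; have /derivs_leP := H I; apply.
rewrite sumr_const -[X in _ * X <= _]mulr_natl.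
rewrite [leLHS](_ : _ = #|{set 'I_n}|%:R * (B * (g y * v y))); last by ring.
by rewrite !ler_wpM2l.
Qed.

Lemma symb_sup_norm g u f I : supersmooth f -> (forall y, 0 <= g y) -> (forall y, 0 <= u y) ->
  (forall y, 1 <= g y * u y) ->
  (forall j beta, (sup_norm g j beta f < +oo)%E) -> symb u (f I).
Proof.
move=> sf g0 u0 gu fin; split=> [|s j]; first exact: sf.
have [b b0 /sup_norm_leP H] := sup_norm_finP g0 (fin j (fun i => count_mem i s)).
exists b => y; rewrite foldr_partial_iter//.
set beta := fun i => _.
have le1 : semi j (iter_deriv partial beta (f I) y) <= coef_norm j beta f y.
  by rewrite /coef_norm (bigD1 I)//= lerDl sumr_ge0// => ? _; exact: semi_ge0.
rewrite (le_trans le1)// (@le_trans _ _ (g y * u y * coef_norm j beta f y))//.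
  by rewrite ler_peMl// coef_norm_ge0.
by rewrite mulrAC ler_wpM2r.
Qed.

Lemma sup_norm_symb g v f j beta C : (forall y, 0 <= g y) -> (forall y, 0 <= v y) ->
  (forall y, g y * v y <= C) -> (forall I, symb v (f I)) -> (sup_norm g j beta f < +oo)%E.
Proof.
move=> g0 v0 gv sf.
have /choice[B HB] : forall I, exists B, 0 <= B /\ derivs_le j (size (deriv_word beta)) v B (f I).
  by move=> I; have [B B0 HB] := symb_derivs_le j (size (deriv_word beta)) v0 (sf I); exists B.
have B0 : 0 <= \sum_I B I by apply: sumr_ge0 => I _; exact: (HB I).1.
apply: (le_lt_trans (sup_norm_derivs_le g0 gv B0 _) (ltry _)) => I.
apply: derivs_le_weaken (HB I).2 => // y; rewrite ler_wpM2r// (bigD1 I)//= lerDl.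
by apply: sumr_ge0 => ? _; exact: (HB _).1.
Qed.

Lemma symbols_topology (mu' mu : 'rV[R]_d -> {posnum R}) :
  seminorm_topology (fun jb (f : symbols_for A n mu' mu) => symbol_norm mu' jb (val f)).
Proof.
have g0 (y : 'rV[R]_d) : 0 <= (mu' y)%:num^-1 by rewrite invr_ge0.
split=> [|jb f|jb|jb f1 f2] //; first by apply: sup_norm_ge0 => y.
  by rewrite raddf0; apply: sup_norm0 => y.
have sm (f : symbols_for A n mu' mu) : supersmooth (val f) by have := valP f; rewrite inE => -[].
have -> : val (f1 + f2)%R = (val f1 + val f2)%R by exact: raddfD.
by apply: sup_normD => // y.
Qed.

Lemma schwartz_topology :
  seminorm_topology (fun njb (f : schwartz A n) => schwartz_norm njb (val f : superfun A d n)).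
Proof.
split=> [|njb f|njb|njb f1 f2] //; first by apply: sup_norm_ge0 => y.
  by rewrite raddf0; apply: sup_norm0 => y.
have sm (f : schwartz A n) : supersmooth (val f : superfun A d n) by have := valP f; rewrite inE => -[].
have -> : val (f1 + f2)%R = (val f1 + val f2)%R by exact: raddfD.
by apply: sup_normD => // y.
Qed.

End SupNorms.

(** * Extension of the star product *)

Section DerivativeSums.
Context {R : realType} {A : frechetType R} {d : nat}.
Implicit Types (f : 'rV[R]_d -> A).

Lemma smooth_sum (T : Type) (r : seq T) (c : T -> R[i]) (F : T -> 'rV[R]_d -> A) :
  (forall i, smooth (F i)) -> smooth (fun y => \sum_(i <- r) c i *: F i y).
Proof.
move=> sF; elim: r => [|i r IH].
  by rewrite (_ : (fun y => _) = fun=> 0); [exact: smooth0|apply/funext => y; rewrite big_nil].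
rewrite (_ : (fun y => _) = c i *: F i + (fun y => \sum_(i <- r) c i *: F i y)); last first.
  by apply/funext => y; rewrite big_cons.
exact: smooth_linear.
Qed.

Lemma derivs_le_sum j K u B (T : Type) (r : seq T) (c : T -> R[i]) (F : T -> 'rV[R]_d -> A) :
  0 <= B -> (forall y, 0 <= u y) -> (forall i, smooth (F i)) -> (forall i, derivs_le j K u B (F i)) ->
  derivs_le j K u ((\sum_(i <- r) cmod (c i)) * B) (fun y => \sum_(i <- r) c i *: F i y).
Proof.
move=> B0 u0 sF H; elim: r => [|i r IH].
  rewrite big_nil mul0r (_ : (fun y => _) = fun=> 0); last by apply/funext => y; rewrite big_nil.
  by apply/derivs_leP => s _ y; rewrite foldr_partial0 semi0 mul0r.
rewrite (_ : (fun y => _) = c i *: F i + (fun y => \sum_(i <- r) c i *: F i y)); last first.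
  by apply/funext => y; rewrite big_cons.
rewrite big_cons mulrDl; exact: derivs_le_linear (sF i) (smooth_sum r c sF) (H i) IH.
Qed.

End DerivativeSums.

Section Growth.
Context {R : realType} {d : nat}.
Implicit Types (u v : 'rV[R]_d -> R).

(** [v] bounds the translates of [u], up to a polynomial growth in the translation that the
    oscillating integral absorbs. For a symbol weight, [v] can be a multiple of its associated
    weight; for the decay of Schwartz functions, [u] itself. *)
Definition growth M u v := (forall y, 0 <= v y) /\
  forall y y', u (y' + y) <= v y * rho y' ^+ M.

Lemma growth_le M M' u v : (M <= M')%N -> growth M u v -> growth M' u v.
Proof.
move=> MM [v0 H]; split=> // y y'; rewrite (le_trans (H y y'))// ler_wpM2l//.
by rewrite ler_weXn2l// rho_ge1.
Qed.

(** Peetre's inequality, from [rho y <= rho (y' + y) * rho y']. *)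
Lemma growth_rhoV m : growth m (fun y => rho y ^- m) (fun y => rho y ^- m).
Proof.
split=> [y|y y']; first by rewrite invr_ge0 exprn_ge0// ltW// rho_gt0.
rewrite -ler_pdivrMl ?invr_gt0 ?exprn_gt0 ?rho_gt0// invrK.
rewrite ler_pdivrMr ?exprn_gt0 ?rho_gt0// -exprMn lerXn2r ?nnegrE ?mulr_ge0 ?(ltW (rho_gt0 _))//.
by have := rhoD (y' + y) (- y'); rewrite rhoN {1}[y' + y]addrC addrK mulrC.
Qed.

Lemma growth_rho m C u : 0 <= C -> (forall y, u y <= C * rho y ^+ m) ->
  growth m u (fun y => C * rho y ^+ m).
Proof.
move=> C0 H; have r0 y : 0 <= rho y ^+ m by rewrite exprn_ge0// ltW// rho_gt0.
split=> [y|y y']; first by rewrite mulr_ge0// r0.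
rewrite (le_trans (H _))// -mulrA ler_wpM2l// -exprMn lerXn2r ?nnegrE ?mulr_ge0 ?(ltW (rho_gt0 _))//.
by rewrite mulrC rhoD.
Qed.

Lemma growth_symb (A : frechetType R) M u v (f : 'rV[R]_d -> A) :
  (forall y, 0 <= u y) -> growth M u v -> symb u f -> symb (fun y => rho y ^+ M) f.
Proof.
move=> u0 [v0 H]; apply: (symb_le (C := v 0)) => // y.
by have := H 0 y; rewrite addr0.
Qed.

End Growth.

Section StarEstimate.
Context {R : realType} {A : frechetAlgType R} {k n : nat}.
Variables (a0 : R) (lambda kappa : R[i]).
Local Notation body := 'rV[R]_(k + k).
Local Notation body2 := 'rV[R]_((k + k) + (k + k)).
Local Notation superf := (superfun A (k + k) n).
Local Notation tempered_super M f := (forall I, symb (fun y => rho y ^+ M) (f I)).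

Variable L : (body2 -> A) -> A.
Hypothesis L_linear : forall M b F G, tempered M F -> tempered M G ->
  L (b *: F + G) = b *: L F + L G.
Hypothesis L_bound : forall j M, exists K, exists2 C, 0 <= C &
  forall F B, tempered M F -> 0 <= B ->
  derivs_le j K (fun y => rho y ^+ M) B F -> semi j (L F) <= C * B.

Implicit Types (f : superf).
Local Notation star_L := (ostar a0 lambda kappa L).

Lemma ostar_sumE (f1 f2 : superf) U : star_L f1 f2 U = fun y =>
  \sum_(I : {set 'I_n} * {set 'I_n}) (kappa * (top_sign U * shifted_coef a0 lambda (top_set U) I)) *:
    twisted L (f1 I.1) (f2 I.2) y.
Proof.
apply/funext => y; rewrite /ostar !scaler_sumr; apply: eq_bigr => I _.
by rewrite !scalerA !mulrA.
Qed.

Lemma supersmooth_ostar M f1 f2 : tempered_super M f1 -> tempered_super M f2 ->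
  supersmooth (star_L f1 f2).
Proof.
move=> s1 s2 U; rewrite ostar_sumE; apply: smooth_sum => I.
exact: symb_smooth (symb_twisted L_linear L_bound (s1 I.1) (s2 I.2)).
Qed.

Lemma ostar_linearl M c f1 f1' f2 : tempered_super M f1 -> tempered_super M f1' ->
  tempered_super M f2 -> star_L (c *: f1 + f1') f2 = c *: star_L f1 f2 + star_L f1' f2.
Proof.
move=> s1 s1' s2; apply/funext => U; apply/funext => y.
rewrite -[RHS]/(c *: star_L f1 f2 U y + star_L f1' f2 U y) !ostar_sumE.
rewrite scaler_sumr -big_split /=; apply: eq_bigr => I _.
rewrite -[(c *: f1 + f1') I.1]/(c *: f1 I.1 + f1' I.1).
rewrite (twisted_linearl L_linear c (s1 I.1) (s1' I.1) (s2 I.2)) !fctE scalerDr !scalerA.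
by rewrite [c * _]mulrC.
Qed.

Lemma ostar_linearr M c f1 f2 f2' : tempered_super M f1 -> tempered_super M f2 ->
  tempered_super M f2' -> star_L f1 (c *: f2 + f2') = c *: star_L f1 f2 + star_L f1 f2'.
Proof.
move=> s1 s2 s2'; apply/funext => U; apply/funext => y.
rewrite -[RHS]/(c *: star_L f1 f2 U y + star_L f1 f2' U y) !ostar_sumE.
rewrite scaler_sumr -big_split /=; apply: eq_bigr => I _.
rewrite -[(c *: f2 + f2') I.2]/(c *: f2 I.2 + f2' I.2).
rewrite (twisted_linearr L_linear c (s1 I.1) (s2 I.2) (s2' I.2)) !fctE scalerDr !scalerA.
by rewrite [c * _]mulrC.
Qed.

(** [g1], [g2], [g3] are the multipliers in the norms of the two factors and of the product. The
    bounds [1 <= g * u] convert norms of the factors into weights [u1], [u2], and [C3] converts the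
    weight [v1 * v2] of the product back into a norm. *)
Lemma star_estimate (g1 g2 g3 u1 u2 v1 v2 : body -> R) M C3 j beta :
  (forall y, 0 <= g3 y) -> (forall y, 0 <= u1 y) -> (forall y, 0 <= u2 y) ->
  (forall y, 1 <= g1 y * u1 y) -> (forall y, 1 <= g2 y * u2 y) ->
  (forall y, g3 y * (v1 y * v2 y) <= C3) -> growth M u1 v1 -> growth M u2 v2 ->
  exists J K, exists2 C, 0 <= C & forall (f1 f2 : superf) b1 b2, 0 <= b1 -> 0 <= b2 ->
  supersmooth f1 -> supersmooth f2 -> tempered_super M f1 -> tempered_super M f2 ->
  (forall (i : 'I_J.+1) (beta : {ffun 'I_(k + k) -> 'I_K.+1}),
    (sup_norm g1 i (fun x => beta x) f1 <= b1%:E)%E) ->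
  (forall (i : 'I_J.+1) (beta : {ffun 'I_(k + k) -> 'I_K.+1}),
    (sup_norm g2 i (fun x => beta x) f2 <= b2%:E)%E) ->
  (sup_norm g3 j beta (star_L f1 f2) <= (C * (b1 * b2))%:E)%E.
Proof.
move=> g30 u10 u20 gu1 gu2 g3v [v10 gr1] [v20 gr2].
have [J [K [C C0 H]]] := twisted_bound L_linear L_bound j (size (deriv_word beta)) M.
pose c U (I : {set 'I_n} * {set 'I_n}) :=
  kappa * (top_sign U * shifted_coef a0 lambda (top_set U) I).
(* The sum over all [U] makes the constant independent of the coefficient of the product. *)
pose D := \sum_U \sum_I cmod (c U I).
have D0 : 0 <= D by rewrite !sumr_ge0// => U _; rewrite sumr_ge0// => I _; exact: cmod_ge0.
have C30 : 0 <= C3 by rewrite (le_trans _ (g3v 0))// !mulr_ge0.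
exists J, K, (#|{set 'I_n}|%:R * (D * C * C3)); first by rewrite !mulr_ge0.
move=> f1 f2 b1 b2 b10 b20 sf1 sf2 t1 t2 H1 H2.
have B0 : 0 <= D * (C * (b1 * b2)) by rewrite !mulr_ge0.
have -> : #|{set 'I_n}|%:R * (D * C * C3) * (b1 * b2) =
  #|{set 'I_n}|%:R * (D * (C * (b1 * b2)) * C3) by ring.
apply: (sup_norm_derivs_le g30 g3v B0) => U; rewrite ostar_sumE.
have tw I : derivs_le j (size (deriv_word beta)) (fun y => v1 y * v2 y) (C * (b1 * b2))
    (twisted L (f1 I.1) (f2 I.2)).
  apply: (H u1 v1 u2 v2) => // i iJ.
    by apply: (derivs_le_sup_norm _ sf1 gu1 u10) => b; exact: (H1 (Ordinal (iJ : (i < J.+1)%N))).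
  by apply: (derivs_le_sup_norm _ sf2 gu2 u20) => b; exact: (H2 (Ordinal (iJ : (i < J.+1)%N))).
have v0 y : 0 <= v1 y * v2 y by rewrite mulr_ge0.
have st I : smooth (twisted L (f1 I.1) (f2 I.2)).
  exact: symb_smooth (symb_twisted L_linear L_bound (t1 I.1) (t2 I.2)).
apply: derivs_le_weaken (derivs_le_sum (index_enum _) (c U) _ v0 st tw) => //; last first.
  by rewrite !mulr_ge0.
move=> y; rewrite ler_wpM2r// ler_wpM2r// ?mulr_ge0// /D (bigD1 U)//= lerDl.
by rewrite sumr_ge0// => V _; rewrite sumr_ge0// => I _; exact: cmod_ge0.
Qed.

End StarEstimate.

Section Packing.
Variable K : pzRingType.

Lemma linear_pack (U V : lmodType K) (f : U -> V) : linear f ->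
  exists g : {linear U -> V}, forall x, g x = f x.
Proof.
move=> lf; pose g : {linear U -> V} :=
  HB.pack_for {linear U -> V} f (GRing.isLinear.Build K U V *:%R f lf).
by exists g.
Qed.
End Packing.

Section BPacking.
Variable K : nzRingType.

Lemma bilinear_pack (U U' V : lmodType K) (f : U -> U' -> V) :
  (forall c x x' y, f (c *: x + x') y = c *: f x y + f x' y) ->
  (forall c x y y', f x (c *: y + y') = c *: f x y + f x y') ->
  exists g : {bilinear U -> U' -> V}, forall x y, g x y = f x y.
Proof.
move=> fl fr.
have bf : bilinear_for *:%R *:%R f by split=> [y c x x'|x c y y']; [exact: fl|exact: fr].
pose g : {bilinear U -> U' -> V} := HB.pack_for {bilinear U -> U' -> V} f
  (bilinear_isBilinear.Build K U U' V *:%R *:%R f bf).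
by exists g.
Qed.
End BPacking.

Section OscillatingFunctional.
Context {R : realType} {A : frechetAlgType R} {k : nat} (a0 : R).
Local Notation body2 := 'rV[R]_((k + k) + (k + k)).

Lemma oscillating_functional : a0 != 0 -> exists L : (body2 -> A) -> A,
  [/\ forall M b F G, tempered M F -> tempered M G -> L (b *: F + G) = b *: L F + L G,
      forall j M, exists K, exists2 C, 0 <= C & forall F B, tempered M F -> 0 <= B ->
        derivs_le j K (fun y => rho y ^+ M) B F -> semi j (L F) <= C * B &
      forall F, symb (fun Y => rho Y ^- 4) F ->
        L F = double_integral (phase_mul (quadratic_phase a0) F)].
Proof.
move=> a00; have sh := @phase_shift R k a0; have un := @phase_unit R k a0.
have c0 (j : 'I_((k + k) + (k + k))) := dual_slope_neq0 j a00.
have si := @dual_coord_inj k; have sn := @dual_coord_neq k.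
exists (osc (quadratic_phase a0) dual_coord (dual_slope a0)); split.
- exact: (osc_linear sh un c0 si sn).
- exact: (osc_bound sh un c0 si sn).
- exact: (osc_integral sh un c0 si sn).
Qed.

End OscillatingFunctional.

(** * Spaces defined by weighted supremum norms *)

Section SeminormedSpaces.
Context {R : realType} {A : frechetType R} {d n : nat}.
Local Notation superf := (superfun A d n).
Context {E : preTopologicalLmodType R[i]} {J : Type}.
Implicit Types (v : E -> superf) (g : J -> ('rV[R]_d -> R) * nat * ('I_d -> nat)).

Definition weighted_norm g j (f : superf) := sup_norm (g j).1.1 (g j).1.2 (g j).2 f.

(** Lets [symbols] and [schwartz] be treated at once: [v] embeds the space into the superfunctions,
    and [g] lists the multiplier, the seminorm and the multi-index of each norm. *)
Definition weighted_space v g :=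
  [/\ linear v, injective v, forall j y, 0 <= (g j).1.1 y,
      seminorm_topology (fun j f => weighted_norm g j (v f)) &
      forall h, (exists f, v f = h) <->
        supersmooth h /\ forall j, (weighted_norm g j h < +oo)%E].

(** A multiplier [G] that occurs with every seminorm and every multi-index forces the weight [u] on
    the elements of the space. A symbol space controls its own weight, the Schwartz space every
    [rho ^- m]. *)
Definition controls g (u : 'rV[R]_d -> R) := (forall y, 0 <= u y) /\
  exists2 G, (forall i beta, exists j, g j = (G, i, beta)) & forall y, 1 <= G y * u y.

Lemma controls_tempered v g u w M f I : weighted_space v g -> controls g u ->
  growth M u w -> symb (fun y => rho y ^+ M) (v f I).
Proof.
move=> [_ _ g0 _ vE] [u0 [G gE Gu]] gr; apply: (growth_symb u0 gr).
have [sf fin] : supersmooth (v f) /\ forall j, (weighted_norm g j (v f) < +oo)%E.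
  by apply/vE; exists f.
have G0 y : 0 <= G y by have [j gj] := gE 0%N (fun=> 0%N); have := g0 j y; rewrite gj.
apply: (symb_sup_norm _ sf G0 u0 Gu) => i beta.
by have [j gj] := gE i beta; have := fin j; rewrite /weighted_norm gj.
Qed.

Lemma controls_list g G N K : (forall i beta, exists j, g j = (G, i, beta)) ->
  exists s, forall (f : superf) b, all (fun j => (weighted_norm g j f <= b%:E)%E) s ->
  forall (i : 'I_N.+1) (beta : {ffun 'I_d -> 'I_K.+1}), (sup_norm G i (fun x => beta x) f <= b%:E)%E.
Proof.
move=> gE.
have /choice[sel selE] : forall p : nat * ('I_d -> nat), exists j, g j = (G, p.1, p.2).
  by move=> [i beta]; exact: gE.
exists [seq sel (p.1 : nat, fun x => p.2 x : nat) | p : 'I_N.+1 * {ffun 'I_d -> 'I_K.+1}].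
move=> f b; rewrite all_map => /allP H i beta.
by have := H (i, beta) (mem_enum _ _); rewrite /= /weighted_norm selE.
Qed.

End SeminormedSpaces.

Section StarExtension.
Context {R : realType} {A : frechetAlgType R} {k n : nat}.
Variables (a0 : R) (lambda kappa : R[i]).
Local Notation body := 'rV[R]_(k + k).
Local Notation body2 := 'rV[R]_((k + k) + (k + k)).
Local Notation superf := (superfun A (k + k) n).
Local Notation norm_index := ((body -> R) * nat * ('I_(k + k) -> nat))%type.

Variable L : (body2 -> A) -> A.
Hypothesis L_linear : forall M b F G, tempered M F -> tempered M G ->
  L (b *: F + G) = b *: L F + L G.
Hypothesis L_bound : forall j M, exists K, exists2 C, 0 <= C &
  forall F B, tempered M F -> 0 <= B ->
  derivs_le j K (fun y => rho y ^+ M) B F -> semi j (L F) <= C * B.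
Hypothesis L_integral : forall F, symb (fun Y => rho Y ^- 4) F ->
  L F = double_integral (phase_mul (quadratic_phase a0) F).

Local Notation star_L := (ostar a0 lambda kappa L).

(** The weights may depend on the norm [j] of the target: a Schwartz norm with a polynomial
    multiplier of high degree demands more decay from a Schwartz factor. *)
Lemma star_extension (E1 E2 E3 : preTopologicalLmodType R[i]) (J1 J2 J3 : Type)
    (v1 : E1 -> superf) (v2 : E2 -> superf) (v3 : E3 -> superf)
    (g1 : J1 -> norm_index) (g2 : J2 -> norm_index) (g3 : J3 -> norm_index) (j0 : J3) :
  weighted_space v1 g1 -> weighted_space v2 g2 -> weighted_space v3 g3 ->
  (forall j, exists u1 w1 u2 w2 M C, [/\ controls g1 u1, controls g2 u2,
     growth M u1 w1, growth M u2 w2 & forall y, (g3 j).1.1 y * (w1 y * w2 y) <= C]) ->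
  exists star : {bilinear E1 -> E2 -> E3},
    (forall f1 f2, v3 (star f1 f2) = star_L (v1 f1) (v2 f2)) /\
    continuous (fun f : E1 * E2 => star f.1 f.2).
Proof.
move=> ws1 ws2 ws3 H.
have [v1l _ _ top1 v1E] := ws1; have [v2l _ _ top2 v2E] := ws2.
have [v3l v3i g30 top3 v3E] := ws3.
(* The norm [j0] of the target provides weights, from which a common growth exponent is read off. *)
have [M [t1 t2]] : exists M, (forall f I, symb (fun y => rho y ^+ M) (v1 f I)) /\
    (forall f I, symb (fun y => rho y ^+ M) (v2 f I)).
  have [u1 [w1 [u2 [w2 [M [C [c1 c2 gr1 gr2 _]]]]]]] := H j0.
  by exists M; split=> f I; [exact: (controls_tempered f I ws1 c1 gr1)|exact: (controls_tempered f I ws2 c2 gr2)].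
have m1 f : supersmooth (v1 f) /\ forall j, (weighted_norm g1 j (v1 f) < +oo)%E.
  by apply/v1E; exists f.
have m2 f : supersmooth (v2 f) /\ forall j, (weighted_norm g2 j (v2 f) < +oo)%E.
  by apply/v2E; exists f.
have est j : exists s1 s2, exists2 C : R, 0 <= C & forall f1 f2 (b1 b2 : R), 0 <= b1 -> 0 <= b2 ->
    all (fun i => (weighted_norm g1 i (v1 f1) <= b1%:E)%E) s1 ->
    all (fun i => (weighted_norm g2 i (v2 f2) <= b2%:E)%E) s2 ->
    (weighted_norm g3 j (star_L (v1 f1) (v2 f2)) <= (C * (b1 * b2))%:E)%E.
  have [u1 [w1 [u2 [w2 [N [C [c1 c2 gr1 gr2 HC]]]]]]] := H j.
  have st1 f I : symb (fun y => rho y ^+ N) (v1 f I) by exact: (controls_tempered f I ws1 c1 gr1).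
  have st2 f I : symb (fun y => rho y ^+ N) (v2 f I) by exact: (controls_tempered f I ws2 c2 gr2).
  have [u10 [G1 G1E Gu1]] := c1; have [u20 [G2 G2E Gu2]] := c2.
  have [J [K [B B0 HB]]] := star_estimate (n := n) a0 lambda kappa L_linear L_bound (g3 j).1.2 (g3 j).2
    (g30 j) u10 u20 Gu1 Gu2 HC gr1 gr2.
  have [s1 Hs1] := controls_list (A := A) (n := n) J K G1E.
  have [s2 Hs2] := controls_list (A := A) (n := n) J K G2E.
  exists s1, s2, B => // f1 f2 b1 b2 b10 b20 H1 H2.
  apply: (HB _ _ _ _ b10 b20 (m1 f1).1 (m2 f2).1 (st1 f1) (st2 f2)); first exact: Hs1.
  exact: Hs2.
have fin (f1 : E1) (f2 : E2) j : (weighted_norm g3 j (star_L (v1 f1) (v2 f2)) < +oo)%E.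
  have [s1 [s2 [C C0 HC]]] := est j.
  have [_ p10 _ _] := top1; have [_ p20 _ _] := top2.
  have [b1 b10 Hb1] := seminorms_bounded (p := fun j f => weighted_norm g1 j (v1 f)) s1 ((m1 f1).2) (p10^~ f1).
  have [b2 b20 Hb2] := seminorms_bounded (p := fun j f => weighted_norm g2 j (v2 f)) s2 ((m2 f2).2) (p20^~ f2).
  exact: le_lt_trans (HC f1 f2 b1 b2 b10 b20 Hb1 Hb2) (ltry _).
have /choice[st stE] : forall p : E1 * E2, exists f, v3 f = star_L (v1 p.1) (v2 p.2).
  move=> [f1 f2]; apply/v3E; split; last exact: fin.
  exact: (supersmooth_ostar a0 lambda kappa L_linear L_bound (t1 f1) (t2 f2)).
have [||star starE] := @bilinear_pack R[i] E1 E2 E3 (fun f1 f2 => st (f1, f2)).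
- move=> c f1 f1' f2; apply: v3i; rewrite v3l !stE /= v1l.
  exact: (ostar_linearl a0 lambda kappa L_linear c (t1 f1) (t1 f1') (t2 f2)).
- move=> c f1 f2 f2'; apply: v3i; rewrite v3l !stE /= v2l.
  exact: (ostar_linearr a0 lambda kappa L_linear c (t1 f1) (t2 f2) (t2 f2')).
exists star; split=> [f1 f2|]; first by rewrite starE stE.
apply: (bilinear_continuous top1 _ top2 _ top3) => [j f|j f|j].
- exact: (m1 f).2.
- exact: (m2 f).2.
have [s1 [s2 [C C0 HC]]] := est j; exists s1, s2, C => // f1 f2 b1 b2 b10 b20 H1 H2.
by rewrite starE stE; exact: HC.
Qed.

End StarExtension.

Section Oscillation.
Context {R : realType} {A : frechetAlgType R} {k n : nat}.
Variables (a0 : R) (lambda kappa : R[i]).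
Local Notation body := 'rV[R]_(k + k).
Local Notation body2 := 'rV[R]_((k + k) + (k + k)).
Local Notation D := ((k + k) + (k + k))%N.
Local Notation superf := (superfun A (k + k) n).

Variable L : (body2 -> A) -> A.
Hypothesis L_linear : forall M b F G, tempered M F -> tempered M G ->
  L (b *: F + G) = b *: L F + L G.
Hypothesis L_bound : forall j M, exists K, exists2 C, 0 <= C &
  forall F B, tempered M F -> 0 <= B ->
  derivs_le j K (fun y => rho y ^+ M) B F -> semi j (L F) <= C * B.
Hypothesis L_integral : forall F, symb (fun Y => rho Y ^- 4) F ->
  L F = double_integral (phase_mul (quadratic_phase a0) F).

Lemma symbols_symb (mu mu' : body2 -> {posnum R}) (F : symbols_for A 0 mu' mu) I :
  symb (fun Y => (mu Y)%:num) (val F I).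
Proof.
have := valP F; rewrite inE => -[sF fin].
apply: (symb_sup_norm (g := fun Y => (mu Y)%:num^-1)) => // [Y|j beta].
  by rewrite mulVf.
exact: fin (j, beta).
Qed.

(** The exponent [M] is taken from [mu'], which defines the topology; [mu <= mu'] puts the elements
    of the space among the functions of growth [rho ^+ M]. *)
Lemma continuous_symbols (mu mu' : body2 -> {posnum R}) (Lm : {linear symbols A 0 mu -> A}) :
  (forall F, Lm F = L (val F finset.set0)) -> (forall Y, (mu Y)%:num <= (mu' Y)%:num) ->
  poly_bounded mu' -> continuous (Lm : symbols_for A 0 mu' mu -> A).
Proof.
move=> LmE mm [P muP] F0 U /nbhs_semi[N [e [e0 HU]]].
have [M [C C0 HC]] := polyfun_rho P.
have mr Y : (mu' Y)%:num <= C * rho Y ^+ M.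
  by rewrite (le_trans (muP Y))// (le_trans (ler_norm _)).
have tF (F : symbols_for A 0 mu' mu) : tempered M (val F finset.set0).
  apply: symb_le (symbols_symb F finset.set0) => Y //.
  by rewrite (le_trans (mm Y)).
suff H j : nbhs F0 [set F : symbols_for A 0 mu' mu | semi j (Lm F - Lm F0) < e].
  suff : nbhs F0 [set F : symbols_for A 0 mu' mu | forall j, (j <= N)%N -> semi j (Lm F - Lm F0) < e].
    by apply: filterS => F /= ?; exact: HU.
  elim: N {HU} => [|N IH]; first by apply: filterS (H 0%N) => F /= H0 j; rewrite leqn0 => /eqP ->.
  apply: filterS (filterI (H N.+1) IH) => F /= [HN HF] j.
  by rewrite leq_eqVlt => /orP[/eqP ->//|]; exact: HF.
have [K [B B0 HB]] := L_bound j M.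
pose b := e / (B * C + 1) / 2.
have BC : 0 < B * C + 1 by rewrite ltr_wpDl// mulr_ge0.
have b0 : 0 < b by rewrite !divr_gt0.
pose s := [seq (j, fun x => beta x : nat) | beta : {ffun 'I_D -> 'I_K.+1}].
have := nbhs_seminorm_balls s F0 (symbols_topology mu' mu) b0.
apply: filterS => F /= /allP Hs.
have dE : val (F - F0) finset.set0 = (-1) *: val F0 finset.set0 + val F finset.set0.
  have -> : val (F - F0) = val F - val F0 by exact: raddfB.
  by apply/funext => Y; rewrite !fctE scaleN1r addrC.
rewrite !LmE -[X in semi j X](_ : L (val (F - F0) finset.set0) = _); last first.
  by rewrite dE (L_linear (-1) (tF F0) (tF F)) scaleN1r addrC.
have HD : derivs_le j K (fun Y => rho Y ^+ M) (b * C) (val (F - F0) finset.set0).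
  apply: (derivs_le_weaken (leqnn K) (u := fun Y => (mu' Y)%:num) (B := b)).
    by move=> Y; rewrite -(mulrA b C) ler_wpM2l// ltW.
  have := valP (F - F0); rewrite inE => -[sF _].
  apply: (derivs_le_sup_norm finset.set0 sF (g := fun Y => (mu' Y)%:num^-1)) => // [Y|beta].
    by rewrite mulVf.
  by apply/ltW/(Hs (j, fun x => beta x : nat)); rewrite map_f// mem_enum.
rewrite (le_lt_trans (HB _ _ (tF (F - F0)) _ HD))//; first by rewrite mulr_ge0// ltW.
have E : B * (b * C) = b * (B * C) by ring.
have be : b * (B * C + 1) = e / 2 by rewrite /b mulrAC divfK// gt_eqF.
by rewrite E; move: be b0 e0; rewrite mulrDr mulr1; lra.
Qed.

Lemma oscillating_ostar M (f1 f2 : superf) :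
  (forall I, symb (fun y => rho y ^+ M) (f1 I)) ->
  (forall I, symb (fun y => rho y ^+ M) (f2 I)) ->
  oscillating_star a0 lambda kappa f1 f2 (ostar a0 lambda kappa L f1 f2).
Proof.
(* One weight serves all [y] and [J]: the shifted integrands grow at most like [rho ^+ M], which a
   multiple of this smooth weight dominates. *)
move=> s1 s2; pose mu : body2 -> {posnum R} := power_posnum M.
have tF (F : symbols A 0 mu) : tempered M.*2 (val F finset.set0).
  apply: (symb_le (C := 1) _ _ (symbols_symb F finset.set0)) => Y; last by [].
  by rewrite mul1r; exact: power_weight_rho.
have [|Lm LmE] := @linear_pack R[i] (symbols A 0 mu) A (fun F => L (val F finset.set0)).
  by move=> c F G; exact: (L_linear c (tF F) (tF G)).
have mem y J : shifted_integrand a0 lambda f1 f2 y J \in symbol_set mu.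
  have tS : tempered M (fun Y => \sum_(I : {set 'I_n} * {set 'I_n}) shifted_coef a0 lambda J I *:
      translate (row_mx y y) (tensor (f1 I.1) (f2 I.2)) Y).
    apply: (L_sum (M := M) L_linear _ _ _).1 => I.
    by apply: tempered_translate; exact: tempered_tensor.
  rewrite inE shifted_integrandE; split=> [I|[j beta]]; first exact: symb_smooth tS.
  have r0 (Y : body2) : 0 <= rho Y ^+ M by exact: rhoX_ge0.
  apply: (sup_norm_symb _ _ _ r0 (C := 2 ^+ (D * M))) => // Y.
  rewrite mulrC ler_pdivrMr//; exact: rho_power_weight.
exists mu, Lm, (fun y J => exist (fun f => f \in symbol_set mu) _ (mem y J)); split=> //.
- exact: weight_power.
- have [P HP] := @poly_bounded_power R D M 1; by exists P => Y; rewrite -HP mul1r.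
- split=> [F tF0|mu' wmu' pmu' mm _].
    rewrite LmE L_integral//.
    have [sF cF] := tF0 finset.set0; exact: test_symb.
  by apply: (continuous_symbols LmE _ pmu') => Y; exact: ltW.
- move=> K y; rewrite (ostar_shifted a0 lambda kappa L_linear _ _ s1 s2); congr (_ *: berezin _ (berezin _ _) _).
  by apply/funext => J; rewrite LmE.
Qed.

End Oscillation.

Section ConcreteSpaces.
Context {R : realType} {A : frechetType R} {d n : nat}.
Implicit Types (mu mut : 'rV[R]_d -> {posnum R}).

Definition symbol_index mu (jb : nat * ('I_d -> nat)) :=
  (fun y => (mu y)%:num^-1, jb.1, jb.2).

Definition schwartz_index (njb : mpoly.mpoly d R * nat * ('I_d -> nat)) :=
  (fun y => `|polyfun njb.1.1 y|, njb.1.2, njb.2).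

Lemma symbols_space mu :
  weighted_space (fun f : symbols A n mu => val f) (symbol_index mu).
Proof.
split=> [c f g|f g fg|j y|| h] /=.
- by [].
- exact: val_inj.
- by rewrite invr_ge0.
- exact: symbols_topology.
- split=> [[f <-]|sh]; first by have := valP f; rewrite inE.
  have mh : h \in symbol_set mu by rewrite inE.
  by exists (exist (fun f => f \in symbol_set mu) h mh).
Qed.

Lemma schwartz_space :
  weighted_space (fun f : schwartz A n => val f : superfun A d n) schwartz_index.
Proof.
split=> [c f g|f g fg|j y|| h] /=.
- by [].
- exact: val_inj.
- by [].
- exact: schwartz_topology.
- split=> [[f <-]|sh]; first by have := valP f; rewrite inE.
  have mh : h \in @schwartz_set R A d n by rewrite inE.
  by exists (exist (fun f => f \in schwartz_set) h mh).
Qed.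

Lemma symbol_controls mu : controls (symbol_index mu) (fun y => (mu y)%:num).
Proof.
split=> //; exists (fun y => (mu y)%:num^-1) => [i beta|y]; first by exists (i, beta).
by rewrite mulVf.
Qed.

(** The multiplier is a polynomial above [rho ^+ m]; the factor [2 ^+ (d * m)] is that of
    [rho_power_weight]. *)
Lemma schwartz_controls m : controls schwartz_index (fun y => rho y ^- m).
Proof.
split=> [y|]; first by rewrite invr_ge0 exprn_ge0// ltW// rho_gt0.
have [P HP] := @poly_bounded_power R d m (2 ^+ (d * m)).
exists (fun y => `|polyfun P y|) => [i beta|y]; first by exists (P, i, beta).
rewrite ler_pdivlMr ?exprn_gt0 ?rho_gt0// mul1r -HP.
exact: le_trans (rho_power_weight m y) (ler_norm _).
Qed.

Lemma poly_bounded_rho mu : poly_bounded mu ->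
  exists m, exists2 C, 0 <= C & forall y, (mu y)%:num <= C * rho y ^+ m.
Proof.
move=> [P HP]; have [m [C C0 HC]] := polyfun_rho P; exists m, C => // y.
exact: le_trans (HP y) (le_trans (ler_norm _) (HC y)).
Qed.

(** Of the two factors [mut] bounding a translate of [mu], one is kept as a weight and the other, at
    the translation variable, is bounded by a power of [rho]. *)
Lemma associated_growth mu mut : associated_weight mu mut -> exists m, exists2 C, 0 <= C &
  growth m (fun y => (mu y)%:num) (fun y => C * (mut y)%:num).
Proof.
move=> [_ /poly_bounded_rho[m [C C0 HC]] _ mm]; exists m, C => //; split=> [y|y y'].
  by rewrite mulr_ge0.
by rewrite (le_trans (mm _ _))// mulrAC ler_wpM2r.
Qed.

Lemma poly_bounded_growth mu : poly_bounded mu -> exists m, exists2 C, 0 <= C &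
  growth m (fun y => (mu y)%:num) (fun y => C * rho y ^+ m).
Proof. by move=> /poly_bounded_rho[m [C C0 HC]]; exists m, C => //; exact: growth_rho. Qed.

End ConcreteSpaces.

Theorem proposition3p17 (R : realType) (A : frechetAlgType R) (k n : nat)
    (a0 : R) (lambda kappa : R[i]) (a0_neq0 : a0 != 0) :
  let S := @schwartz R A (k + k) n in
  let B := fun mu : 'rV[R]_(k + k) -> {posnum R} => symbols A n mu in
  let starD : superfun A (k + k) n -> superfun A (k + k) n ->
    superfun A (k + k) n := star a0 lambda kappa in
  [/\ exists star : {bilinear S -> S -> S},
        (forall f1 f2 : S, test_fun (val f1) -> test_fun (val f2) ->
          val (star f1 f2) = starD (val f1) (val f2)) /\
        continuous (fun f : S * S => star f.1 f.2),
      forall mu mu' mut mut' : 'rV[R]_(k + k) -> {posnum R},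
        weight mu -> poly_bounded mu -> associated_weight mu mut ->
        weight mu' -> poly_bounded mu' -> associated_weight mu' mut' ->
        let mutt := fun y => ((mut y)%:num * (mut' y)%:num)%:pos in
        exists star : {bilinear B mu -> B mu' -> B mutt},
          [/\ forall (f1 : B mu) (f2 : B mu'),
                test_fun (val f1) -> test_fun (val f2) ->
                val (star f1 f2) = starD (val f1) (val f2),
              forall (f1 : B mu) (f2 : B mu'),
                oscillating_star a0 lambda kappa (val f1) (val f2)
                  (val (star f1 f2)) &
              continuous (fun f : B mu * B mu' => star f.1 f.2)],
      forall mu : 'rV[R]_(k + k) -> {posnum R}, weight mu -> poly_bounded mu ->
        exists star : {bilinear B mu -> S -> S},
          [/\ forall (f1 : B mu) (f2 : S),
                test_fun (val f1) -> test_fun (val f2) ->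
                val (star f1 f2) = starD (val f1) (val f2),
              forall (f1 : B mu) (f2 : S),
                oscillating_star a0 lambda kappa (val f1) (val f2)
                  (val (star f1 f2)) &
              continuous (fun f : B mu * S => star f.1 f.2)] &
      forall mu : 'rV[R]_(k + k) -> {posnum R}, weight mu -> poly_bounded mu ->
        exists star : {bilinear S -> B mu -> S},
          [/\ forall (f1 : S) (f2 : B mu),
                test_fun (val f1) -> test_fun (val f2) ->
                val (star f1 f2) = starD (val f1) (val f2),
              forall (f1 : S) (f2 : B mu),
                oscillating_star a0 lambda kappa (val f1) (val f2)
                  (val (star f1 f2)) &
              continuous (fun f : S * B mu => star f.1 f.2)]].
Proof.
move=> S B starD.
have [L [Ll Lb Li]] := oscillating_functional (A := A) (k := k) a0_neq0.
have test (f1 f2 : superfun A (k + k) n) : test_fun f1 -> test_fun f2 ->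
    ostar a0 lambda kappa L f1 f2 = starD f1 f2.
  by move=> t1 t2; rewrite /starD (star_test _ _ Li).
have osc (E1 E2 : preTopologicalLmodType R[i]) J1 J2 (v1 : E1 -> superfun A (k + k) n)
    (v2 : E2 -> superfun A (k + k) n) (g1 : J1 -> _) (g2 : J2 -> _) u1 u2 w1 w2 M f1 f2 :
    weighted_space v1 g1 -> weighted_space v2 g2 -> controls g1 u1 -> controls g2 u2 ->
    growth M u1 w1 -> growth M u2 w2 ->
    oscillating_star a0 lambda kappa (v1 f1) (v2 f2) (ostar a0 lambda kappa L (v1 f1) (v2 f2)).
  move=> s1 s2 c1 c2 r1 r2; apply: (oscillating_ostar lambda kappa Ll Lb Li (M := M)) => I.
    exact: controls_tempered s1 c1 r1.
  exact: controls_tempered s2 c2 r2.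
have sS := @schwartz_space R A (k + k) n; have sB := @symbols_space R A (k + k) n.
have cS := @schwartz_controls R (k + k); have cB := @symbol_controls R (k + k).
have rS := @growth_rhoV R (k + k).
have j0 : mpoly.mpoly (k + k) R * nat * ('I_(k + k) -> nat) := (mpoly.mpolyC _ 0, 0%N, fun=> 0%N).
have r0 m (y : 'rV[R]_(k + k)) : 0 < rho y ^+ m by rewrite exprn_gt0// rho_gt0.
(* The decay needed from a Schwartz factor: [M0] powers against the growth of the other factor, [m]
   against the polynomial of the norm. *)
have target (P : mpoly.mpoly (k + k) R) M0 C0 : 0 <= C0 -> exists m C, forall y,
    `|polyfun P y| * (C0 * rho y ^+ M0 * rho y ^- (M0 + m)) <= C.
  move=> C00; have [m [C C00' HC]] := polyfun_rho P; exists m, (C * C0) => y.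
  have E (a b p : R) : 0 < a -> 0 < b -> p * (C0 * a * (a * b)^-1) = p / b * C0.
    by move=> p0 b0; field; rewrite !gt_eqF.
  by rewrite exprD E ?r0// ler_wpM2r// ler_pdivrMr.
split.
- have [|star [starE cs]] := @star_extension R A k n a0 lambda kappa L Ll Lb _ _ _ _ _ _ _ _ _ _ _ _ j0 sS sS sS.
    (* Both factors decay like [rho ^- m]; the first already beats the polynomial, and the second is
       bounded by 1. *)
    move=> [[P j] beta]; have [m [C HC]] := target P 0%N 1 ler01.
    exists (fun y => rho y ^- m), (fun y => rho y ^- m), (fun y => rho y ^- m), (fun y => rho y ^- m), m, C.
    split=> // y; rewrite (le_trans _ (HC y))//= expr0 mulr1 mul1r add0n.
    rewrite ler_wpM2l// ler_piMl// ?invr_ge0 ?(ltW (r0 _ _))// invf_le1//.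
    by rewrite exprn_ege1// rho_ge1.
  by exists star; split=> // f1 f2 t1 t2; rewrite starE test.
- move=> mu mu' mut mut' wmu pmu amu wmu' pmu' amu' mutt.
  have [m [C C0 gr]] := associated_growth amu; have [m' [C' C0' gr']] := associated_growth amu'.
  have {}gr := growth_le (leq_maxl m m') gr; have {}gr' := growth_le (leq_maxr m m') gr'.
  have [|star [starE cs]] := @star_extension R A k n a0 lambda kappa L Ll Lb _ _ _ _ _ _ _ _ _ _ _ _
      (0%N, fun=> 0%N) (sB mu) (sB mu') (sB mutt).
    (* The constants of the two growth bounds multiply, since [mutt] is the product of the
       associated weights. *)
    move=> [j beta]; do 4 eexists; exists (maxn m m'), (C * C').
    split; [exact: cB|exact: cB|exact: gr|exact: gr'|move=> y /=].
    by rewrite mulrC ler_pdivrMr// mulrACA.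
  exists star; split=> // f1 f2.
    by move=> t1 t2; rewrite starE test.
  rewrite starE; exact: osc (sB mu) (sB mu') (cB mu) (cB mu') gr gr'.
- move=> mu wmu pmu; have [M [C C0 gr]] := poly_bounded_growth pmu.
  have [|star [starE cs]] := @star_extension R A k n a0 lambda kappa L Ll Lb _ _ _ _ _ _ _ _ _ _ _ _
      j0 (sB mu) sS sS.
    move=> [[P j] beta]; have [m [C1 HC]] := target P M C C0.
    do 4 eexists; exists (M + m)%N, C1.
    split; [exact: cB|exact: (cS (M + m)%N)|exact: growth_le (leq_addr m M) gr|exact: rS|exact: HC].
  exists star; split=> // f1 f2.
    by move=> t1 t2; rewrite starE test.
  rewrite starE; exact: osc (sB mu) sS (cB mu) (cS M) gr (rS M).
- move=> mu wmu pmu; have [M [C C0 gr]] := poly_bounded_growth pmu.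
  have [|star [starE cs]] := @star_extension R A k n a0 lambda kappa L Ll Lb _ _ _ _ _ _ _ _ _ _ _ _
      j0 sS (sB mu) sS.
    move=> [[P j] beta]; have [m [C1 HC]] := target P M C C0.
    do 4 eexists; exists (M + m)%N, C1.
    split; [exact: (cS (M + m)%N)|exact: cB|exact: rS|exact: growth_le (leq_addr m M) gr|].
    by move=> y; rewrite [X in _ * X]mulrC; exact: HC.
  exists star; split=> // f1 f2.
    by move=> t1 t2; rewrite starE test.
  rewrite starE; exact: osc sS (sB mu) (cS M) (cB mu) (rS M) gr.
Qed.
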